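(* Let $b,\sigma:[0,T]\times\mathbb{R}^d\to\mathbb{R}^d$ be continuous and satisfy the assumptions $(H_1)$ and $(H_2)$ stated in the context, let $1-H<\alpha<\alpha_0$, and let $K=\{x\in\mathbb{R}^d:|x|\le1\}$ be the (closed) unit ball. Then the following assertions are equivalent: (I) $K$ is viable for the fractional stochastic differential equation $$X_s^{t,x}=x+\int_t^s b(r,X_r^{t,x})dr+\int_t^s\sigma(r,X_r^{t,x})dB^H_r,\quad s\in[t,T].$$ (II) For all $t\in[0,T]$ and all $x\in\mathbb{R}^d$ with $|x|=1$, $\langle x,b(t,x)\rangle\le0$ and $\langle x,\sigma(t,x)\rangle=0$.
   Context: Fix $T>0$, $d\ge 1$, $H\in(\frac12,1)$ and a real-valued fractional Brownian motion $B^H=\{B^H_t,t\ge 0\}$ with Hurst parameter $H$ on a complete probability space $(\Omega,\mathcal F,\mathbb P)$. Integrals with respect to $B^H$ are pathwise Riemann-Stieltjes (Young) integrals. $(H_1)$: $\sigma(t,x)$ is differentiable in $x$, and there are constants $\beta,\delta\in(0,1]$, $M_0>0$, and for every $\rho>0$ a constant $M_\rho>0$, such that for all $s,t\in[0,T]$: (i) $|\sigma(t,x)-\sigma(s,y)|\le M_0(|t-s|^\beta+|x-y|)$ for all $x,y\in\mathbb{R}^d$; (ii) $|\nabla_x\sigma(t,y)-\nabla_x\sigma(s,z)|\le M_\rho(|t-s|^\beta+|y-z|^\delta)$ for all $|y|,|z|\le \rho$. Set $\alpha_0=\min\{\frac12,\beta,\frac{\delta}{1+\delta}\}$. $(H_2)$: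 there are $\mu\in(1-\alpha_0,1]$, $L_0>0$, and for every $\rho\ge0$ a constant $L_\rho>0$, such that for all $s,t\in[0,T]$: (i) $|b(t,x)-b(s,y)|\le L_\rho(|t-s|^\mu+|x-y|)$ for all $|x|,|y|\le\rho$; (ii) $|b(t,x)|\le L_0(1+|x|)$ for all $x\in\mathbb{R}^d$. Viability: $K$ is viable for the equation if for every $t\in[0,T]$ and every $x\in K$ there exists a solution $X^{t,x}$, with trajectories a.s. in the space $C^{1-\alpha}([t,T];\mathbb{R}^d)$ of $(1-\alpha)$-Hölder continuous functions, such that a.s. $X_s^{t,x}\in K$ for all $s\in[t,T]$. *)

(* Defs.v *)
From HB Require Import structures.
From mathcomp Require Import all_boot all_order all_algebra.
From mathcomp Require Import all_classical all_reals all_analysis.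
Import Order.TTheory GRing.Theory Num.Theory.
Import numFieldNormedType.Exports.

Set Implicit Arguments.
Unset Strict Implicit.
Unset Printing Implicit Defensive.

Local Open Scope classical_set_scope.
Local Open Scope ring_scope.

Section Euclidean.
Variable R : realType.

(* The norm `|x| of the library on matrices is the sup norm, so the Euclidean
   norm (the Frobenius norm for Jacobian matrices) is introduced here. *)
Definition enorm m n (A : 'M[R]_(m, n)) : R :=
  Num.sqrt (\sum_i \sum_j A i j ^+ 2).

Definition dotp n (x y : 'rV[R]_n) : R := \sum_i x 0 i * y 0 i.

Definition unit_ball n : set 'rV[R]_n := [set x | enorm x <= 1].

End Euclidean.

Section Coefficients.
Variables (R : realType) (d : nat).
(* Coefficients on [0, T] x R^d are total functions of the time variable;
   their values at times outside [0, T] are never used. *)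
Implicit Types b sigma : R -> 'rV[R]_d -> 'rV[R]_d.

Definition continuous_coef (T : R) b : Prop :=
  {within [set p : R * 'rV[R]_d | p.1 \in `[0, T]],
    continuous (fun p : R * 'rV[R]_d => b p.1 p.2)}.

Definition alpha0 (beta delta : R) : R :=
  Num.min (2^-1) (Num.min beta (delta / (1 + delta))).

Definition assumption_H1 (T beta delta : R) sigma : Prop :=
  [/\ 0 < beta <= 1, 0 < delta <= 1,
      (forall t : R, t \in `[0, T] -> forall x : 'rV[R]_d, differentiable (sigma t) x),
      (exists2 M0 : R, 0 < M0 &
         forall s t : R, s \in `[0, T] -> t \in `[0, T] -> forall x y,
           enorm (sigma t x - sigma s y)
             <= M0 * (`|t - s| `^ beta + enorm (x - y))) &
      (forall rho : R, 0 < rho -> exists2 M : R, 0 < M &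
         forall s t : R, s \in `[0, T] -> t \in `[0, T] -> forall y z,
           enorm y <= rho -> enorm z <= rho ->
           enorm ('J (sigma t) y - 'J (sigma s) z)
             <= M * (`|t - s| `^ beta + enorm (y - z) `^ delta))].

Definition assumption_H2 (T beta delta : R) b : Prop :=
  exists2 mu : R, 1 - alpha0 beta delta < mu <= 1 &
    (forall rho : R, 0 <= rho -> exists2 L : R, 0 < L &
       forall s t : R, s \in `[0, T] -> t \in `[0, T] -> forall x y,
         enorm x <= rho -> enorm y <= rho ->
         enorm (b t x - b s y) <= L * (`|t - s| `^ mu + enorm (x - y))) /\
    (exists2 L0 : R, 0 < L0 &
       forall t : R, t \in `[0, T] -> forall x,
         enorm (b t x) <= L0 * (1 + enorm x)).

End Coefficients.

Section RiemannStieltjes.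
Variable R : realType.
Implicit Types f g : R -> R.

(* a :: l is the subdivision and xi k the tag of its k-th subinterval. *)
Definition RS_sum f g (a b : R) (l : seq R) (xi : nat -> R) : R :=
  let p := nth b (a :: l) in
  \sum_(0 <= k < size l) f (xi k) * (g (p k.+1) - g (p k)).

Definition tagged_partition (a b : R) (l : seq R) (xi : nat -> R) : Prop :=
  itv_partition a b l /\
  let p := nth b (a :: l) in
  forall k, (k < size l)%N -> p k <= xi k <= p k.+1.

Definition mesh_lt (a b : R) (l : seq R) (eta : R) : Prop :=
  let p := nth b (a :: l) in
  forall k, (k < size l)%N -> p k.+1 - p k < eta.

(* The integral of f with respect to g over [a, b] exists and equals I. *)
Definition is_RS_integral f g (a b I : R) : Prop :=
  forall eps : R, 0 < eps -> exists2 eta : R, 0 < eta &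
    forall l xi, tagged_partition a b l xi -> mesh_lt a b l eta ->
      `|RS_sum f g a b l xi - I| < eps.

End RiemannStieltjes.

Section FractionalBrownianMotion.
Variables (R : realType) (disp : measure_display) (Omega : measurableType disp).
Variable P : probability Omega R.

(* Mean m and standard deviation s.  The degenerate case is separated because
   normal_prob m 0 is the uniform law on [0, 1]. *)
Definition gaussian_law (m s : R) (A : set R) : \bar R :=
  if s == 0 then \d_m A else normal_prob m s A.

Definition gaussian_rv (Y : Omega -> R) : Prop :=
  exists m s : R, forall A : set R, measurable A ->
    pushforward P Y A = gaussian_law m s A.

(* Processes indexed by [0, +oo[ are families indexed by R whose members at
   negative times are never used. *)
Definition gaussian_process (B : R -> {RV P >-> R}) : Prop :=
  forall (n : nat) (t c : 'I_n -> R), (forall i, 0 <= t i) ->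
    gaussian_rv (fun w => \sum_i c i * B (t i) w).

Definition fractional_brownian_motion (H : R) (B : R -> {RV P >-> R}) : Prop :=
  [/\ gaussian_process B,
      (forall t : R, 0 <= t -> ('E_P[B t] = 0)%E),
      (forall s t : R, 0 <= s -> 0 <= t ->
         covariance P (B s) (B t) =
         ((s `^ (2 * H) + t `^ (2 * H) - `|t - s| `^ (2 * H)) / 2)%:E) &
      \forall w \ae P, {within `[0, +oo[, continuous (fun t : R => B t w : R)}].

End FractionalBrownianMotion.

Section Viability.
Variables (R : realType) (disp : measure_display) (Omega : measurableType disp).
Variables (P : probability Omega R) (d : nat).

Definition holder_on (t T gamma : R) (x : R -> 'rV[R]_d) : Prop :=
  exists C : R, forall r s : R, r \in `[t, T] -> s \in `[t, T] ->
    enorm (x s - x r) <= C * `|s - r| `^ gamma.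

(* y = x0 + \int_t^s b(r, x r) dr + \int_t^s sigma(r, x r) dg(r) for y = x s,
   coordinatewise; the existence of the second integral is part of it. *)
Definition integral_equation (b sigma : R -> 'rV[R]_d -> 'rV[R]_d)
    (g : R -> R) (t : R) (x0 : 'rV[R]_d) (x : R -> 'rV[R]_d) (s : R) : Prop :=
  exists I : 'rV[R]_d,
    (forall i, is_RS_integral (fun r => sigma r (x r) 0 i) g t s (I 0 i)) /\
    x s = x0
        + \row_i (\int[lebesgue_measure]_(r in `[t, s]) (b r (x r) 0 i)) + I.

Definition solution (T alpha : R) (b sigma : R -> 'rV[R]_d -> 'rV[R]_d)
    (B : R -> Omega -> R) (t : R) (x0 : 'rV[R]_d)
    (X : R -> Omega -> 'rV[R]_d) : Prop :=
  [/\ (forall s : R, s \in `[t, T] ->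
         forall i, measurable_fun setT (fun w => X s w 0 i)),
      (\forall w \ae P, holder_on t T (1 - alpha) (X ^~ w)) &
      (\forall w \ae P, forall s : R, s \in `[t, T] ->
         integral_equation b sigma (B ^~ w) t x0 (X ^~ w) s)].

Definition viable (T alpha : R) (b sigma : R -> 'rV[R]_d -> 'rV[R]_d)
    (B : R -> Omega -> R) (K : set 'rV[R]_d) : Prop :=
  forall t : R, t \in `[0, T] -> forall x, K x ->
    exists2 X : R -> Omega -> 'rV[R]_d,
      solution T alpha b sigma B t x X &
      \forall w \ae P, forall s : R, s \in `[t, T] -> K (X s w).

End Viability.

(* Main.v *)
(* Write gam = 1 - alpha < H. Almost every path g of the fractional Brownian
   motion is gam-Holder (Kolmogorov). With lam = min(beta, delta gam, mu) one has
   lam + gam > 1, and x solves the equation driven by g as soon as, for u <= v,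
     x v - x u = (v - u) b(u, x u) + (g v - g u) sigma(u, x u)
                 + O((v - u)^(lam + gam));
   a solution that is gam-Holder satisfies this expansion.

   Necessity. A solution started at x on the sphere at time t and staying in the
   ball satisfies <x, X s - x> <= 0, whence
     (s - t) <x, b> + (g s - g t) <x, sigma> <= O((s - t)^(lam + gam)).
   Gaussian increments exceed (s - t)^H, which dominates s - t, with probability
   bounded below as s tends to t, in both directions. This forces
   <x, sigma> = 0, then <x, b> <= 0. The time T is reached by continuity.

   Sufficiency. Consider the Euler scheme of step h projected on the ball at each
   step. By tangency the projection is a correction of order h^(2 gam), and
   discrete sewing gives the expansion uniformly in h. Sewing applied to the
   difference of the schemes of steps h and h/2, with the Holder gradient of
   sigma controlling second differences, gives geometric convergence along
   dyadic steps. The limit is defined path by path, stays in the ball, is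
   measurable in omega, and satisfies the expansion. *)
Require Import Defs.
From mathcomp Require Import all_boot all_order all_algebra.
From mathcomp Require Import all_classical all_reals all_analysis.
From mathcomp Require Import measurable_realfun ring lra zify.
Set Implicit Arguments.
Unset Strict Implicit.
Unset Printing Implicit Defensive.
Import Order.TTheory GRing.Theory Num.Theory.
Import numFieldNormedType.Exports.
Local Open Scope classical_set_scope.
Local Open Scope ring_scope.

(** Compactness of the schemes would give a limit along a subsequence depending on omega, and the
    measurability of the solution would be lost. Hence the whole sequence of dyadic steps is made to
    converge, at a geometric rate on each path. The two schemes to be compared live on different
    grids. The class [approx_euler] settles this: it retains only membership of the ball and a
    one-step error of order [h ^ (lam + gam)], and it is preserved, with a larger constant, when
    every second point is dropped and the step doubled; both schemes then belong to the class with
    the same step. The rate comes from sewing their difference at an exponent [th'] strictly between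
    1 and [lam + gam], which leaves a factor [h ^ rho] in front of the one-step errors. On the
    probabilistic side, the law of an increment is normal with parameters that are only compared
    with its variance, up to numerical constants; this serves both the tails behind Hoelder
    continuity and the lower bound behind necessity. *)

Section EuclideanNorm.
Variable R : realType.

Lemma cauchy_schwarz_sum (I : finType) (a b : I -> R) :
  (\sum_i a i * b i) ^+ 2 <= (\sum_i a i ^+ 2) * (\sum_i b i ^+ 2).
Proof.
set A := \sum_i a i ^+ 2; set C := \sum_i a i * b i; set D := \sum_i b i ^+ 2.
have D0 : 0 <= D by apply: sumr_ge0 => i _; rewrite sqr_ge0.
have : 0 <= \sum_i (D * a i - C * b i) ^+ 2.
  by apply: sumr_ge0 => i _; rewrite sqr_ge0.
have -> : \sum_i (D * a i - C * b i) ^+ 2 = D * (A * D - C ^+ 2).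
  rewrite (eq_bigr (fun i => D ^+ 2 * a i ^+ 2 - 2 * D * C * (a i * b i)
     + C ^+ 2 * b i ^+ 2)); last by move=> i _; ring.
  rewrite big_split sumrB /= -!mulr_sumr -/A -/C -/D; ring.
have [D00 _|Dn0] := eqVneq D 0; last first.
  by rewrite pmulr_rge0 ?lt0r ?Dn0 // subr_ge0.
suff -> : C = 0 by rewrite D00 mulr0 expr0n.
rewrite /C big1 // => i _.
have /eqP := D00; rewrite psumr_eq0; last by move=> j _; rewrite sqr_ge0.
by move=> /allP/(_ i); rewrite mem_index_enum sqrf_eq0 => /(_ isT)/eqP ->; rewrite mulr0.
Qed.

Section Matrices.
Variables m n : nat.
Implicit Types A B : 'M[R]_(m, n).

Lemma enorm_ge0 A : 0 <= enorm A.
Proof. exact: sqrtr_ge0. Qed.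

Lemma enorm_pairE A : enorm A = Num.sqrt (\sum_p A p.1 p.2 ^+ 2).
Proof. by rewrite /enorm pair_bigA. Qed.

Lemma sqr_enorm A : enorm A ^+ 2 = \sum_p A p.1 p.2 ^+ 2.
Proof.
by rewrite enorm_pairE sqr_sqrtr //; apply: sumr_ge0 => p _; rewrite sqr_ge0.
Qed.

Lemma coord_le_enorm A i j : `|A i j| <= enorm A.
Proof.
rewrite -(@ler_pXn2r _ 2) // ?nnegrE ?enorm_ge0 // sqr_enorm real_normK ?num_real //.
rewrite (bigD1 (i, j)) //= lerDl; apply: sumr_ge0 => p _; exact: sqr_ge0.
Qed.

Lemma ler_enormD A B : enorm (A + B) <= enorm A + enorm B.
Proof.
rewrite -(@ler_pXn2r _ 2) // ?nnegrE ?addr_ge0 ?enorm_ge0 //.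
rewrite sqrrD !sqr_enorm.
rewrite (eq_bigr (fun p => A p.1 p.2 ^+ 2 + 2 * (A p.1 p.2 * B p.1 p.2)
   + B p.1 p.2 ^+ 2)); last by move=> p _; rewrite mxE; ring.
rewrite !big_split /= lerD2r lerD2l -mulr_sumr -[leRHS]mulr_natl ler_pM2l //.
apply: le_trans (ler_norm _) _.
rewrite -(@ler_pXn2r _ 2) // ?nnegrE ?mulr_ge0 ?enorm_ge0 // exprMn !sqr_enorm.
by rewrite real_normK ?num_real //; apply: cauchy_schwarz_sum.
Qed.

Lemma enormZ (c : R) A : enorm (c *: A) = `|c| * enorm A.
Proof.
apply/eqP; rewrite -(@eqrXn2 _ 2) // ?mulr_ge0 ?enorm_ge0 //.
rewrite exprMn !sqr_enorm real_normK ?num_real // mulr_sumr.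
by apply/eqP/eq_bigr => p _; rewrite mxE exprMn.
Qed.

Lemma enorm0 : enorm (0 : 'M[R]_(m, n)) = 0.
Proof. by rewrite -(scale0r 0) enormZ normr0 mul0r. Qed.

Lemma enormN A : enorm (- A) = enorm A.
Proof. by rewrite -scaleN1r enormZ normrN1 mul1r. Qed.

Lemma ler_enormB A B : enorm (A - B) <= enorm A + enorm B.
Proof. by rewrite -[enorm B]enormN ler_enormD. Qed.

Lemma enorm_distC A B : enorm (A - B) = enorm (B - A).
Proof. by rewrite -enormN opprB. Qed.

Lemma ler_enorm_sub A B : enorm A <= enorm B + enorm (A - B).
Proof. by rewrite -{1}(subrK B A) addrC ler_enormD. Qed.

Lemma ler_enorm_sum (I : Type) (s : seq I) (F : I -> 'M[R]_(m, n)) :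
  enorm (\sum_(i <- s) F i) <= \sum_(i <- s) enorm (F i).
Proof.
elim: s => [|i s IH]; first by rewrite !big_nil enorm0.
by rewrite !big_cons (le_trans (ler_enormD _ _)) // lerD2l.
Qed.

End Matrices.

Lemma sqr_enorm_row n (x : 'rV[R]_n) : enorm x ^+ 2 = dotp x x.
Proof.
rewrite /enorm sqr_sqrtr; last first.
  by apply: sumr_ge0 => i _; apply: sumr_ge0 => j _; rewrite sqr_ge0.
by rewrite big_ord1; apply: eq_bigr => i _; rewrite expr2.
Qed.

Lemma enorm_le_coord n (x : 'rV[R]_n) (e : R) :
  (forall i, `|x 0 i| <= e) -> enorm x <= n%:R * e.
Proof.
move=> xe; case: n x xe => [x _|n x xe].
  rewrite mul0r /enorm big_ord1 big_ord0 sqrtr0 //.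
have e0 : 0 <= e by apply: le_trans (xe ord0).
rewrite -(@ler_pXn2r _ 2) // ?nnegrE ?mulr_ge0 ?enorm_ge0 //.
rewrite sqr_enorm_row /dotp.
apply: (@le_trans _ _ (\sum_(i < n.+1) e ^+ 2)).
  apply: ler_sum => i _; rewrite -expr2 -(@real_normK _ (x 0 i)) ?num_real //.
  by rewrite ler_pXn2r ?nnegrE.
rewrite sumr_const card_ord exprMn -[leLHS]mulr_natl ler_wpM2r ?sqr_ge0 //.
by rewrite -natrX ler_nat expnS expn1 leq_pmulr.
Qed.

Section DotProduct.
Variable n : nat.
Implicit Types x y z : 'rV[R]_n.

Lemma dotpC x y : dotp x y = dotp y x.
Proof. by apply: eq_bigr => i _; rewrite mulrC. Qed.

Lemma dotpDr x y z : dotp x (y + z) = dotp x y + dotp x z.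
Proof. by rewrite /dotp -big_split; apply: eq_bigr => i _; rewrite mxE mulrDr. Qed.

Lemma dotpZr c x y : dotp x (c *: y) = c * dotp x y.
Proof. by rewrite /dotp mulr_sumr; apply: eq_bigr => i _; rewrite mxE mulrCA. Qed.

Lemma dotpZl c x y : dotp (c *: x) y = c * dotp x y.
Proof. by rewrite dotpC dotpZr dotpC. Qed.

Lemma dotpBr x y z : dotp x (y - z) = dotp x y - dotp x z.
Proof. by rewrite dotpDr -[- z]scaleN1r dotpZr mulN1r. Qed.

Lemma dotp0l y : dotp 0 y = 0.
Proof. by rewrite -(scale0r 0) dotpZl mul0r. Qed.

Lemma norm_dotp_le x y : `|dotp x y| <= enorm x * enorm y.
Proof.
rewrite -(@ler_pXn2r _ 2) // ?nnegrE ?mulr_ge0 ?enorm_ge0 // exprMn.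
rewrite real_normK ?num_real // !sqr_enorm_row /dotp.
under [X in _ <= X * _]eq_bigr do rewrite -expr2.
under [X in _ <= _ * X]eq_bigr do rewrite -expr2.
exact: cauchy_schwarz_sum.
Qed.

Lemma sqr_enormD x y : enorm (x + y) ^+ 2 = enorm x ^+ 2 + 2 * dotp x y + enorm y ^+ 2.
Proof.
by rewrite !sqr_enorm_row !dotpDr !(dotpC (x + y)) !dotpDr (dotpC y x); ring.
Qed.

End DotProduct.

Lemma norm_coord_mulmx_le m n (v : 'rV[R]_m) (A : 'M[R]_(m, n)) i :
  `|(v *m A) 0 i| <= enorm v * enorm A.
Proof.
have -> : (v *m A) 0 i = dotp v (col i A)^T.
  by rewrite mxE; apply: eq_bigr => j _; rewrite !mxE.
apply: (le_trans (norm_dotp_le _ _)); rewrite ler_wpM2l ?enorm_ge0 //.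
rewrite -(@ler_pXn2r _ 2) // ?nnegrE ?enorm_ge0 // sqr_enorm_row sqr_enorm.
rewrite -(pair_bigA _ (fun i j => A i j ^+ 2)) /=; apply: ler_sum => j _.
rewrite !mxE -expr2 (bigD1 i) //= lerDl; apply: sumr_ge0 => k _; exact: sqr_ge0.
Qed.

End EuclideanNorm.

(** * Real powers and discrete sewing *)

Section PowerHelpers.
Variable R : realType.
Implicit Types x y w r s : R.

Lemma powRD_gt0 x r s : 0 < r -> 0 < s -> x `^ (r + s) = x `^ r * x `^ s.
Proof. by move=> r0 s0; rewrite powRD // gt_eqF ?addr_gt0. Qed.

Lemma le_powR_base x y r : 0 <= r -> 0 <= x -> x <= y -> x `^ r <= y `^ r.
Proof. by move=> r0 x0 xy; rewrite ge0_ler_powR ?nnegrE // (le_trans x0). Qed.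

Lemma ge_powR_exponent w r s : 0 <= w <= 1 -> 0 < s -> s <= r -> w `^ r <= w `^ s.
Proof.
move=> /andP[w0 w1] s0 sr; have [->|wn0] := eqVneq w 0.
  by rewrite !powR0 ?gt_eqF // (lt_le_trans s0).
by apply: ger_powR => //; rewrite w1 lt0r wn0 w0.
Qed.

Lemma powR_le1 w r : 0 <= w <= 1 -> 0 <= r -> w `^ r <= 1.
Proof. by move=> /andP[w0 w1] r0; have := le_powR_base r0 w0 w1; rewrite powR1. Qed.

End PowerHelpers.

(* Splitting an interval of n steps as evenly as possible gives two parts of
   length at most 2n/3, whence the contraction factor (2/3)^(theta-1). *)
Lemma powR_split_le (R : realType) (th : R) (p q : nat) : 1 < th ->
  (q <= p.+1)%N -> (0 < p)%N -> (p <= q)%N ->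
  p%:R `^ th + q%:R `^ th <= (2 / 3) `^ (th - 1) * (p + q)%:R `^ th.
Proof.
move=> th1 qp p0 pq; have th0 : 0 < th - 1 by rewrite subr_gt0.
have q23 : q%:R <= 2 / 3 * (p + q)%:R :> R.
  suff : (3 * q <= 2 * (p + q))%N by rewrite -(ler_nat R) !natrM; lra.
  lia.
have powS (n : nat) : n%:R * n%:R `^ (th - 1) = n%:R `^ th :> R.
  by rewrite mulr_powRB1 // (lt_trans ltr01).
rewrite -!powS.
have q0 : (0 : R) <= q%:R by [].
have p0' : (0 : R) <= p%:R by [].
have pl : p%:R `^ (th - 1) <= q%:R `^ (th - 1) :> R.
  by apply: le_powR_base; rewrite ?ler_nat // ltW.
apply: (@le_trans _ _ ((p + q)%:R * q%:R `^ (th - 1))).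
  by rewrite natrD mulrDl lerD2r ler_wpM2l.
rewrite mulrCA ler_wpM2l // -powRM ?divr_ge0 //.
by apply: le_powR_base => //; apply: ltW.
Qed.

(** Induction on [m - k], cutting the interval as evenly as possible. The factor [1 + c] lets the
    error of a junction depend on the left piece itself: in the applications the increment of the
    integrand over that piece is only known up to its own defect. The condition on [F] says that the
    contraction [(2 / 3) ^ (th - 1)] of the powers leaves room for both [c] and [F]. *)
Lemma discrete_sewing (R : realType) (th c F K : R) (N : nat)
    (a : nat -> nat -> R) :
  1 < th -> 0 <= c -> 0 <= F -> 0 <= K ->
  F <= (1 - (2 / 3) `^ (th - 1) - c) * K ->
  (forall k, (k < N)%N -> a k k.+1 <= K) ->
  (forall k l m, (k < l)%N -> (l < m)%N -> (m <= N)%N ->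
     a k m <= (1 + c) * a k l + a l m + F * (m - k)%:R `^ th) ->
  forall k m, (k < m)%N -> (m <= N)%N -> a k m <= K * (m - k)%:R `^ th.
Proof.
move=> th1 c0 F0 K0 FK a1 a3 k m.
have [n] := ubnP (m - k); elim: n k m => // n IH k m nk km mN.
have [->|mk] := eqVneq m k.+1.
  by rewrite subSnn powR1 mulr1; apply: a1; lia.
pose p := (m - k)./2; pose q := (m - k - p)%N.
have m2 : (2 <= m - k)%N by move/eqP: mk; lia.
have hp : (p.*2 + odd (m - k) = m - k)%N by rewrite /p addnC odd_double_half.
have [p0 qp pq] : [/\ (0 < p)%N, (q <= p.+1)%N & (p <= q)%N].
  by rewrite /q; case: (odd _) hp => /= hp; clear - hp m2; split; lia.
have pqE : (p + q = m - k)%N by rewrite /q; lia.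
have kl : (k < k + p)%N by lia.
have lm : (k + p < m)%N by lia.
apply: (le_trans (a3 _ _ _ kl lm mN)).
have h1 : a k (k + p)%N <= K * p%:R `^ th.
  by rewrite -{2}(addKn k p); apply: IH; lia.
have h2 : a (k + p)%N m <= K * q%:R `^ th.
  by rewrite /q -subnDA; apply: IH; lia.
have hs := powR_split_le th1 qp p0 pq.
rewrite pqE in hs.
set W := (m - k)%:R `^ th in hs *.
have W0 : 0 <= W by apply: powR_ge0.
have pW : p%:R `^ th <= W.
  apply: le_powR_base; rewrite ?ler0n ?(ltW (lt_trans ltr01 th1)) //.
  by rewrite ler_nat -pqE leq_addr.
have hK : K * (p%:R `^ th + q%:R `^ th) <= K * ((2 / 3) `^ (th - 1) * W).
  by rewrite ler_wpM2l.
have hc : c * (K * p%:R `^ th) <= c * (K * W) by rewrite ler_wpM2l // ler_wpM2l.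
have hF : F * W <= (1 - (2 / 3) `^ (th - 1) - c) * K * W by rewrite ler_wpM2r.
have ha : (1 + c) * a k (k + p)%N <= (1 + c) * (K * p%:R `^ th).
  by rewrite ler_wpM2l // addr_ge0.
lra.
Qed.

Lemma exists_small_powR (R : realType) (A c gam : R) : 0 < A -> 0 < c -> 0 < gam ->
  exists2 tau : R, 0 < tau <= 1 & A * tau `^ gam <= c.
Proof.
move=> A0 c0 g0; have cA : 0 < c / A by rewrite divr_gt0.
exists (Num.min 1 ((c / A) `^ gam^-1)).
  by rewrite lt_min ltr01 powR_gt0 //= ge_min lexx.
have cAE : c / A = ((c / A) `^ gam^-1) `^ gam.
  by rewrite -powRrM mulVf ?gt_eqF // powRr1 // ltW.
rewrite -ler_pdivlMl // [leRHS]mulrC [leRHS]cAE.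
apply: le_powR_base; first exact: ltW.
  by rewrite le_min ler01 powR_ge0.
by rewrite ge_min lexx orbT.
Qed.

(* The coefficients are only controlled on the unit ball; [young_diff2] is what
   Hoelder continuity of the gradient of sigma gives on second differences. *)
Record young_data (R : realType) (d : nat) (b sigma : R -> 'rV[R]_d -> 'rV[R]_d)
    (g : R -> R) (lam gam del M : R) : Prop := YoungData {
  young_gam : 2^-1 < gam <= 1;
  young_lam : 0 < lam <= gam;
  young_exp : 1 < lam + gam;
  young_del : 0 < del <= 1;
  young_lam_del : lam <= del * gam;
  young_M : 1 <= M;
  young_g : forall s t, 0 <= s -> s <= t -> `|g t - g s| <= M * (t - s) `^ gam;
  young_b_bd : forall t x, 0 <= t -> enorm x <= 1 -> enorm (b t x) <= M;
  young_sigma_bd : forall t x, 0 <= t -> enorm x <= 1 -> enorm (sigma t x) <= M;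
  young_b : forall s t x y, 0 <= s -> s <= t -> t <= s + 1 ->
    enorm x <= 1 -> enorm y <= 1 ->
    enorm (b t x - b s y) <= M * ((t - s) `^ lam + enorm (x - y));
  young_sigma : forall s t x y, 0 <= s -> s <= t -> t <= s + 1 ->
    enorm x <= 1 -> enorm y <= 1 ->
    enorm (sigma t x - sigma s y) <= M * ((t - s) `^ lam + enorm (x - y));
  young_diff2 : forall s t x y x' y', 0 <= s -> s <= t -> t <= s + 1 ->
    enorm x <= 1 -> enorm y <= 1 -> enorm x' <= 1 -> enorm y' <= 1 ->
    enorm ((sigma t x' - sigma t y') - (sigma s x - sigma s y)) <=
      M * (enorm ((x' - y') - (x - y)) +
           enorm (x - y) * ((t - s) `^ lam + enorm (x' - x) `^ del
                            + enorm (y' - y) `^ del));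
  young_b_in : forall t x, 0 <= t -> enorm x = 1 -> dotp x (b t x) <= 0;
  young_sigma_tan : forall t x, 0 <= t -> enorm x = 1 -> dotp x (sigma t x) = 0
}.

(** * Projection on the ball and tangency *)

Section ProjectedEuler.
Variables (R : realType) (d : nat).
Implicit Types x y z : 'rV[R]_d.

Definition ball_proj x : 'rV[R]_d := (Num.max 1 (enorm x))^-1 *: x.

Lemma enorm_ball_proj x : enorm (ball_proj x) <= 1.
Proof.
have m1 : 1 <= Num.max 1 (enorm x) by rewrite le_max lexx.
rewrite enormZ ger0_norm ?invr_ge0 ?(le_trans ler01) //.
by rewrite ler_pdivrMl ?(lt_le_trans ltr01) // mulr1 le_max lexx orbT.
Qed.

Lemma ball_proj_dist x (e : R) : 0 <= e -> enorm x <= 1 + e -> enorm (ball_proj x - x) <= e.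
Proof.
move=> e0 xe; rewrite /ball_proj; case: (leP (enorm x) 1) => [x1|x1].
  by rewrite invr1 scale1r subrr enorm0.
rewrite -[X in _ - X]scale1r -scalerBl enormZ.
have x0 : 0 < enorm x by apply: lt_trans x1.
rewrite ler0_norm; last by rewrite subr_le0 invf_le1 // ltW.
rewrite opprB mulrBl mul1r mulVf ?gt_eqF //; lra.
Qed.

(* The inner product of x with the field is O(1 - |x|) since it is
   nonpositive on the sphere and the field is Lipschitz. *)
Lemma dotp_le_dist_sphere (f : 'rV[R]_d -> 'rV[R]_d) (M : R) x : 0 <= M ->
  (forall y z, enorm y <= 1 -> enorm z <= 1 -> enorm (f y - f z) <= M * enorm (y - z)) ->
  (forall y, enorm y = 1 -> dotp y (f y) <= 0) ->
  enorm x <= 1 -> dotp x (f x) <= M * (1 - enorm x).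
Proof.
move=> M0 fL fS x1; set r := enorm x in x1 *.
have [r0|rn0] := eqVneq r 0.
  have -> : x = 0.
    apply/rowP => i; rewrite mxE; apply/eqP; rewrite -normr_le0 -r0.
    exact: coord_le_enorm.
  by rewrite dotp0l mulr_ge0 // subr_ge0.
have rp : 0 < r by rewrite lt0r rn0 enorm_ge0.
pose y := r^-1 *: x.
have y1 : enorm y = 1 by rewrite enormZ ger0_norm ?invr_ge0 ?ltW // mulVf.
have xy : enorm (x - y) = 1 - r.
  rewrite /y -{1}(scale1r x) -scalerBl enormZ -/r distrC ger0_norm.
    by rewrite mulrBl mulVf // mul1r.
  by rewrite subr_ge0 invf_ge1.
rewrite -[f x](subrK (f y)) dotpDr.
have h1 : dotp x (f x - f y) <= M * (1 - r).
  apply: le_trans (ler_norm _) _; apply: (le_trans (norm_dotp_le _ _)).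
  rewrite -[leRHS]mul1r; apply: ler_pM; rewrite ?enorm_ge0 // -xy.
  by apply: fL; rewrite ?y1.
have h2 : dotp x (f y) <= 0.
  have -> : x = r *: y by rewrite scalerA divff // scale1r.
  by rewrite dotpZl pmulr_rle0 // fS.
lra.
Qed.

Lemma dotpNr x y : dotp x (- y) = - dotp x y.
Proof. by rewrite -scaleN1r dotpZr mulN1r. Qed.

Lemma norm_dotp_le_dist_sphere (f : 'rV[R]_d -> 'rV[R]_d) (M : R) x : 0 <= M ->
  (forall y z, enorm y <= 1 -> enorm z <= 1 -> enorm (f y - f z) <= M * enorm (y - z)) ->
  (forall y, enorm y = 1 -> dotp y (f y) = 0) ->
  enorm x <= 1 -> `|dotp x (f x)| <= M * (1 - enorm x).
Proof.
move=> M0 fL fS x1; rewrite ler_norml lerNl -dotpNr; apply/andP; split.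
  apply: (@dotp_le_dist_sphere (fun x => - f x)) => // [y z y1 z1|y y1].
    by rewrite -opprD enormN; apply: fL.
  by rewrite dotpNr fS ?oppr0.
by apply: dotp_le_dist_sphere => // y y1; rewrite fS.
Qed.

(** Put [e = (h + |D|) * M]. In the squared norm after the step, the first-order part is at most
    [2 * e * (1 - enorm x)], hence at most [1 - enorm x] since [e <= 1/2]; with
    [enorm x ^+ 2 <= enorm x] these terms add up to at most 1. Only the quadratic term [e ^+ 2] can
    push the point out of the ball. *)
Lemma ball_proj_step_le (u v : 'rV[R]_d) (h D M : R) x : 0 <= h -> 0 <= M ->
  enorm x <= 1 -> enorm u <= M -> enorm v <= M ->
  dotp x u <= M * (1 - enorm x) -> `|dotp x v| <= M * (1 - enorm x) ->
  (h + `|D|) * M <= 2^-1 ->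
  enorm (ball_proj (x + (h *: u + D *: v)) - (x + (h *: u + D *: v)))
    <= ((h + `|D|) * M) ^+ 2.
Proof.
move=> h0 M0 x1 uM vM xu xv; set e := (h + `|D|) * M => e2.
have e0 : 0 <= e by rewrite mulr_ge0 // addr_ge0.
apply: ball_proj_dist; first exact: sqr_ge0.
have e20 : 0 <= e ^+ 2 by apply: sqr_ge0.
suff : enorm (x + (h *: u + D *: v)) ^+ 2 <= 1 + e ^+ 2.
  move=> H; rewrite -(@ler_pXn2r _ 2) // ?nnegrE ?enorm_ge0 ?addr_ge0 //.
  by apply: (le_trans H); rewrite [leRHS]expr2; nra.
rewrite sqr_enormD dotpDr !dotpZr.
have h1 : enorm (h *: u + D *: v) ^+ 2 <= e ^+ 2.
  rewrite ler_pXn2r ?nnegrE ?enorm_ge0 // (le_trans (ler_enormD _ _)) //.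
  rewrite !enormZ (ger0_norm h0) /e mulrDl lerD // ler_wpM2l //.
have h2 : h * dotp x u <= h * (M * (1 - enorm x)) by rewrite ler_wpM2l.
have h3 : D * dotp x v <= `|D| * (M * (1 - enorm x)).
  by rewrite (le_trans (ler_norm _)) // normrM ler_wpM2l.
have r0 := enorm_ge0 x.
have h4 : 2 * (h * dotp x u + D * dotp x v) <= 1 - enorm x.
  have : h * dotp x u + D * dotp x v <= e * (1 - enorm x) by rewrite /e; nra.
  have : e * (1 - enorm x) <= 2^-1 * (1 - enorm x) by rewrite ler_wpM2r // subr_ge0.
  lra.
suff : enorm x ^+ 2 <= enorm x by lra.
by rewrite expr2 ler_piMl.
Qed.
End ProjectedEuler.

Ltac nat_lia :=
  repeat match goal with H : ?P |- _ =>
    lazymatch type of P with Prop =>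
      lazymatch P with
      | is_true (leq _ _) => fail
      | @eq nat _ _ => fail
      | _ => clear H
      end
    end
  end; lia.

(** * Approximate Euler schemes: uniform expansion, coarsening, stability *)

Section ApproximateEuler.
Variables (R : realType) (d : nat) (b sigma : R -> 'rV[R]_d -> 'rV[R]_d).
Variables (g : R -> R) (lam gam del M : R).
Hypothesis YD : young_data b sigma g lam gam del M.
Implicit Types (X Y : nat -> 'rV[R]_d) (h : R) (k l m : nat).

Let gam0 : 0 < gam.
Proof. by have /andP[+ _] := young_gam YD; apply: lt_trans; rewrite invr_gt0. Qed.
Let gam1 : gam <= 1. Proof. by case/andP: (young_gam YD). Qed.
Let lam0 : 0 < lam. Proof. by case/andP: (young_lam YD). Qed.
Let lamgam : lam <= gam. Proof. by case/andP: (young_lam YD). Qed.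
Let M1 : 1 <= M. Proof. exact: young_M YD. Qed.
Let M0 : 0 <= M. Proof. exact: le_trans ler01 M1. Qed.
Local Ltac goal_lra := clear - YD gam0 gam1 lam0 lamgam M1 M0; lra.

Definition euler_incr h k (x : 'rV[R]_d) : 'rV[R]_d :=
  h *: b (k%:R * h) x + (g (k.+1%:R * h) - g (k%:R * h)) *: sigma (k%:R * h) x.

Fixpoint euler (x0 : 'rV[R]_d) h k : 'rV[R]_d :=
  if k is k'.+1 then ball_proj (euler x0 h k' + euler_incr h k' (euler x0 h k'))
  else x0.

(** What remains of the projected scheme once the projection is forgotten. This class survives the
    removal of every second point, which the recursion defining [euler] does not. *)
Definition approx_euler A h X :=
  (forall k, enorm (X k) <= 1) /\
  (forall k, enorm (X k.+1 - (X k + euler_incr h k (X k))) <= A * h `^ (lam + gam)).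

Lemma young_g_grid h k l : 0 <= h -> (k <= l)%N ->
  `|g (l%:R * h) - g (k%:R * h)| <= M * ((l - k)%:R * h) `^ gam.
Proof.
move=> h0 kl; have := @young_g _ _ _ _ _ _ _ _ _ YD (k%:R * h) (l%:R * h).
rewrite natrB // mulrBl; apply; first by rewrite mulr_ge0.
by rewrite ler_wpM2r // ler_nat.
Qed.

Lemma powR_ge_id h : 0 <= h <= 1 -> h <= h `^ gam.
Proof.
move=> /andP[h0 h1]; have [->|hn0] := eqVneq h 0; first exact: powR_ge0.
by apply: ger1_powR => //; rewrite lt0r hn0 h0.
Qed.

(* By tangency the projection moves a point by O(h^(2 gam)) only, and
   2 gam >= lam + gam. *)
Lemma approx_euler_euler x0 h : enorm x0 <= 1 -> 0 < h <= 1 ->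
  2 * M ^+ 2 * h `^ gam <= 2^-1 ->
  approx_euler (4 * M ^+ 4) h (euler x0 h).
Proof.
move=> x01 /andP[h0 h1] hs; have h0' := ltW h0.
have e1 k : enorm (euler x0 h k) <= 1 by case: k => [|k] //=; apply: enorm_ball_proj.
split=> // k /=; set x := euler x0 h k; set t := k%:R * h.
have x1 : enorm x <= 1 by apply: e1.
have t0 : 0 <= t by rewrite mulr_ge0.
set D := g (k.+1%:R * h) - g t.
have hD : `|D| <= M * h `^ gam.
  by have := young_g_grid h0' (leqnSn k); rewrite subSnn mul1r.
have hg : h <= h `^ gam by apply: powR_ge_id; rewrite h0' h1.
(* The increment of [g] is at most [M * h ^ gam] and [h <= h ^ gam], which gives the factor
   [(1 + M) * M <= 2 * M ^+ 2]; its square is the constant [4 * M ^+ 4] of the statement. *)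
have he : (h + `|D|) * M <= 2 * M ^+ 2 * h `^ gam.
  have : (h + `|D|) * M <= (h `^ gam + M * h `^ gam) * M by rewrite ler_wpM2r // lerD.
  have : 0 <= (M - 1) * M * h `^ gam by rewrite !mulr_ge0 ?powR_ge0 // subr_ge0.
  rewrite expr2; lra.
have tt1 : t <= t + 1 by rewrite lerDl.
have Lb y z : enorm y <= 1 -> enorm z <= 1 -> enorm (b t y - b t z) <= M * enorm (y - z).
  by move=> y1 z1; have := young_b YD t0 (lexx _) tt1 y1 z1; rewrite subrr powR0 ?gt_eqF // add0r.
have Ls y z : enorm y <= 1 -> enorm z <= 1 -> enorm (sigma t y - sigma t z) <= M * enorm (y - z).
  by move=> y1 z1; have := young_sigma YD t0 (lexx _) tt1 y1 z1; rewrite subrr powR0 ?gt_eqF // add0r.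
apply: (le_trans (@ball_proj_step_le _ _ _ _ h D M x h0' M0 x1 _ _ _ _ _)).
- exact: (young_b_bd YD t0 x1).
- exact: (young_sigma_bd YD t0 x1).
- by apply: (dotp_le_dist_sphere (f := b t)) => // y y1; apply: (young_b_in YD).
- by apply: (norm_dotp_le_dist_sphere (f := sigma t)) => // y y1; apply: (young_sigma_tan YD).
- exact: le_trans he hs.
apply: (@le_trans _ _ ((2 * M ^+ 2 * h `^ gam) ^+ 2)).
  rewrite ler_pXn2r ?nnegrE //; last by rewrite !mulr_ge0 ?powR_ge0 // sqr_ge0.
  by rewrite mulr_ge0 // addr_ge0.
rewrite exprMn exprMn -exprM -natrX.
have -> : (2 ^ 2)%:R = 4 :> R by [].
rewrite ler_wpM2l ?mulr_ge0 ?exprn_ge0 // expr2 -powRD_gt0 //.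
by apply: ge_powR_exponent; rewrite ?h0' ?h1 ?addr_gt0 // lerD2r.
Qed.

(** The drift is kept as the exact sum and only [sigma] is frozen at the left end. The drift is then
    additive and drops out of the relation of Chasles, where only the increment of [sigma]
    remains. *)
Definition euler_defect h X k l : 'rV[R]_d :=
  X l - X k - \sum_(k <= j < l) h *: b (j%:R * h) (X j)
  - (g (l%:R * h) - g (k%:R * h)) *: sigma (k%:R * h) (X k).

Lemma euler_defect_chasles h X k l m : (k <= l)%N -> (l <= m)%N ->
  euler_defect h X k m = euler_defect h X k l + euler_defect h X l m +
    (g (m%:R * h) - g (l%:R * h)) *: (sigma (l%:R * h) (X l) - sigma (k%:R * h) (X k)).
Proof.
move=> kl lm; rewrite /euler_defect (big_cat_nat kl lm) /=.
by apply/rowP => i; rewrite !mxE; ring.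
Qed.

Lemma enorm_drift_le h X k l : 0 <= h -> (k <= l)%N -> (forall k, enorm (X k) <= 1) ->
  enorm (\sum_(k <= j < l) h *: b (j%:R * h) (X j)) <= (l - k)%:R * h * M.
Proof.
move=> h0 kl X1; apply: le_trans (ler_enorm_sum _ _) _.
rewrite -mulrA mulr_natl -sumr_const_nat; apply: ler_sum => j _.
by rewrite enormZ ger0_norm // ler_wpM2l // (young_b_bd YD) // mulr_ge0.
Qed.

Lemma enorm_incr_le_defect h X k l : 0 < h -> (k <= l)%N -> (l - k)%:R * h <= 1 ->
  (forall k, enorm (X k) <= 1) ->
  enorm (X l - X k) <= enorm (euler_defect h X k l) + (M + M ^+ 2) * ((l - k)%:R * h) `^ gam.
Proof.
move=> h0 kl w1 X1; set w := (l - k)%:R * h in w1 *.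
have w0 : 0 <= w by rewrite mulr_ge0 // ltW.
have -> : X l - X k = euler_defect h X k l +
  (\sum_(k <= j < l) h *: b (j%:R * h) (X j) +
   (g (l%:R * h) - g (k%:R * h)) *: sigma (k%:R * h) (X k)).
  by rewrite /euler_defect; apply/rowP => i; rewrite !mxE; ring.
apply: (le_trans (ler_enormD _ _)); rewrite lerD2l.
apply: (le_trans (ler_enormD _ _)); rewrite mulrDl; apply: lerD.
  apply: (le_trans (enorm_drift_le (ltW h0) kl X1)); rewrite mulrC ler_wpM2l //.
  by apply: powR_ge_id; rewrite w0.
rewrite enormZ expr2 mulrAC; apply: ler_pM; rewrite ?enorm_ge0 //.
  exact: young_g_grid (ltW h0) kl.
by rewrite (young_sigma_bd YD) // mulr_ge0 // ltW.
Qed.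

(** Sewing applied to the norm of the defect. The junction term is an increment of [g] times an
    increment of [sigma]; the latter involves an increment of [X], hence the defect itself. On a
    horizon [tau] with [M ^+ 2 * tau ^ gam <= c] this feedback costs only the factor [1 + c].
    Neither [tau] nor [K] depends on [h] or on the scheme. *)
Lemma euler_defect_le A : 0 <= A -> exists2 tau, 0 < tau <= 1 & exists2 K, 0 <= K &
  forall h X k l, 0 < h -> approx_euler A h X -> (k <= l)%N -> (l - k)%:R * h <= tau ->
    enorm (euler_defect h X k l) <= K * ((l - k)%:R * h) `^ (lam + gam).
Proof.
move=> A0; set th := lam + gam.
have th1 : 1 < th := young_exp YD.
pose kap : R := (2 / 3) `^ (th - 1).
have kap1 : kap < 1.
  have : kap < 1 `^ (th - 1).
    apply: gt0_ltr_powR; rewrite ?nnegrE ?subr_gt0 ?divr_ge0 //.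
    by rewrite ltr_pdivrMr // mul1r ltr_nat.
  by rewrite powR1.
(* Half of the margin [1 - kap] goes to the feedback; the other half, [1 - kap - c = c], is left for
   [F]. *)
pose c := (1 - kap) / 2.
have c0 : 0 < c by rewrite divr_gt0 // subr_gt0.
have M20 : 0 < M ^+ 2 by rewrite exprn_gt0 // (lt_le_trans ltr01).
have [tau tau01 htau] := exists_small_powR M20 c0 gam0.
exists tau => //.
pose F := M ^+ 2 * (1 + M + M ^+ 2).
have F0 : 0 <= F by rewrite mulr_ge0 ?addr_ge0 // ltW.
exists (A + F / c); first by rewrite addr_ge0 // divr_ge0 // ltW.
move=> h X k l h0 [X1 Xe] kl ltau; have h0' := ltW h0.
have [->|nlk] := eqVneq l k.
  rewrite /euler_defect big_geq // !subrr scale0r !subr0 enorm0.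
  by rewrite mulr_ge0 ?powR_ge0 // addr_ge0 // divr_ge0 // ltW.
have kltl : (k < l)%N by rewrite ltn_neqAle eq_sym nlk.
have hth : 0 <= h `^ th := powR_ge0 _ _.
(* Indices are counted from [k] and the power [h ^ th] is put in the constants, to fit the integer
   lengths of [discrete_sewing]. *)
pose a i j := enorm (euler_defect h X (k + i) (k + j)).
have small i j : (i <= j)%N -> (j <= l - k)%N -> (j - i)%:R * h <= tau.
  move=> ij jlk; apply: le_trans ltau; rewrite ler_wpM2r // ler_nat; nat_lia.
case/andP: tau01 => tau0 tau1.
have Hwt : (A + F / c) * ((l - k)%:R * h) `^ th = (A + F / c) * h `^ th * (l - k - 0)%:R `^ th.
  by rewrite subn0 powRM // mulrA mulrAC.
have HE : enorm (euler_defect h X k l) = a 0%N (l - k)%N by rewrite /a addn0 subnKC.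
rewrite Hwt HE; apply: (@discrete_sewing R th c (F * h `^ th) ((A + F / c) * h `^ th) (l - k) a th1 (ltW c0)) => //; last by rewrite subn_gt0.
- exact: mulr_ge0.
- by rewrite mulr_ge0 // addr_ge0 // divr_ge0 // ltW.
- rewrite mulrA ler_wpM2r // -/kap.
  have -> : 1 - kap - c = c by rewrite /c; lra.
  by rewrite mulrDr (mulrC c (F / c)) divfK ?gt_eqF // lerDr mulr_ge0 // ltW.
- move=> i _; rewrite /a addnS /euler_defect big_nat1.
  have -> : X (k + i).+1 - X (k + i)%N - h *: b ((k + i)%:R * h) (X (k + i)%N) -
    (g ((k + i).+1%:R * h) - g ((k + i)%:R * h)) *: sigma ((k + i)%:R * h) (X (k + i)%N)
    = X (k + i).+1 - (X (k + i)%N + euler_incr h (k + i) (X (k + i)%N)).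
    by rewrite /euler_incr; apply/rowP => j; rewrite !mxE; ring.
  by apply: (le_trans (Xe _)); rewrite ler_wpM2r // lerDl divr_ge0 // ltW.
- move=> i j m ij jm mlk.
  set w := (m - i)%:R * h.
  have w0 : 0 <= w by apply: mulr_ge0.
  have wtau : w <= tau by apply: small => //; nat_lia.
  have w01 : 0 <= w <= 1 by rewrite w0 (le_trans wtau).
  have wij : (k + j - (k + i))%:R * h <= w by rewrite ler_wpM2r // ler_nat; nat_lia.
  have wjm : (k + m - (k + j))%:R * h <= w by rewrite ler_wpM2r // ler_nat; nat_lia.
  have wij0 : 0 <= (k + j - (k + i))%:R * h by apply: mulr_ge0.
  have wjm0 : 0 <= (k + m - (k + j))%:R * h by apply: mulr_ge0.
  have kij : (k + i <= k + j)%N by nat_lia.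
  have kjm : (k + j <= k + m)%N by nat_lia.
  rewrite {1}/a (euler_defect_chasles h X kij kjm) {1 2}/a.
  apply: (le_trans (ler_enormD _ _)).
  have h1 := ler_enormD (euler_defect h X (k + i) (k + j)) (euler_defect h X (k + j) (k + m)).
  set u := enorm (euler_defect h X (k + i) (k + j)) in h1 *.
  set v := enorm (euler_defect h X (k + j) (k + m)) in h1 *.
  have u0 : 0 <= u := enorm_ge0 _.
  have wg0 : 0 <= w `^ gam := powR_ge0 _ _.
  have hg : `|g ((k + m)%:R * h) - g ((k + j)%:R * h)| <= M * w `^ gam.
    apply: (le_trans (young_g_grid h0' kjm)); rewrite ler_wpM2l //.
    by apply: le_powR_base => //; apply: ltW.
  have hX : enorm (X (k + j)%N - X (k + i)%N) <= u + (M + M ^+ 2) * w `^ gam.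
    apply: (le_trans (enorm_incr_le_defect h0 kij _ X1)).
      by apply: (le_trans wij); case/andP: w01.
    rewrite lerD2l ler_wpM2l ?addr_ge0 ?exprn_ge0 //.
    by apply: le_powR_base => //; apply: ltW.
  have hs : enorm (sigma ((k + j)%:R * h) (X (k + j)%N) - sigma ((k + i)%:R * h) (X (k + i)%N))
     <= M * (w `^ lam + (u + (M + M ^+ 2) * w `^ gam)).
    have H1 : (k + j)%:R * h - (k + i)%:R * h = (k + j - (k + i))%:R * h.
      by rewrite natrB // mulrBl.
    apply: (le_trans (young_sigma YD _ _ _ (X1 _) (X1 _))).
    + exact: mulr_ge0.
    + by rewrite ler_wpM2r // ler_nat.
    + by rewrite -lerBlDl H1 (le_trans wij) //; case/andP: w01.
    + rewrite ler_wpM2l // lerD // H1; apply: le_powR_base => //; exact: ltW.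
  have wth : w `^ th = w `^ gam * w `^ lam by rewrite /th addrC powRD_gt0.
  have wgg : w `^ gam * w `^ gam <= w `^ th.
    by rewrite wth ler_wpM2l //; apply: ge_powR_exponent.
  have wgtau : M ^+ 2 * w `^ gam <= c.
    apply: le_trans htau; rewrite ler_wpM2l ?(ltW M20) //.
    by apply: le_powR_base => //; apply: ltW.
  rewrite enormZ.
  have H2 : `|g ((k + m)%:R * h) - g ((k + j)%:R * h)| *
    enorm (sigma ((k + j)%:R * h) (X (k + j)%N) - sigma ((k + i)%:R * h) (X (k + i)%N))
    <= (M * w `^ gam) * (M * (w `^ lam + (u + (M + M ^+ 2) * w `^ gam))).
    by apply: ler_pM => //; apply: enorm_ge0.
  have H3 : (M * w `^ gam) * (M * (w `^ lam + (u + (M + M ^+ 2) * w `^ gam))) =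
    M ^+ 2 * (w `^ gam * w `^ lam) + (M ^+ 2 * w `^ gam) * u +
    M ^+ 2 * (M + M ^+ 2) * (w `^ gam * w `^ gam) by ring.
  have H4 : (M ^+ 2 * w `^ gam) * u <= c * u by rewrite ler_wpM2r.
  have H5 : M ^+ 2 * (M + M ^+ 2) * (w `^ gam * w `^ gam) <= M ^+ 2 * (M + M ^+ 2) * w `^ th.
    by rewrite ler_wpM2l // mulr_ge0 ?addr_ge0 // ltW.
  have H6 : F * h `^ th * (m - i)%:R `^ th = M ^+ 2 * w `^ th + M ^+ 2 * (M + M ^+ 2) * w `^ th.
    rewrite /w powRM // /F; ring.
  rewrite -wth in H3.
  lra.
Qed.


Lemma approx_euler_holder A : 0 <= A -> exists2 tau, 0 < tau <= 1 & exists2 C, 1 <= C &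
  forall h X k l, 0 < h -> approx_euler A h X -> (k <= l)%N -> (l - k)%:R * h <= tau ->
    enorm (X l - X k) <= C * ((l - k)%:R * h) `^ gam.
Proof.
move=> A0; have [tau /andP[tau0 tau1] [K K0 HK]] := euler_defect_le A0.
exists tau; first by rewrite tau0.
exists (K + (M + M ^+ 2)); first by rewrite addrC ler_wpDr // ler_wpDr ?exprn_ge0.
move=> h X k l h0 aX kl w; rewrite mulrDl.
have w1 : (l - k)%:R * h <= 1 by apply: le_trans tau1.
have [X1 _] := aX.
apply: (le_trans (enorm_incr_le_defect h0 kl w1 X1)); rewrite lerD2r.
apply: (le_trans (HK _ _ _ _ h0 aX kl w)); rewrite ler_wpM2l //.
by apply: ge_powR_exponent; rewrite ?lerDr ?(ltW lam0) // w1 mulr_ge0 // ltW.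
Qed.

(** Two steps of size [h / 2] differ from one step of size [h] by the defect over the two steps, of
    order [h ^ (lam + gam)], and by the change of the drift over half a step, of order
    [h * h ^ lam]. *)
Lemma approx_euler_coarsen A : 0 <= A -> exists2 tau, 0 < tau <= 1 & exists2 A', A <= A' &
  forall h X, 0 < h <= tau -> approx_euler A (h / 2) X ->
    approx_euler A' h (fun k => X (2 * k)%N).
Proof.
move=> A0; have [tau1 /andP[tau10 tau11] [K K0 HK]] := euler_defect_le A0.
have [tau2 /andP[tau20 tau21] [C C1 HC]] := approx_euler_holder A0.
exists (Num.min tau1 tau2); first by rewrite lt_min tau10 tau20 /= ge_min tau11.
exists (A + K + M * (1 + C)); first by rewrite -addrA lerDl addr_ge0 // mulr_ge0 // addr_ge0 // (le_trans ler01).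
move=> h X /andP[h0]; rewrite le_min => /andP[ht1 ht2] aX; have h20 : 0 < h / 2 by rewrite divr_gt0.
have h0' := ltW h0; have h1 : h <= 1 by apply: le_trans tau11.
have C0 : 0 <= C by apply: le_trans C1.
have [X1 _] := aX; split=> // k.
have tE : (2 * k)%:R * (h / 2) = k%:R * h by rewrite natrM; lra.
have tE2 : (2 * k.+1)%:R * (h / 2) = k.+1%:R * h by rewrite natrM; lra.
have tE1 : (2 * k).+1%:R * (h / 2) = k%:R * h + h / 2 by rewrite -natr1 natrM; lra.
have e2 : (2 * k.+1 = (2 * k).+2)%N by rewrite mulnS.
pose D := euler_defect (h / 2) X (2 * k) (2 * k.+1).
have -> : X (2 * k.+1)%N - (X (2 * k)%N + euler_incr h k (X (2 * k)%N)) =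
  D + (h / 2) *: (b (k%:R * h + h / 2) (X (2 * k).+1) - b (k%:R * h) (X (2 * k)%N)).
  rewrite /D /euler_defect /euler_incr tE tE2 e2 big_nat_recr ?big_nat1 //= tE tE1.
  apply/rowP => i; rewrite !mxE.
  by move: (b _ _ 0 i) (b _ _ 0 i) => u v; lra.
have kk : (2 * k <= 2 * k.+1)%N by rewrite leq_mul2l leqnSn orbT.
have wE : (2 * k.+1 - 2 * k)%:R * (h / 2) = h by rewrite -mulnBr subSnn muln1; lra.
have hD : enorm D <= K * h `^ (lam + gam).
  by rewrite -[X in X `^ _]wE; apply: HK => //; rewrite wE.
have hX : enorm (X (2 * k).+1 - X (2 * k)%N) <= C * h `^ lam.
  have := HC _ _ (2 * k)%N (2 * k).+1 h20 aX (leqnSn _).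
  rewrite subSnn mul1r => H; apply: (le_trans (H _)); first lra.
  rewrite ler_wpM2l //.
  apply: (@le_trans _ _ (h `^ gam)); first by apply: le_powR_base; [exact: ltW gam0 | lra | lra].
  by apply: ge_powR_exponent; rewrite ?h0'.
have kh0 : 0 <= k%:R * h by rewrite mulr_ge0.
have hb : enorm (b (k%:R * h + h / 2) (X (2 * k).+1) - b (k%:R * h) (X (2 * k)%N))
   <= M * (h `^ lam + C * h `^ lam).
  apply: (le_trans (young_b YD kh0 _ _ (X1 _) (X1 _))); [lra|lra|].
  by rewrite ler_wpM2l // lerD // addrAC subrr add0r; apply: le_powR_base; [exact: ltW lam0 | lra | lra].
have hh : h / 2 <= h `^ gam.
  by apply: (@le_trans _ _ h); [lra | apply: powR_ge_id; rewrite h0' h1].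
apply: (le_trans (ler_enormD _ _)); rewrite enormZ ger0_norm; last lra.
have H2 : h / 2 * enorm (b (k%:R * h + h / 2) (X (2 * k).+1) - b (k%:R * h) (X (2 * k)%N))
   <= h `^ gam * (M * (h `^ lam + C * h `^ lam)).
  by apply: ler_pM => //; [lra | apply: enorm_ge0].
have H3 : h `^ gam * (M * (h `^ lam + C * h `^ lam)) = M * (1 + C) * h `^ (lam + gam).
  by rewrite powRD_gt0 //; ring.
have H4 : 0 <= A * h `^ (lam + gam) by rewrite mulr_ge0 ?powR_ge0.
lra.
Qed.

(** The difference [Z] of the two schemes has a defect [D] of its own. Sewing bounds [D] in terms of
    the maximum [S] of [Z] over the window; inserted in the increments of [Z] on a short window,
    this gives [S <= enorm (Z 0) + (S + e) / 2], from which [S] is solved. *)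
Lemma approx_euler_stable A : 0 <= A -> exists2 tau, 0 < tau <= 1 & exists2 rho, 0 < rho &
  forall h X Y k0 N, 0 < h -> approx_euler A h X -> approx_euler A h Y ->
    N%:R * h <= tau -> forall k, (k <= N)%N ->
    enorm (X (k0 + k)%N - Y (k0 + k)%N) <= 2 * enorm (X k0 - Y k0) + h `^ rho.
Proof.
move=> A0; have [tau1 /andP[tau10 tau11] [C C1 HC]] := approx_euler_holder A0.
set th := lam + gam; have th1 : 1 < th := young_exp YD.
(* Halfway between 1 and [th], the exponent [th'] is still admissible for sewing, while
   [h ^ th = h ^ rho * h ^ th'] leaves the small factor [h ^ rho] on the one-step errors. *)
pose th' := (1 + th) / 2; pose rho := th - th'.
have th'1 : 1 < th' by rewrite /th'; lra.
have th'th : th' <= th by rewrite /th'; lra.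
have rho0 : 0 < rho by rewrite /rho /th'; lra.
pose kap : R := (2 / 3) `^ (th' - 1).
have kap1 : kap < 1.
  have : kap < 1 `^ (th' - 1).
    apply: gt0_ltr_powR; rewrite ?nnegrE ?subr_gt0 ?divr_ge0 //.
    by rewrite ltr_pdivrMr // mul1r ltr_nat.
  by rewrite powR1.
pose c := (1 - kap) / 2.
have c0 : 0 < c by rewrite divr_gt0 // subr_gt0.
have M20 : 0 < M ^+ 2 by rewrite exprn_gt0 // (lt_le_trans ltr01).
have C0 : 0 <= C by apply: le_trans C1.
(* [F] collects the coefficients of [S] in the junction estimate below, once the powers of [w] are
   all bounded by [w ^ th']. In [K], the term [2 * A] covers the one-step errors of both schemes. *)
pose F := M ^+ 2 * (1 + 2 * C) + M ^+ 3 + M ^+ 4.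
have F0 : 0 <= F by rewrite !addr_ge0 ?exprn_ge0 // mulr_ge0 ?(ltW M20) // addr_ge0 // mulr_ge0.
pose K := 2 * A + F / c.
have K0 : 0 <= K by rewrite addr_ge0 ?mulr_ge0 ?invr_ge0 // ltW.
have KM0 : 0 < K + M + M ^+ 2 by rewrite ltr_wpDl // addr_ge0.
have [tau2 /andP[tau20 tau21] htau2] := exists_small_powR M20 c0 gam0.
have half0 : (0 : R) < 2^-1 by rewrite invr_gt0.
have [tau3 /andP[tau30 tau31] htau3] := exists_small_powR KM0 half0 gam0.
pose tau := Num.min tau1 (Num.min tau2 tau3).
have [tt1 tt2 tt3] : [/\ tau <= tau1, tau <= tau2 & tau <= tau3].
  by rewrite /tau; split; rewrite !ge_min ?lexx ?orbT.
have tau0 : 0 < tau by rewrite !lt_min tau10 tau20.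
exists tau; first by rewrite tau0 (le_trans tt1).
exists rho => // h X Y k0 N h0 aX aY Ntau; have h0' := ltW h0.
have [X1 Xe] := aX; have [Y1 Ye] := aY.
pose Z k := X (k0 + k)%N - Y (k0 + k)%N.
pose tk k := (k0 + k)%:R * h.
have tk0 k : 0 <= tk k by rewrite mulr_ge0.
pose S := \big[Num.max/0]_(k < N.+1) enorm (Z k).
have ZS k : (k <= N)%N -> enorm (Z k) <= S.
  by rewrite -ltnS => kN; apply: (bigmax_sup (Ordinal kN)).
have S0 : 0 <= S by apply: bigmax_ge_id.
pose e := h `^ rho; have e0 : 0 <= e := powR_ge0 _ _.
pose D k l : 'rV[R]_d := Z l - Z k
  - \sum_(k <= j < l) h *: (b (tk j) (X (k0 + j)%N) - b (tk j) (Y (k0 + j)%N))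
  - (g (tk l) - g (tk k)) *: (sigma (tk k) (X (k0 + k)%N) - sigma (tk k) (Y (k0 + k)%N)).
have tkB k l : (k <= l)%N -> tk l - tk k = (l - k)%:R * h.
  by move=> kl; rewrite /tk -mulrBl -natrB ?leq_add2l // subnDl.
have tkle k l : (k <= l)%N -> tk k <= tk l.
  by move=> kl; rewrite -subr_ge0 tkB // mulr_ge0.
have w1N k l : (k <= l)%N -> (l <= N)%N -> (l - k)%:R * h <= tau.
  by move=> kl lN; apply: le_trans Ntau; rewrite ler_wpM2r // ler_nat; nat_lia.
have tk1 k l : (k <= l)%N -> (l <= N)%N -> tk l <= tk k + 1.
  by move=> kl lN; rewrite -lerBlDl tkB // (le_trans (w1N _ _ kl lN)) // (le_trans tt1).
have gk k l : (k <= l)%N -> `|g (tk l) - g (tk k)| <= M * ((l - k)%:R * h) `^ gam.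
  move=> kl; have := @young_g_grid h (k0 + k) (k0 + l) h0'.
  by rewrite leq_add2l subnDl; apply.
have lipb k : enorm (b (tk k) (X (k0 + k)%N) - b (tk k) (Y (k0 + k)%N)) <= M * enorm (Z k).
  have := young_b YD (tk0 k) (lexx _) _ (X1 (k0 + k)%N) (Y1 (k0 + k)%N).
  by rewrite subrr powR0 ?gt_eqF // add0r; apply; rewrite lerDl.
have lips k : enorm (sigma (tk k) (X (k0 + k)%N) - sigma (tk k) (Y (k0 + k)%N)) <= M * enorm (Z k).
  have := young_sigma YD (tk0 k) (lexx _) _ (X1 (k0 + k)%N) (Y1 (k0 + k)%N).
  by rewrite subrr powR0 ?gt_eqF // add0r; apply; rewrite lerDl.
have Dincr k l : (k <= l)%N -> (l <= N)%N ->
  enorm (Z l - Z k) <= enorm (D k l) + (M + M ^+ 2) * ((l - k)%:R * h) `^ gam * S.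
  move=> kl lN; set w := (l - k)%:R * h.
  have -> : Z l - Z k = D k l +
   (\sum_(k <= j < l) h *: (b (tk j) (X (k0 + j)%N) - b (tk j) (Y (k0 + j)%N))
  + (g (tk l) - g (tk k)) *: (sigma (tk k) (X (k0 + k)%N) - sigma (tk k) (Y (k0 + k)%N))).
    by rewrite /D; apply/rowP => i; rewrite !mxE; ring.
  apply: (le_trans (ler_enormD _ _)); rewrite lerD2l.
  apply: (le_trans (ler_enormD _ _)).
  have w0 : 0 <= w by rewrite mulr_ge0.
  have ww : w <= w `^ gam.
    apply: powR_ge_id; rewrite w0 /=; apply: le_trans tau11.
    by apply: le_trans tt1; apply: w1N.
  have B1 : enorm (\sum_(k <= j < l) h *: (b (tk j) (X (k0 + j)%N) - b (tk j) (Y (k0 + j)%N)))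
     <= M * w `^ gam * S.
    apply: (@le_trans _ _ (w * (M * S))); last first.
      by rewrite mulrA (mulrC w) ler_wpM2r // ler_wpM2l.
    apply: (le_trans (ler_enorm_sum _ _)).
    rewrite -mulrA mulr_natl -sumr_const_nat big_nat_cond [leRHS]big_nat_cond.
    apply: ler_sum => j /andP[/andP[_ jl] _].
    rewrite enormZ ger0_norm // ler_wpM2l // (le_trans (lipb _)) // ler_wpM2l //.
    by apply: ZS; nat_lia.
  have B2 : enorm ((g (tk l) - g (tk k)) *: (sigma (tk k) (X (k0 + k)%N) - sigma (tk k) (Y (k0 + k)%N)))
     <= (M * w `^ gam) * (M * S).
    rewrite enormZ; apply: ler_pM; rewrite ?enorm_ge0 //; first exact: gk.
    by apply: (le_trans (lips _)); rewrite ler_wpM2l //; apply: ZS; nat_lia.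
  have -> : (M + M ^+ 2) * w `^ gam * S = M * w `^ gam * S + (M * w `^ gam) * (M * S) by ring.
  exact: lerD.
have Dch i j m : (i <= j)%N -> (j <= m)%N -> D i m = D i j + D j m +
   (g (tk m) - g (tk j)) *: ((sigma (tk j) (X (k0 + j)%N) - sigma (tk j) (Y (k0 + j)%N))
     - (sigma (tk i) (X (k0 + i)%N) - sigma (tk i) (Y (k0 + i)%N))).
  move=> ij jm; rewrite /D (big_cat_nat ij jm) /=.
  by apply/rowP => q; rewrite !mxE; ring.
have Dle : forall k l, (k < l)%N -> (l <= N)%N ->
    enorm (D k l) <= K * (S + e) * h `^ th' * (l - k)%:R `^ th'.
  have hh0 : 0 <= h `^ th' := powR_ge0 _ _.
  have Se0 : 0 <= S + e by apply: addr_ge0.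
  apply: (@discrete_sewing R th' c (F * S * h `^ th') (K * (S + e) * h `^ th') N (fun k l => enorm (D k l)) th'1 (ltW c0)).
  - by rewrite !mulr_ge0.
  - by rewrite !mulr_ge0.
  - rewrite -/kap; have -> : 1 - kap - c = c by rewrite /c; goal_lra.
    rewrite !mulrA ler_wpM2r //.
    have -> : c * K * (S + e) = F * S + (F * e + c * (2 * A) * (S + e)).
      have cF : c * (F / c) = F by rewrite mulrC divfK ?gt_eqF.
      by rewrite /K; transitivity (c * (F / c) * (S + e) + c * (2 * A) * (S + e));
        [ring | rewrite cF; ring].
    rewrite lerDl; apply: addr_ge0; first exact: mulr_ge0.
    by rewrite mulr_ge0 // mulr_ge0 ?(ltW c0) // mulr_ge0.
  - move=> k kN; rewrite /D big_nat1.
    have -> : Z k.+1 - Z k -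
      h *: (b (tk k) (X (k0 + k)%N) - b (tk k) (Y (k0 + k)%N)) -
      (g (tk k.+1) - g (tk k)) *: (sigma (tk k) (X (k0 + k)%N) - sigma (tk k) (Y (k0 + k)%N))
      = (X (k0 + k).+1 - (X (k0 + k)%N + euler_incr h (k0 + k) (X (k0 + k)%N))) -
        (Y (k0 + k).+1 - (Y (k0 + k)%N + euler_incr h (k0 + k) (Y (k0 + k)%N))).
      rewrite /Z /tk /euler_incr addnS; apply/rowP => i; rewrite !mxE; ring.
    apply: (le_trans (ler_enormB _ _)).
    have hthE : h `^ th = e * h `^ th'.
      have th'0 : 0 < th' := lt_trans ltr01 th'1.
      by rewrite -[in LHS](subrK th' th) -/rho powRD_gt0.
    have := Xe (k0 + k)%N; have := Ye (k0 + k)%N; rewrite hthE.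
    have : 2 * A * (e * h `^ th') <= K * (S + e) * h `^ th'.
      rewrite mulrA ler_wpM2r // ler_pM ?mulr_ge0 // ?lerDr //.
      by rewrite /K lerDl divr_ge0 // ltW.
    goal_lra.
  - move=> i j m ij jm mN; have ij' := ltnW ij; have jm' := ltnW jm.
    have iN : (i <= N)%N by nat_lia.
    have jN : (j <= N)%N by nat_lia.
    set w := (m - i)%:R * h.
    have w0 : 0 <= w by apply: mulr_ge0.
    have wtau : w <= tau by apply: w1N => //; nat_lia.
    have w1 : w <= 1 by apply: (le_trans wtau); apply: (le_trans tt1).
    have w01 : 0 <= w <= 1 by rewrite w0.
    have wij : (j - i)%:R * h <= w by rewrite ler_wpM2r // ler_nat; nat_lia.
    have wjm : (m - j)%:R * h <= w by rewrite ler_wpM2r // ler_nat; nat_lia.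
    have wij0 : 0 <= (j - i)%:R * h by apply: mulr_ge0.
    have wjm0 : 0 <= (m - j)%:R * h by apply: mulr_ge0.
    rewrite (Dch i j m ij' jm').
    apply: (le_trans (ler_enormD _ _)).
    have h1 := ler_enormD (D i j) (D j m).
    have Dij := Dincr i j ij' jN.
    set u := enorm (D i j) in h1 Dij *; set v := enorm (D j m) in h1 *.
    have u0 : 0 <= u := enorm_ge0 _.
    have wg0 : 0 <= w `^ gam := powR_ge0 _ _.
    have wl0 : 0 <= w `^ lam := powR_ge0 _ _.
    have hg : `|g (tk m) - g (tk j)| <= M * w `^ gam.
      apply: (le_trans (gk _ _ jm')); rewrite ler_wpM2l //.
      by apply: le_powR_base => //; apply: ltW.
    have hZ : enorm (Z j - Z i) <= u + (M + M ^+ 2) * w `^ gam * S.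
      apply: (le_trans Dij); rewrite lerD2l ler_wpM2r // ler_wpM2l ?addr_ge0 ?exprn_ge0 //.
      by apply: le_powR_base => //; apply: ltW.
    have del0 : 0 <= del by case/andP: (young_del YD) => /ltW.
    (* The place where [lam <= del * gam] matters: the power [del] of a [gam]-Hoelder increment is
       still of order [w ^ lam]. *)
    have hold (U : nat -> 'rV[R]_d) : approx_euler A h U ->
      enorm (U (k0 + j)%N - U (k0 + i)%N) `^ del <= C * w `^ lam.
      move=> aU; have ki : (k0 + i <= k0 + j)%N by rewrite leq_add2l.
      have := HC _ _ _ _ h0 aU ki; rewrite subnDl => /(_ (le_trans (le_trans wij wtau) tt1)) HU.
      apply: (@le_trans _ _ ((C * w `^ gam) `^ del)).
        apply: le_powR_base; rewrite ?enorm_ge0 //; apply: (le_trans HU).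
        by rewrite ler_wpM2l //; apply: le_powR_base => //; apply: ltW.
      rewrite powRM //; apply: ler_pM; rewrite ?powR_ge0 //.
        by apply: ler1_powR => //; case/andP: (young_del YD).
      rewrite -powRrM mulrC; apply: ge_powR_exponent => //; exact: young_lam_del YD.
    (* Each term carries either the defect [u], or [S] times a positive power of [w]. Lipschitz
       bounds on [sigma] would give the factor [S] or the power of [w], but not both. *)
    have hs : enorm ((sigma (tk j) (X (k0 + j)%N) - sigma (tk j) (Y (k0 + j)%N))
     - (sigma (tk i) (X (k0 + i)%N) - sigma (tk i) (Y (k0 + i)%N)))
     <= M * (u + (M + M ^+ 2) * w `^ gam * S + S * ((1 + 2 * C) * w `^ lam)).
      apply: (le_trans (young_diff2 YD (tk0 i) (tkle _ _ ij') (tk1 _ _ ij' jN) (X1 _) (Y1 _) (X1 _) (Y1 _))).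
      rewrite ler_wpM2l //; apply: lerD; first exact: hZ.
      apply: ler_pM; rewrite ?addr_ge0 ?powR_ge0 ?enorm_ge0 //; first exact: ZS.
      have -> : (1 + 2 * C) * w `^ lam = w `^ lam + C * w `^ lam + C * w `^ lam by ring.
      apply: lerD; last exact: hold.
      apply: lerD; last exact: hold.
      by rewrite tkB //; apply: le_powR_base => //; apply: ltW.
    have wth : w `^ gam * w `^ lam <= w `^ th'.
      by rewrite mulrC -powRD_gt0 // ge_powR_exponent // (lt_trans ltr01).
    have wgg : w `^ gam * w `^ gam <= w `^ th'.
      by apply: le_trans wth; rewrite ler_wpM2l //; apply: ge_powR_exponent.
    have wgtau : M ^+ 2 * w `^ gam <= c.
      apply: le_trans htau2; rewrite ler_wpM2l ?(ltW M20) //.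
      by apply: le_powR_base => //; [apply: ltW | apply: le_trans tt2].
    rewrite enormZ.
    set Q := enorm (_ - _ - _) in hs *.
    have H2 : `|g (tk m) - g (tk j)| * Q
      <= (M * w `^ gam) * (M * (u + (M + M ^+ 2) * w `^ gam * S + S * ((1 + 2 * C) * w `^ lam))).
      by apply: ler_pM => //; apply: enorm_ge0.
    have H3 : (M * w `^ gam) * (M * (u + (M + M ^+ 2) * w `^ gam * S + S * ((1 + 2 * C) * w `^ lam))) =
      (M ^+ 2 * w `^ gam) * u + (M ^+ 3 + M ^+ 4) * S * (w `^ gam * w `^ gam) +
      (M ^+ 2 * (1 + 2 * C)) * S * (w `^ gam * w `^ lam) by ring.
    have H4 : (M ^+ 2 * w `^ gam) * u <= c * u by rewrite ler_wpM2r.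
    have H5 : (M ^+ 3 + M ^+ 4) * S * (w `^ gam * w `^ gam) <= (M ^+ 3 + M ^+ 4) * S * w `^ th'.
      by rewrite ler_wpM2l // mulr_ge0 ?addr_ge0 ?exprn_ge0.
    have H6 : M ^+ 2 * (1 + 2 * C) * S * (w `^ gam * w `^ lam) <= M ^+ 2 * (1 + 2 * C) * S * w `^ th'.
      by rewrite ler_wpM2l // !mulr_ge0 ?addr_ge0 // mulr_ge0.
    have H7 : F * S * h `^ th' * (m - i)%:R `^ th' =
      (M ^+ 3 + M ^+ 4) * S * w `^ th' + M ^+ 2 * (1 + 2 * C) * S * w `^ th'.
      by rewrite /w powRM // /F; ring.
    move: h1 H2 H3 H4 H5 H6 H7; goal_lra.
have Zle k : (k <= N)%N -> enorm (Z k) <= enorm (Z 0) + (S + e) / 2.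
  case: k => [|k] kN; first by rewrite lerDl divr_ge0 // addr_ge0.
  apply: (le_trans (ler_enorm_sub _ (Z 0%N))); rewrite lerD2l.
  apply: (le_trans (Dincr _ _ (leq0n _) kN)).
  have := Dle 0%N k.+1 (ltn0Sn _) kN; rewrite subn0.
  have -> : K * (S + e) * h `^ th' * k.+1%:R `^ th' = K * (S + e) * (k.+1%:R * h) `^ th'.
    by rewrite powRM //; ring.
  set w := k.+1%:R * h.
  have w0 : 0 <= w by rewrite mulr_ge0.
  have wtau : w <= tau by have := w1N 0%N k.+1 (leq0n _) kN; rewrite subn0.
  have w01 : 0 <= w <= 1 by rewrite w0 (le_trans wtau) // (le_trans tt1).
  have wg : (K + M + M ^+ 2) * w `^ gam <= 2^-1.
    apply: le_trans htau3; rewrite ler_wpM2l ?(ltW KM0) //.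
    by apply: le_powR_base => //; [apply: ltW | apply: le_trans tt3].
  have wth : w `^ th' <= w `^ gam.
    by apply: ge_powR_exponent => //; apply: (le_trans gam1); apply: ltW.
  have : K * (S + e) * w `^ th' <= K * (S + e) * w `^ gam.
    by rewrite ler_wpM2l // mulr_ge0 // addr_ge0.
  have : (K + M + M ^+ 2) * w `^ gam * (S + e) <= 2^-1 * (S + e).
    by rewrite ler_wpM2r // addr_ge0.
  have : 0 <= (M + M ^+ 2) * w `^ gam * e.
    by rewrite !mulr_ge0 ?powR_ge0 // addr_ge0 // exprn_ge0.
  goal_lra.
have SZ : S <= enorm (Z 0) + (S + e) / 2.
  apply: bigmax_le; first by rewrite addr_ge0 ?enorm_ge0 // divr_ge0 // addr_ge0.
  by move=> [k kN] _; apply: Zle.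
have Z0 : Z 0%N = X k0 - Y k0 by rewrite /Z addn0.
by move=> k kN; have := Zle k kN; rewrite -Z0 -/(Z k) -/e; move: SZ; goal_lra.
Qed.

(** Each window of [N] steps at most doubles the distance and adds [h ^ rho], and
    [2 * 3 ^ j + 1 <= 3 ^ (j + 1)]. *)
Lemma approx_euler_stable_global A : 0 <= A -> exists2 tau, 0 < tau <= 1 & exists2 rho, 0 < rho &
  forall h X Y N, 0 < h -> approx_euler A h X -> approx_euler A h Y -> X 0%N = Y 0%N ->
    (0 < N)%N -> N%:R * h <= tau -> forall j k, (k <= j * N)%N ->
    enorm (X k - Y k) <= 3 ^+ j * h `^ rho.
Proof.
move=> A0; have [tau tau01 [rho rho0 H]] := approx_euler_stable A0.
exists tau => //; exists rho => // h X Y N h0 aX aY XY0 N0 Ntau.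
have hr : 0 <= h `^ rho := powR_ge0 _ _.
elim=> [|j IH] k; first by rewrite mul0n leqn0 => /eqP ->; rewrite XY0 subrr enorm0 mulr_ge0.
rewrite mulSn => kN; have p3 : 1 <= 3 ^+ j :> R by rewrite exprn_ege1 // ler1n.
have p3h : h `^ rho <= 3 ^+ j * h `^ rho by rewrite ler_peMl.
rewrite exprS; have [kj|kj] := leqP k (j * N); first by have := IH k kj; lra.
have := H h X Y (j * N)%N N h0 aX aY Ntau (k - j * N)%N.
rewrite subnKC ?(ltnW kj) // => /(_ ltac:(nat_lia)); have := IH _ (leqnn (j * N)%N); lra.
Qed.

End ApproximateEuler.

(** * Geometric convergence and dyadic grids *)

Section GeometricLimits.
Variable R : realType.

Lemma le_geometric_error (x y C r : R) (n0 : nat) : 0 <= r < 1 ->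
  (forall n, (n0 <= n)%N -> x <= y + C * r ^+ n) -> x <= y.
Proof.
move=> /andP[r0 r1] H.
have r1' : `|r| < 1 by rewrite ger0_norm.
have cv : (y + C * r ^+ n) @[n --> \oo] --> y.
  rewrite -[X in _ --> X]addr0 -[X in _ --> _ + X](mulr0 C).
  by apply: cvgD; [exact: cvg_cst | apply: cvgM; [exact: cvg_cst | exact: cvg_expr]].
by apply: (cvgr_to_ge cv); exists n0 => // n /= nn; apply: H.
Qed.

(** With [K = C / (1 - r)], that is [K = C + K * r], the sequences [u n - K * r ^+ n] and
    [u n + K * r ^+ n] are monotone in opposite directions from [n0] on. They enclose the limit,
    which yields convergence and rate together. *)
Lemma geometric_cauchy_cvg (u : nat -> R) (C r : R) (n0 : nat) : 0 <= C -> 0 <= r < 1 ->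
  (forall n, (n0 <= n)%N -> `|u n.+1 - u n| <= C * r ^+ n) ->
  u n @[n --> \oo] --> limn u /\
  forall n, (n0 <= n)%N -> `|limn u - u n| <= C / (1 - r) * r ^+ n.
Proof.
move=> C0 /andP[r0 r1] H; have r1' : `|r| < 1 by rewrite ger0_norm.
have r1n : 0 < 1 - r by rewrite subr_gt0.
pose K := C / (1 - r); have K0 : 0 <= K by rewrite divr_ge0 // ltW.
have KE : K = C + K * r by rewrite /K; field; rewrite gt_eqF.
pose v n := u (n + n0)%N - K * r ^+ (n + n0).
pose w n := u (n + n0)%N + K * r ^+ (n + n0).
have uH n : `|u (n + n0).+1 - u (n + n0)%N| <= C * r ^+ (n + n0) by apply: H; rewrite leq_addl.
have vS : nondecreasing_seq v.
  apply/nondecreasing_seqP => n; rewrite /v addSn exprS.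
  have := uH n; rewrite ler_norml => /andP[h _].
  have : K * (r * r ^+ (n + n0)) = K * r ^+ (n + n0) - C * r ^+ (n + n0).
    by rewrite {2}KE; ring.
  lra.
have wS : nonincreasing_seq w.
  apply/nonincreasing_seqP => n; rewrite /w addSn exprS.
  have := uH n; rewrite ler_norml => /andP[_ h].
  have : K * (r * r ^+ (n + n0)) = K * r ^+ (n + n0) - C * r ^+ (n + n0).
    by rewrite {2}KE; ring.
  lra.
have vw n : v n <= w n.
  have : 0 <= K * r ^+ (n + n0) by rewrite mulr_ge0 ?exprn_ge0.
  rewrite /v /w; lra.
have vub : has_ubound (range v).
  exists (w 0%N) => _ [n _ <-]; apply: (le_trans (vw n)); exact: wS.
have cv := nondecreasing_is_cvgn vS vub.
have Kr : (K * r ^+ (n + n0)) @[n --> \oo] --> (0 : R).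
  rewrite -[X in _ --> X](mulr0 K); apply: cvgM; first exact: cvg_cst.
  by rewrite (cvg_shiftn n0 (fun n => r ^+ n)); apply: cvg_expr.
have cu0 : u (n + n0)%N @[n --> \oo] --> limn v.
  rewrite -[X in _ --> X]addr0.
  rewrite (_ : (fun n => u (n + n0)%N) = (fun n => v n + K * r ^+ (n + n0))).
    exact: cvgD.
  by apply/funext => n; rewrite /v subrK.
have cu : u n @[n --> \oo] --> limn v by rewrite -(cvg_shiftn n0).
have luv : limn u = limn v by apply: cvg_lim.
rewrite luv; split => // n nn.
have -> : n = (n - n0 + n0)%N by rewrite subnK.
set m := (n - n0)%N.
have h1 : v m <= limn v by apply: nondecreasing_cvgn_le.
have cw : w n @[n --> \oo] --> limn v.
  by rewrite -[X in _ --> X]addr0; apply: cvgD.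
have h2 : limn v <= w m.
  by rewrite -(cvg_lim _ cw) //; apply: nonincreasing_cvgn_ge => //; apply: cvgP cw.
rewrite ler_norml; apply/andP; split; rewrite -/K; rewrite /v /w in h1 h2; lra.
Qed.

Lemma geometric_cauchy_row d (u : nat -> 'rV[R]_d) (C r : R) (n0 : nat) : 0 <= C -> 0 <= r < 1 ->
  (forall n, (n0 <= n)%N -> enorm (u n.+1 - u n) <= C * r ^+ n) ->
  forall n, (n0 <= n)%N ->
    enorm ((\row_i limn (fun n => u n 0 i)) - u n) <= d%:R * (C / (1 - r)) * r ^+ n.
Proof.
move=> C0 r01 H n nn; rewrite -mulrA; apply: enorm_le_coord => i; rewrite !mxE.
apply: (@geometric_cauchy_cvg (fun n => u n 0 i) C r n0 C0 r01 _).2 => //.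
move=> k nk; apply: (le_trans _ (H k nk)).
by have := coord_le_enorm (u k.+1 - u k) 0 i; rewrite !mxE.
Qed.

Lemma geometric_cauchy_row_cvg d (u : nat -> 'rV[R]_d) (C r : R) (n0 : nat) i : 0 <= C -> 0 <= r < 1 ->
  (forall n, (n0 <= n)%N -> enorm (u n.+1 - u n) <= C * r ^+ n) ->
  u n 0 i @[n --> \oo] --> limn (fun n => u n 0 i).
Proof.
move=> C0 r01 H; apply: (@geometric_cauchy_cvg (fun n => u n 0 i) C r n0 C0 r01 _).1 => k nk.
apply: (le_trans _ (H k nk)).
by have := coord_le_enorm (u k.+1 - u k) 0 i; rewrite !mxE.
Qed.

Definition dyadic_step (n : nat) : R := 2^-1 ^+ n.
Definition dyadic_index (n : nat) (u : R) : nat := Num.truncn (u * 2 ^+ n).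

Lemma dyadic_step_gt0 n : 0 < dyadic_step n.
Proof. by rewrite exprn_gt0 // invr_gt0. Qed.

Lemma dyadic_step_le1 n : dyadic_step n <= 1.
Proof. by rewrite exprn_ile1 // ?invr_ge0 // invf_le1 // ler1n. Qed.

Lemma dyadic_stepS n : dyadic_step n.+1 = dyadic_step n / 2.
Proof. by rewrite /dyadic_step exprSr. Qed.

Lemma dyadic_step_powR n a : dyadic_step n `^ a = (2^-1 `^ a) ^+ n.
Proof. by rewrite -powR_mulrn ?powR_ge0 // powRAC powR_mulrn ?invr_ge0. Qed.

Lemma dyadic_ratio_lt1 (a : R) : 0 < a -> 0 <= (2^-1 : R) `^ a < 1.
Proof.
move=> a0; rewrite powR_ge0 /=; have : (2^-1 : R) `^ a < 1 `^ a.
  by apply: gt0_ltr_powR; rewrite ?nnegrE // ?invr_ge0 // invf_lt1 // ltr1n.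
by rewrite powR1.
Qed.

Lemma dyadic_step_small (e : R) : 0 < e -> exists n0, forall n, (n0 <= n)%N -> dyadic_step n <= e.
Proof.
move=> e0; have h : `|2^-1 : R| < 1 by rewrite ger0_norm ?invr_ge0 // invf_lt1 // ltr1n.
have /cvgrPdist_le/(_ e e0)[n0 _ H] := cvg_expr h; exists n0 => n nn.
by have := H n nn; rewrite /= sub0r normrN ger0_norm // exprn_ge0 // invr_ge0.
Qed.

Lemma dyadic_index_bounds n u : 0 <= u ->
  (dyadic_index n u)%:R * dyadic_step n <= u < (dyadic_index n u)%:R * dyadic_step n + dyadic_step n.
Proof.
move=> u0; have p0 : 0 < 2 ^+ n :> R by rewrite exprn_gt0.
have /andP[h1 h2] := truncn_itv (mulr_ge0 u0 (ltW p0)).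
rewrite /dyadic_step exprVn -[X in _ + X]mul1r -mulrDl natr1 ler_pdivrMr // ltr_pdivlMr //.
by rewrite h1.
Qed.

Lemma dyadic_index_le n u v : 0 <= u -> u <= v -> (dyadic_index n u <= dyadic_index n v)%N.
Proof.
move=> u0 uv; have p0 : 0 <= 2 ^+ n :> R by rewrite exprn_ge0.
rewrite truncn_ge_nat; last by rewrite mulr_ge0 // (le_trans u0).
by apply: (le_trans _ (ler_wpM2r p0 uv)); rewrite truncn_le mulr_ge0.
Qed.

Lemma dyadic_indexS n u : 0 <= u ->
  (2 * dyadic_index n u <= dyadic_index n.+1 u <= (2 * dyadic_index n u).+1)%N.
Proof.
move=> u0; have p0 m : 0 <= u * 2 ^+ m by rewrite mulr_ge0 // exprn_ge0.
have /andP[h1 h2] := truncn_itv (p0 n).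
rewrite /dyadic_index truncn_ge_nat // truncn_le_nat; set m := Num.truncn _ in h1 h2 *.
have -> : (2 * m).+2%:R = 2 * m%:R + 2 :> R by rewrite -addn2 natrD natrM.
rewrite natrM exprS mulrCA ler_pM2l // h1 /=; rewrite -natr1 in h2; lra.
Qed.

End GeometricLimits.

(** * The limit of the dyadic schemes and its expansion *)

Section YoungLimit.
Variables (R : realType) (d : nat) (b sigma : R -> 'rV[R]_d -> 'rV[R]_d).
Variables (g : R -> R) (lam gam del M : R) (x0 : 'rV[R]_d).
Hypotheses (YD : young_data b sigma g lam gam del M) (x01 : enorm x0 <= 1).

Let gam0 : 0 < gam.
Proof. by have /andP[+ _] := young_gam YD; apply: lt_trans; rewrite invr_gt0. Qed.
Let gam1 : gam <= 1. Proof. by case/andP: (young_gam YD). Qed.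
Let lam0 : 0 < lam. Proof. by case/andP: (young_lam YD). Qed.
Let lamgam : lam <= gam. Proof. by case/andP: (young_lam YD). Qed.
Let M1 : 1 <= M. Proof. exact: young_M YD. Qed.
Let M0 : 0 <= M. Proof. exact: le_trans ler01 M1. Qed.
Let A0 : R := 4 * M ^+ 4.
Let A00 : 0 <= A0. Proof. by rewrite mulr_ge0 // exprn_ge0. Qed.
Local Ltac goal_lra := clear - YD x01 gam0 gam1 lam0 lamgam M1 M0 A00; lra.

Definition euler_path (n : nat) (u : R) : 'rV[R]_d :=
  euler b sigma g x0 (dyadic_step R n) (dyadic_index n u).

(** Taking [limn] coordinate by coordinate makes the limit a definite function of the driving path,
    without any choice; its measurability in omega rests on this. *)
Definition euler_limit (u : R) : 'rV[R]_d := \row_i limn (fun n => euler_path n u 0 i).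

Lemma approx_euler_dyadic : exists n0, forall n, (n0 <= n)%N ->
  approx_euler b sigma g lam gam A0 (dyadic_step R n) (euler b sigma g x0 (dyadic_step R n)).
Proof.
have M20 : 0 < 2 * M ^+ 2 by rewrite mulr_gt0 // exprn_gt0 // (lt_le_trans ltr01).
have half0 : (0 : R) < 2^-1 by rewrite invr_gt0.
have [tau /andP[tau0 tau1] Htau] := exists_small_powR M20 half0 gam0.
have [n0 Hn0] := dyadic_step_small tau0; exists n0 => n nn.
apply: (approx_euler_euler YD) => //; first by rewrite dyadic_step_gt0 dyadic_step_le1.
apply: (le_trans _ Htau); rewrite ler_wpM2l ?(ltW M20) //.
by apply: le_powR_base; rewrite ?(ltW gam0) ?(ltW (dyadic_step_gt0 _ _)) // Hn0.
Qed.

Lemma approx_euler_le A A' h X : A <= A' ->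
  approx_euler b sigma g lam gam A h X -> approx_euler b sigma g lam gam A' h X.
Proof.
move=> AA' [X1 Xe]; split=> // k; apply: (le_trans (Xe k)).
by rewrite ler_wpM2r ?powR_ge0.
Qed.

(** At time [u] the index of level [n.+1] is [2 * k] or [2 * k + 1], where [k] is that of level [n].
    Returning to [2 * k] costs a Hoelder increment over at most one step, of order [h ^ gam]; there
    the finer scheme, sampled at even indices, is compared with the coarser one by stability, at a
    cost of order [h ^ rho]. *)
Lemma euler_path_cauchy (T : R) : 0 <= T -> exists n0, exists C, exists r,
  [/\ 0 <= C, 0 <= r < 1 & forall u n, 0 <= u <= T -> (n0 <= n)%N ->
    enorm (euler_path n.+1 u - euler_path n u) <= C * r ^+ n].
Proof.
move=> T0.
have [t1 /andP[t10 t11] [A A0A Hco]] := approx_euler_coarsen YD A00.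
have A_0 : 0 <= A by apply: le_trans A0A.
have [t2 /andP[t20 t21] [rho rho0 Hst]] := approx_euler_stable_global YD A_0.
have [t3 /andP[t30 t31] [C C1 Hho]] := approx_euler_holder YD A_0.
have [n1 Hn1] := approx_euler_dyadic.
have t0 : 0 < Num.min t1 (Num.min t2 t3) by rewrite !lt_min t10 t20.
have [n2 Hn2] := dyadic_step_small t0.
pose n0 := maxn n1 n2.
pose r1 : R := 2^-1 `^ gam; pose r2 : R := 2^-1 `^ rho; pose r := Num.max r1 r2.
have r10 : 0 <= r1 := powR_ge0 _ _.
have r20 : 0 <= r2 := powR_ge0 _ _.
have r01 : 0 <= r < 1.
  rewrite /r le_max r10 /= gt_max.
  by case/andP: (dyadic_ratio_lt1 gam0) => _ ->; case/andP: (dyadic_ratio_lt1 rho0) => _ ->.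
(* Windows of [2 ^ (n - n2)] steps have length [2 ^ (- n2)], at most [t2]. As [n2 <= n0], [J] of
   them cover [[0, T]] whatever [n] is, so that [3 ^+ J] is a constant. *)
pose J := ((Num.truncn T).+1 * 2 ^ n0)%N.
have C0 : 0 <= C := le_trans ler01 C1.
exists n0; exists (C + 3 ^+ J); exists r; split => //; first by rewrite addr_ge0 // exprn_ge0.
move=> u n /andP[u0 uT]; rewrite geq_max => /andP[nn1 nn2].
pose h := dyadic_step R n; have h0 : 0 < h := dyadic_step_gt0 _ n.
have := Hn2 n nn2; rewrite !le_min -/h => /and3P[ht1 ht2 ht3].
have hS : dyadic_step R n.+1 = h / 2 by apply: dyadic_stepS.
have aX := Hn1 _ nn1; have aY := Hn1 _ (leqW nn1).
pose k := dyadic_index n u.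
have /andP[k1 k2] := dyadic_indexS n u0; rewrite -/k in k1 k2.
have e1 : enorm (euler_path n.+1 u - euler b sigma g x0 (dyadic_step R n.+1) (2 * k)%N) <= C * h `^ gam.
  have w : (dyadic_index n.+1 u - 2 * k)%:R * dyadic_step R n.+1 <= h.
    rewrite hS; apply: (@le_trans _ _ (1%:R * (h / 2))); last by rewrite mul1r; lra.
    by rewrite ler_wpM2r ?divr_ge0 ?(ltW h0) // ler_nat leq_subLR addn1.
  have := Hho _ _ _ _ (dyadic_step_gt0 _ _) (approx_euler_le A0A aY) k1 (le_trans w ht3).
  move=> H; apply: (le_trans H); rewrite ler_wpM2l //.
  by apply: le_powR_base; rewrite ?(ltW gam0) // mulr_ge0 // ltW // dyadic_step_gt0.
have e2 : enorm (euler b sigma g x0 (dyadic_step R n.+1) (2 * k)%N - euler_path n u) <= 3 ^+ J * h `^ rho.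
  rewrite enorm_distC; rewrite hS in aY *.
  have aY' : approx_euler b sigma g lam gam A h (fun k => euler b sigma g x0 (h / 2) (2 * k)%N).
    by apply: Hco => //; rewrite h0.
  have Nh : (2 ^ (n - n2))%:R * h <= t2.
    have := Hn2 n2 (leqnn _); rewrite !le_min => /and3P[_ + _]; apply: le_trans.
    rewrite natrX /h /dyadic_step -{2}(subnK nn2) exprD mulrA -exprMn divff //.
    by rewrite expr1n mul1r.
  apply: (Hst h _ _ (2 ^ (n - n2))%N h0 (approx_euler_le A0A aX) aY' _ _ Nh) => //.
    by rewrite expn_gt0.
  rewrite /J -mulnA.
  have : (k <= (Num.truncn T).+1 * 2 ^ n)%N.
    rewrite /k /dyadic_index truncn_le_nat -[ltRHS]natr1 natrM natrX.
    have p0 : 0 < 2 ^+ n :> R by rewrite exprn_gt0.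
    apply: (@le_lt_trans _ _ ((Num.truncn T).+1%:R * 2 ^+ n)); last by rewrite ltrDl.
    rewrite ler_pM2r // (le_trans uT) // ltW //; by case/andP: (truncn_itv T0).
  move=> H; apply: (leq_trans H); rewrite leq_mul2l /= -expnD leq_exp2l //.
  by rewrite -leq_subLR leq_sub2l // leq_maxr.
rewrite -(subrK (euler b sigma g x0 (dyadic_step R n.+1) (2 * k)%N) (euler_path n.+1 u)) -addrA.
apply: (le_trans (ler_enormD _ _)); rewrite mulrDl; apply: lerD.
  apply: (le_trans e1); rewrite ler_wpM2l // dyadic_step_powR.
  by apply: lerXn2r; rewrite ?nnegrE ?(andP r01).1 // /r le_max lexx.
apply: (le_trans e2); rewrite ler_wpM2l ?exprn_ge0 // dyadic_step_powR.
by apply: lerXn2r; rewrite ?nnegrE ?(andP r01).1 // /r le_max lexx orbT.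
Qed.

Lemma euler_path_cvg u i : 0 <= u ->
  euler_path n u 0 i @[n --> \oo] --> euler_limit u 0 i.
Proof.
move=> u0; have [n0 [C [r [C0 r01 H]]]] := euler_path_cauchy u0.
rewrite mxE; apply: (@geometric_cauchy_row_cvg _ _ (euler_path ^~ u) C r n0) => // n nn.
by apply: H => //; rewrite u0 lexx.
Qed.

Lemma euler_limit_error (T : R) : 0 <= T -> exists n0, exists C, exists r,
  [/\ 0 <= C, 0 <= r < 1 & forall u n, 0 <= u <= T -> (n0 <= n)%N ->
    enorm (euler_limit u - euler_path n u) <= C * r ^+ n].
Proof.
move=> T0; have [n0 [C [r [C0 r01 H]]]] := euler_path_cauchy T0.
exists n0; exists (d%:R * (C / (1 - r))); exists r; split => //.
  by rewrite mulr_ge0 // divr_ge0 // subr_ge0 ltW //; case/andP: r01.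
move=> u n uT nn; apply: (@geometric_cauchy_row _ _ (euler_path ^~ u) C r n0) => // m nm.
exact: H.
Qed.

Lemma enorm_euler_path n u : enorm (euler_path n u) <= 1.
Proof. by rewrite /euler_path; case: (dyadic_index n u) => [|k] //=; apply: enorm_ball_proj. Qed.

Lemma enorm_euler_limit u : 0 <= u -> enorm (euler_limit u) <= 1.
Proof.
move=> u0; have [n0 [C [r [C0 r01 H]]]] := euler_limit_error u0.
apply: (@le_geometric_error _ _ _ C r n0 r01) => n nn.
apply: (le_trans (ler_enorm_sub _ (euler_path n u))); apply: lerD.
  exact: enorm_euler_path.
by apply: H => //; rewrite u0 lexx.
Qed.

Lemma euler_limit0 : euler_limit 0 = x0.
Proof.
apply/rowP => i; rewrite mxE (_ : (fun n => _) = fun=> x0 0 i) ?lim_cst //.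
by apply/funext => n; rewrite /euler_path /dyadic_index mul0r truncn0.
Qed.

(** The drift sum inside the defect is replaced by the drift frozen at the left end. Each term
    changes by [O(h * w ^ lam)], the sum therefore by [O(w * w ^ lam)], and [w <= w ^ gam]. *)
Lemma approx_euler_davie A : 0 <= A -> exists2 tau, 0 < tau <= 1 & exists2 K, 0 <= K &
  forall h X k l, 0 < h -> approx_euler b sigma g lam gam A h X -> (k <= l)%N ->
    (l - k)%:R * h <= tau ->
    enorm (X l - X k - ((l - k)%:R * h) *: b (k%:R * h) (X k)
           - (g (l%:R * h) - g (k%:R * h)) *: sigma (k%:R * h) (X k))
      <= K * ((l - k)%:R * h) `^ (lam + gam).
Proof.
move=> A_0; have [t1 /andP[t10 t11] [K K0 HK]] := euler_defect_le YD A_0.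
have [t2 /andP[t20 t21] [C C1 HC]] := approx_euler_holder YD A_0.
have C0 : 0 <= C := le_trans ler01 C1.
exists (Num.min t1 t2); first by rewrite lt_min t10 t20 ge_min t11.
exists (K + M * (1 + C)); first by rewrite addr_ge0 // mulr_ge0 // addr_ge0.
move=> h X k l h0 aX kl; set w := (l - k)%:R * h; rewrite le_min => /andP[wt1 wt2].
have w0 : 0 <= w by rewrite mulr_ge0 // ltW.
have w1 : w <= 1 by apply: le_trans t11.
have [X1 _] := aX.
have -> : X l - X k - w *: b (k%:R * h) (X k)
    - (g (l%:R * h) - g (k%:R * h)) *: sigma (k%:R * h) (X k)
  = euler_defect b sigma g h X k l
    + \sum_(k <= j < l) h *: (b (j%:R * h) (X j) - b (k%:R * h) (X k)).
  have -> : \sum_(k <= j < l) h *: (b (j%:R * h) (X j) - b (k%:R * h) (X k))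
     = \sum_(k <= j < l) h *: b (j%:R * h) (X j) - w *: b (k%:R * h) (X k).
    rewrite /w -scalerA scaler_nat -sumr_const_nat -sumrB; apply: eq_bigr => j _.
    by rewrite scalerBr.
  by rewrite /euler_defect; apply/rowP => i; rewrite !mxE; ring.
apply: (le_trans (ler_enormD _ _)); rewrite mulrDl; apply: lerD; first exact: HK.
apply: (le_trans (ler_enorm_sum _ _)).
apply: (@le_trans _ _ (w * (M * ((1 + C) * w `^ lam)))); last first.
  rewrite powRD_gt0 //.
  have -> : M * (1 + C) * (w `^ lam * w `^ gam) = w `^ gam * (M * ((1 + C) * w `^ lam)) by ring.
  rewrite ler_wpM2r ?mulr_ge0 ?addr_ge0 ?powR_ge0 //.
  by apply: (powR_ge_id YD); rewrite w0.
apply: (@le_trans _ _ (\sum_(k <= j < l) h * (M * ((1 + C) * w `^ lam)))); last first.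
  by rewrite sumr_const_nat -mulr_natl mulrA.
rewrite big_nat_cond [leRHS]big_nat_cond.
apply: ler_sum => j /andP[/andP[kj jl] _]; rewrite enormZ ger0_norm ?(ltW h0) // ler_wpM2l ?(ltW h0) //.
have jw : (j - k)%:R * h <= w by rewrite ler_wpM2r ?(ltW h0) // ler_nat leq_sub2r // ltnW.
have jw0 : 0 <= (j - k)%:R * h by rewrite mulr_ge0 // ltW.
have kh0 : 0 <= k%:R * h by rewrite mulr_ge0 // ltW.
have jE : j%:R * h = k%:R * h + (j - k)%:R * h by rewrite -mulrDl -natrD subnKC.
apply: (le_trans (young_b YD kh0 _ _ (X1 j) (X1 k))).
- by rewrite jE lerDl.
- by rewrite jE lerD2l (le_trans jw).
rewrite ler_wpM2l // mulrDl mul1r jE addrAC subrr add0r; apply: lerD.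
  by apply: le_powR_base => //; apply: ltW.
apply: (le_trans (HC _ _ _ _ h0 aX kj (le_trans jw wt2))); rewrite ler_wpM2l //.
apply: (@le_trans _ _ (w `^ gam)); first by apply: le_powR_base => //; apply: ltW.
by apply: ge_powR_exponent; rewrite ?w0.
Qed.

(** The expansion of the schemes between the grid points just below [s] and [t] is uniform in the
    step. It passes to the limit because replacing states, times and values of [g] by those on the
    grid costs [O(q ^+ n)]. *)
Lemma euler_limit_davie : exists2 tau, 0 < tau <= 1 & exists2 K, 0 <= K &
  forall s t, 0 <= s -> s <= t -> t <= s + tau ->
    enorm (euler_limit t - euler_limit s - (t - s) *: b s (euler_limit s)
           - (g t - g s) *: sigma s (euler_limit s)) <= K * (t - s) `^ (lam + gam).
Proof.
have [t1 /andP[t10 t11] [K K0 HK]] := approx_euler_davie A00.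
have [n1 Hn1] := approx_euler_dyadic.
(* Rounding to the grid can at most double the length, [w <= 2 * (t - s)], as soon as [h <= t - s].
   This explains the half of [t1] and the factor [2 ^ (lam + gam)] in the next witness. *)
exists (t1 / 2); first by rewrite divr_gt0 //= ler_pdivrMr // mul1r (le_trans t11) // ler1n.
exists (K * 2 `^ (lam + gam)); first by rewrite mulr_ge0 // powR_ge0.
move=> s t s0 st tst; set Phi := _ - _ - _ - _.
have th0 : 0 < lam + gam by rewrite addr_gt0.
have t0 : 0 <= t := le_trans s0 st.
have [ts|nts] := eqVneq t s.
  rewrite /Phi ts !subrr !scale0r !subr0 enorm0 powR0 ?gt_eqF // mulr0 //.
have tsgt : 0 < t - s by rewrite subr_gt0 lt_neqAle eq_sym nts.
have [n2 Hn2] := dyadic_step_small tsgt.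
have [n3 [C [r [C0 /andP[r0 r1] HC]]]] := euler_limit_error t0.
pose q := Num.max r (2^-1 `^ lam).
have q01 : 0 <= q < 1.
  by rewrite /q le_max r0 gt_max r1 /=; case/andP: (dyadic_ratio_lt1 lam0).
have q0 : 0 <= q by case/andP: q01.
(* The constant is the sum of the coefficients in the bounds [B1] to [B6] below. *)
apply: (@le_geometric_error _ _ _ (2 * C + M * (1 + C) + 2 * M + M ^+ 2 * (1 + C) + 2 * M ^+ 2) q
  (maxn n1 (maxn n2 n3)) q01) => n.
rewrite !geq_max => /and3P[nn1 nn2 nn3].
set h := dyadic_step R n; have h0 : 0 < h := dyadic_step_gt0 _ n.
have h1 : h <= 1 := dyadic_step_le1 _ n.
set e := q ^+ n; have e0 : 0 <= e by rewrite exprn_ge0.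
have re : r ^+ n <= e by apply: lerXn2r; rewrite ?nnegrE // /q le_max lexx.
have hle : h `^ lam <= e.
  by rewrite dyadic_step_powR; apply: lerXn2r; rewrite ?nnegrE ?powR_ge0 // /q le_max lexx orbT.
have hge : h `^ gam <= e.
  by apply: le_trans hle; apply: ge_powR_exponent; rewrite ?(ltW h0).
have he : h <= e by apply: le_trans hge; apply: (powR_ge_id YD); rewrite (ltW h0).
have Ce : C * r ^+ n <= C * e by rewrite ler_wpM2l.
pose k := dyadic_index n s; pose l := dyadic_index n t.
have kl : (k <= l)%N by apply: dyadic_index_le.
have := dyadic_index_bounds n s0; rewrite -/h -/k => /andP[ks sk].
have := dyadic_index_bounds n t0; rewrite -/h -/l => /andP[lt tl].
pose Xk := euler_path n s; pose Xl := euler_path n t.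
have hts : h <= t - s := Hn2 n nn2.
pose w := (l - k)%:R * h.
have wE : w = l%:R * h - k%:R * h by rewrite /w natrB // mulrBl.
have w0 : 0 <= w by rewrite mulr_ge0 // ltW.
have w2 : w <= 2 * (t - s) by rewrite wE; move: lt sk hts; goal_lra.
have wt1 : w <= t1 by move: w2 tst; goal_lra.
have kh0 : 0 <= k%:R * h by rewrite mulr_ge0 // ltW.
pose Phin := Xl - Xk - w *: b (k%:R * h) Xk
   - (g (l%:R * h) - g (k%:R * h)) *: sigma (k%:R * h) Xk.
have HPhin : enorm Phin <= K * 2 `^ (lam + gam) * (t - s) `^ (lam + gam).
  rewrite -mulrA -powRM //; last exact: ltW.
  apply: (le_trans (HK _ _ _ _ h0 (Hn1 n nn1) kl wt1)); rewrite ler_wpM2l //.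
  by apply: le_powR_base => //; apply: ltW.
apply: (le_trans (ler_enorm_sub _ Phin)); apply: lerD => //.
set Xs := euler_limit s in Phi *; set Xt := euler_limit t in Phi *.
have -> : Phi - Phin = (Xt - Xl) - (Xs - Xk)
  - ((t - s) *: (b s Xs - b (k%:R * h) Xk) + (t - s - w) *: b (k%:R * h) Xk)
  - ((g t - g s) *: (sigma s Xs - sigma (k%:R * h) Xk)
     + (g t - g s - (g (l%:R * h) - g (k%:R * h))) *: sigma (k%:R * h) Xk).
  by rewrite /Phi /Phin; apply/rowP => i; rewrite !mxE; ring.
have Xk1 : enorm Xk <= 1 := enorm_euler_path n s.
have Xs1 : enorm Xs <= 1 := enorm_euler_limit s0.
have B1 : enorm (Xt - Xl) <= C * e by apply: le_trans Ce; apply: HC => //; rewrite t0 lexx.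
have B2 : enorm (Xs - Xk) <= C * e by apply: le_trans Ce; apply: HC => //; rewrite s0.
have skh : s - k%:R * h <= h by move: sk; goal_lra.
have sk1 : s <= k%:R * h + 1 by move: skh h1; goal_lra.
have L : M * ((s - k%:R * h) `^ lam + enorm (Xs - Xk)) <= M * (1 + C) * e.
  rewrite -mulrA ler_wpM2l // mulrDl mul1r lerD //.
  apply: (le_trans _ hle); apply: le_powR_base; [exact: ltW|move: ks; goal_lra|exact: skh].
have ts1 : t - s <= 1 by move: tst t10 t11; goal_lra.
have B3 : enorm ((t - s) *: (b s Xs - b (k%:R * h) Xk)) <= M * (1 + C) * e.
  rewrite enormZ ger0_norm ?(ltW tsgt) // -[leRHS]mul1r; apply: ler_pM; rewrite ?enorm_ge0 ?(ltW tsgt) //.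
  by apply: (le_trans (young_b YD kh0 ks sk1 Xs1 Xk1)).
have B4 : enorm ((t - s - w) *: b (k%:R * h) Xk) <= 2 * e * M.
  rewrite enormZ; apply: ler_pM; rewrite ?enorm_ge0 //; last exact: (young_b_bd YD).
  by rewrite wE ler_norml; apply/andP; split; move: ks sk lt tl he; goal_lra.
have gts : `|g t - g s| <= M.
  apply: (le_trans (young_g YD s0 st)); rewrite -[leRHS]mulr1 ler_wpM2l //.
  by apply: powR_le1; rewrite ?(ltW tsgt) // ltW.
have B5 : enorm ((g t - g s) *: (sigma s Xs - sigma (k%:R * h) Xk)) <= M * (M * (1 + C) * e).
  rewrite enormZ; apply: ler_pM; rewrite ?enorm_ge0 //.
  by apply: (le_trans (young_sigma YD kh0 ks sk1 Xs1 Xk1)).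
have lh0 : 0 <= l%:R * h by rewrite mulr_ge0 // ltW.
have gt' : `|g t - g (l%:R * h)| <= M * e.
  apply: (le_trans (young_g YD lh0 lt)); rewrite ler_wpM2l //; apply: le_trans hge.
  by apply: le_powR_base; [exact: ltW | move: lt; goal_lra | move: tl; goal_lra].
have gs' : `|g s - g (k%:R * h)| <= M * e.
  apply: (le_trans (young_g YD kh0 ks)); rewrite ler_wpM2l //; apply: le_trans hge.
  by apply: le_powR_base; [exact: ltW | move: ks; goal_lra | move: sk; goal_lra].
have B6 : enorm ((g t - g s - (g (l%:R * h) - g (k%:R * h))) *: sigma (k%:R * h) Xk) <= 2 * (M * e) * M.
  rewrite enormZ; apply: ler_pM; rewrite ?enorm_ge0 //; last exact: (young_sigma_bd YD).
  have -> : g t - g s - (g (l%:R * h) - g (k%:R * h)) = (g t - g (l%:R * h)) - (g s - g (k%:R * h)) by ring.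
  by apply: (le_trans (ler_normB _ _)); move: gt' gs'; goal_lra.
have T1 := ler_enormB (Xt - Xl) (Xs - Xk).
have T2 := ler_enormD ((t - s) *: (b s Xs - b (k%:R * h) Xk)) ((t - s - w) *: b (k%:R * h) Xk).
have T3 := ler_enormD ((g t - g s) *: (sigma s Xs - sigma (k%:R * h) Xk))
  ((g t - g s - (g (l%:R * h) - g (k%:R * h))) *: sigma (k%:R * h) Xk).
apply: (le_trans (ler_enormB _ _)).
have -> : (2 * C + M * (1 + C) + 2 * M + M ^+ 2 * (1 + C) + 2 * M ^+ 2) * e =
  ((C * e + C * e) + (M * (1 + C) * e + 2 * e * M)) + (M * (M * (1 + C) * e) + 2 * (M * e) * M) by ring.
apply: lerD; last by apply: (le_trans T3); apply: lerD.
apply: (le_trans (ler_enormB _ _)); apply: lerD.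
  by apply: (le_trans T1); apply: lerD.
by apply: (le_trans T2); apply: lerD.
Qed.

Lemma euler_limit_holder : exists2 tau, 0 < tau <= 1 & exists2 C, 0 <= C &
  forall s t, 0 <= s -> s <= t -> t <= s + tau ->
    enorm (euler_limit t - euler_limit s) <= C * (t - s) `^ gam.
Proof.
have [tau /andP[tau0 tau1] [K K0 HK]] := euler_limit_davie.
exists tau; first by rewrite tau0.
exists (K + M + M ^+ 2); first by rewrite !addr_ge0 // exprn_ge0.
move=> s t s0 st tst; have w0 : 0 <= t - s by rewrite subr_ge0.
have w1 : 0 <= t - s <= 1 by rewrite w0; lra.
have Xs1 := enorm_euler_limit s0.
have H := HK s t s0 st tst.
set Xs := euler_limit s in Xs1 H *; set Xt := euler_limit t in H *.
set Phi := Xt - Xs - _ - _ in H.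
have -> : Xt - Xs = Phi + ((t - s) *: b s Xs + (g t - g s) *: sigma s Xs).
  by rewrite /Phi; apply/rowP => i; rewrite !mxE; ring.
apply: (le_trans (ler_enormD _ _)); rewrite !mulrDl -addrA; apply: lerD.
  apply: (le_trans H); rewrite ler_wpM2l //; apply: ge_powR_exponent => //.
  by rewrite lerDr ltW.
apply: (le_trans (ler_enormD _ _)); rewrite !enormZ; apply: lerD.
  rewrite ger0_norm // mulrC; apply: ler_pM; rewrite ?enorm_ge0 //; first exact: (young_b_bd YD).
  exact: (powR_ge_id YD).
rewrite expr2 mulrAC; apply: ler_pM; rewrite ?enorm_ge0 //; first exact: (young_g YD).
exact: (young_sigma_bd YD).
Qed.

End YoungLimit.

(** * From local estimates to integrals *)

Section Integrals.
Variable R : realType.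
Implicit Types f g y : R -> R.

Lemma nth_path_le (a c : R) (l : seq R) k : itv_partition a c l -> (k < size l)%N ->
  [/\ a <= nth c (a :: l) k, nth c (a :: l) k < nth c (a :: l) k.+1 &
      nth c (a :: l) k.+1 <= c].
Proof.
move=> [pl /eqP lc] kl.
have srt : sorted <%O (a :: l) by [].
have ss : sorted <=%O (a :: l) by apply: sub_sorted srt => u v /ltW.
have lt := sorted_ltn_nth lt_trans c srt.
have le := sorted_leq_nth le_trans le_refl c ss.
split.
- by have := le 0%N k; rewrite !inE /=; apply => //; apply: ltnW.
- by apply: lt; rewrite ?inE //= ltnS // ltnW.
- have cE : nth c (a :: l) (size l) = c by rewrite -[RHS]lc (last_nth c).
  by rewrite -[leRHS]cE; have := le k.+1 (size l); rewrite !inE /= !ltnS; apply.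
Qed.

(** The increments of [y] telescope along the subdivision. On a subinterval of length [w], the
    left-point term misses the increment of [y] by [O(w ^ th)], and moving the tag away from the
    left end costs [O(w ^ (lam + gam))]. The errors add up to at most a constant times the mesh to
    the power [th - 1] times the total length. *)
Lemma RS_integral_of_local_estimate f g y (a c tau K th lam gam : R) :
  a <= c -> 0 < tau <= 1 -> 0 <= K -> 0 < lam -> 0 < gam -> 1 < th -> th <= lam + gam ->
  (forall u v, a <= u -> u <= v -> v <= c -> v <= u + tau ->
    [/\ `|y v - y u - f u * (g v - g u)| <= K * (v - u) `^ th,
        `|f v - f u| <= K * (v - u) `^ lam & `|g v - g u| <= K * (v - u) `^ gam]) ->
  is_RS_integral f g a c (y c - y a).
Proof.
move=> ac /andP[tau0 tau1] K0 lam0 gam0 th1 thlg H eps eps0.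
(* Both added units serve only to make [Q] positive, [K] and [c - a] being possibly 0. *)
pose Q := (K ^+ 2 + K + 1) * (c - a + 1).
have Q0 : 0 < Q by rewrite mulr_gt0 // ltr_wpDl ?subr_ge0 ?addr_ge0 ?sqr_ge0.
have eps20 : 0 < eps / 2 by rewrite divr_gt0.
have th10 : 0 < th - 1 by rewrite subr_gt0.
have [eta /andP[eta0 eta1] Heta] := exists_small_powR Q0 eps20 th10.
exists (Num.min tau eta); first by rewrite lt_min tau0.
move=> l xi [pl tag] mesh.
set p := nth c (a :: l) in tag mesh.
have yE : y c - y a = \sum_(0 <= k < size l) (y (p k.+1) - y (p k)).
  rewrite (telescope_sumr (fun k => y (p k))) // /p /=.
  by case: pl => _ /eqP lc; rewrite -[in LHS]lc (last_nth c).
have cE : c - a = \sum_(0 <= k < size l) (p k.+1 - p k).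
  rewrite (telescope_sumr p) // /p /=.
  by case: pl => _ /eqP lc; rewrite -[in LHS]lc (last_nth c).
rewrite yE /RS_sum -/p -sumrB.
apply: (le_lt_trans (ler_norm_sum _ _ _)).
apply: (@le_lt_trans _ _ (\sum_(0 <= k < size l) ((K ^+ 2 + K) * eta `^ (th - 1)) * (p k.+1 - p k))).
  rewrite big_nat_cond [leRHS]big_nat_cond; apply: ler_sum => k /andP[/andP[_ kl] _].
  have [h1 h2 h3] := nth_path_le pl kl; rewrite -/p in h1 h2 h3.
  have := mesh k kl; rewrite -/p lt_min => /andP[m1 m2].
  have /andP[x1 x2] := tag k kl; rewrite -/p in x1 x2.
  set w := p k.+1 - p k in m1 m2 *.
  have w0 : 0 < w by rewrite subr_gt0.
  have wt : p k.+1 <= p k + tau by rewrite -lerBlDl ltW.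
  have [e1 _ e3] := H _ _ h1 (ltW h2) h3 wt.
  have [_ e2 _] := H (p k) (xi k) h1 x1 (le_trans x2 h3) (le_trans x2 wt).
  rewrite -/w in e1 e3.
  have xw : (xi k - p k) `^ lam <= w `^ lam.
    by apply: le_powR_base; rewrite ?subr_ge0 ?(ltW lam0) // lerD2r.
  have wth : w `^ (lam + gam) <= w `^ th.
    apply: ge_powR_exponent => //; last exact: lt_trans th1.
    by rewrite (ltW w0) /= (le_trans (ltW m1)).
  have weta : w `^ th <= eta `^ (th - 1) * w.
    rewrite -mulr_powRB1 ?(ltW w0) ?(lt_trans ltr01) // mulrC ler_wpM2r ?(ltW w0) //.
    by apply: le_powR_base; rewrite ?(ltW th10) ?(ltW w0) ?(ltW m2).
  have -> : f (xi k) * (g (p k.+1) - g (p k)) - (y (p k.+1) - y (p k)) =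
    (f (xi k) - f (p k)) * (g (p k.+1) - g (p k)) -
    (y (p k.+1) - y (p k) - f (p k) * (g (p k.+1) - g (p k))) by ring.
  apply: (le_trans (ler_normB _ _)).
  have e4 : `|(f (xi k) - f (p k)) * (g (p k.+1) - g (p k))| <= K * w `^ lam * (K * w `^ gam).
    rewrite normrM; apply: ler_pM => //; apply: (le_trans e2); by rewrite ler_wpM2l.
  have e5 : K * w `^ lam * (K * w `^ gam) = K ^+ 2 * w `^ (lam + gam).
    by rewrite powRD_gt0 //; ring.
  rewrite e5 in e4.
  have e6 : K ^+ 2 * w `^ (lam + gam) <= K ^+ 2 * w `^ th by rewrite ler_wpM2l // sqr_ge0.
  have e7 : (K ^+ 2 + K) * w `^ th <= (K ^+ 2 + K) * (eta `^ (th - 1) * w).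
    by rewrite ler_wpM2l // addr_ge0 // sqr_ge0.
  rewrite mulrA in e7; apply: le_trans e7.
  have -> : (K ^+ 2 + K) * w `^ th = K ^+ 2 * w `^ th + K * w `^ th by ring.
  by apply: lerD => //; apply: (le_trans e4).
rewrite -mulr_sumr -cE.
apply: (@le_lt_trans _ _ (Q * eta `^ (th - 1))); last by apply: (le_lt_trans Heta); lra.
rewrite mulrAC ler_wpM2r ?powR_ge0 //; apply: ler_pM; rewrite ?subr_ge0 //.
- by rewrite addr_ge0 // sqr_ge0.
- by rewrite lerDl.
- by rewrite lerDl.
Qed.

Lemma within_continuous_holder f (a c tau C lam : R) : 0 < tau -> 0 < lam -> 0 <= C ->
  (forall u v, a <= u -> u <= v -> v <= c -> v <= u + tau -> `|f v - f u| <= C * (v - u) `^ lam) ->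
  {within `[a, c], continuous f}.
Proof.
move=> tau0 lam0 C0 H; apply/subspace_continuousP => x Ax.
apply/cvgrPdist_le => e e0; rewrite near_withinE.
have C10 : 0 < C + 1 by rewrite ltr_wpDl.
have [eta /andP[eta0 eta1] Heta] := exists_small_powR C10 e0 lam0.
have m0 : 0 < Num.min tau eta by rewrite lt_min tau0.
have Hle u v : a <= u -> u <= v -> v <= c -> v <= u + tau -> v <= u + eta -> `|f v - f u| <= e.
  move=> au uv vc vt ve; apply: (le_trans (H _ _ au uv vc vt)).
  apply: le_trans Heta; apply: ler_pM; rewrite ?powR_ge0 // ?lerDl //.
  by apply: le_powR_base; rewrite ?subr_ge0 ?(ltW lam0) // lerBlDl.
near=> z => Az.
have zx : `|x - z| <= Num.min tau eta.
  by near: z; apply: (@cvgr_dist_le _ _ _ _ _ id x) => //; apply: cvg_id.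
rewrite le_min !ler_norml in zx; have /andP[/andP[z1 z2] /andP[z3 z4]] := zx.
move: Ax Az; rewrite /= !in_itv /= => /andP[ax xc] /andP[az zc].
case: (leP x z) => [xz|/ltW xz].
  by rewrite distrC; apply: Hle => //; lra.
by apply: Hle => //; lra.
Unshelve. all: by end_near. Qed.

Lemma Rintegral_increment_le f (a c u v e : R) : a <= u -> u <= v -> v <= c ->
  {within `[a, c], continuous f} ->
  (forall r, u <= r <= v -> `|f r - f u| <= e) ->
  `|\int[lebesgue_measure]_(r in `[a, v]) f r - \int[lebesgue_measure]_(r in `[a, u]) f r
    - f u * (v - u)| <= e * (v - u).
Proof.
move=> au uv vc cf fe.
have int p q : a <= p -> q <= c -> lebesgue_measure.-integrable `[p, q] (EFin \o f).
  move=> ap qc; apply: continuous_compact_integrable; first exact: segment_compact.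
  apply: continuous_subspaceW cf => r /=; rewrite !in_itv /= => /andP[pr rq].
  by rewrite (le_trans ap) //= (le_trans rq).
rewrite Rintegral_itvB ?bnd_simp //; last exact: int.
rewrite Rintegral_itv_obnd_cbnd; last first.
  apply: integrableS (int u v au vc) => //.
  by apply: subset_itv => //; rewrite bnd_simp.
have muE : fine (lebesgue_measure `[u, v]) = v - u.
  by rewrite lebesgue_measure_itv /= lte_fin; case: ltgtP uv => // -> _ /=; rewrite subrr.
have int_cst (k : R) : lebesgue_measure.-integrable `[u, v] (EFin \o (fun=> k)).
  apply: continuous_compact_integrable; first exact: segment_compact.
  by apply: continuous_subspaceT => r; apply: cvg_cst.
have mI : measurable [set` `[u, v]] by [].
have <- : \int[lebesgue_measure]_(r in `[u, v]) (fun=> f u) r = f u * (v - u).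
  by rewrite Rintegral_cst // muE.
rewrite -RintegralB //; last exact: int.
have intB : lebesgue_measure.-integrable `[u, v] (EFin \o (fun r => f r - f u)).
  rewrite (_ : _ \o _ = (EFin \o f) \- (EFin \o (fun=> f u)))%E //.
  by apply: integrableB => //; apply: int.
apply: (le_trans (le_normr_Rintegral _ intB)) => //.
rewrite -muE -Rintegral_cst //; apply: le_Rintegral => //.
  exact: integrable_norm.
Qed.

Lemma Rintegral_point f (a : R) : \int[lebesgue_measure]_(r in `[a, a]) f r = 0.
Proof. by rewrite set_itv1 Rintegral_set1. Qed.

End Integrals.

(** * Second differences of a field with Hoelder gradient *)

Section SecondDifference.
Variables (R : realType) (d : nat).
Implicit Types (F G : 'rV[R]_d -> 'rV[R]_d) (p v : 'rV[R]_d).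

Lemma is_derive_line_coord F p v (u : R) i : differentiable F (p + u *: v) ->
  is_derive u 1 (fun u => F (p + u *: v) 0 i) ((v *m 'J F (p + u *: v)) 0 i).
Proof.
move=> dF; set q := p + u *: v in dF *.
have cv : (h^-1 *: (F (h *: v + q) - F q)) @[h --> 0^'] --> v *m 'J F q.
  by rewrite -deriveEjacobian //; exact: (@diff_derivable _ _ _ F q v dF).
have cvi : (h^-1 *: (F (h *: v + q) - F q)) 0 i @[h --> 0^'] --> (v *m 'J F q) 0 i.
  exact: (continuous_cvg _ (@coord_continuous R 1 d 0 i (v *m 'J F q)) cv).
have cvf : (h^-1 *: (((fun u => F (p + u *: v) 0 i) \o shift u) (h *: 1) - F q 0 i))
    @[h --> 0^'] --> (v *m 'J F q) 0 i.
  apply: cvg_trans cvi; apply: near_eq_cvg; near=> h.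
  rewrite !mxE /= /GRing.scale /= mulr1.
  by have -> : p + (h + u) *: v = h *: v + q by rewrite /q scalerDl addrCA.
apply: DeriveDef; first by apply/cvg_ex; exists ((v *m 'J F q) 0 i).
exact: (cvg_lim (@norm_hausdorff _ _) cvf).
Unshelve. all: by end_near. Qed.

(** The sum is at most twice the larger of the two numbers, and [2 ^ r <= 2]. *)
Lemma powR_half_sum (x y r : R) : 0 <= x -> 0 <= y -> 0 <= r <= 1 ->
  (x + y) `^ r <= 2 * (x `^ r + y `^ r).
Proof.
move=> x0 y0 /andP[r0 r1].
have H (u v : R) : 0 <= u -> u <= v -> (u + v) `^ r <= 2 * (u `^ r + v `^ r).
  move=> u0 uv; have v0 := le_trans u0 uv.
  apply: (@le_trans _ _ ((2 * v) `^ r)); first by apply: le_powR_base; [|rewrite addr_ge0|lra].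
  rewrite powRM //; apply: ler_pM; rewrite ?powR_ge0 //; last by rewrite lerDr powR_ge0.
  by apply: ler1_powR => //; rewrite ler1n.
case: (leP x y) => [xy|/ltW yx]; first exact: H.
by rewrite addrC [X in _ * X]addrC; apply: H.
Qed.

Lemma enorm_segment_le1 p q (u : R) : 0 <= u <= 1 -> enorm p <= 1 -> enorm q <= 1 ->
  enorm (p + u *: (q - p)) <= 1.
Proof.
move=> /andP[u0 u1] p1 q1.
have -> : p + u *: (q - p) = (1 - u) *: p + u *: q.
  by apply/rowP => i; rewrite !mxE; ring.
apply: (le_trans (ler_enormD _ _)); rewrite !enormZ !ger0_norm ?subr_ge0 //.
have : (1 - u) * enorm p <= (1 - u) * 1 by rewrite ler_wpM2l ?subr_ge0.
have : u * enorm q <= u * 1 by rewrite ler_wpM2l.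
lra.
Qed.

Lemma mulmx_sub_coord (u v : 'rV[R]_d) (A B : 'M[R]_d) i :
  (u *m A) 0 i - (v *m B) 0 i = ((u - v) *m A) 0 i + (v *m (A - B)) 0 i.
Proof.
rewrite mulmxBl mulmxBr.
have sub (U V : 'rV[R]_d) : (U - V) 0 i = U 0 i - V 0 i by rewrite !mxE.
rewrite !sub.
move: ((u *m A) 0 i) ((v *m A) 0 i) ((v *m B) 0 i) => r s t; ring.
Qed.

(* Mean value theorem along the two segments at once. *)
Lemma second_difference_le F G (B N e del : R) x y x' y' :
  0 <= del <= 1 -> 0 <= B -> 0 <= N -> 0 <= e ->
  (forall p, differentiable F p) -> (forall p, differentiable G p) ->
  (forall p, enorm p <= 1 -> enorm ('J F p) <= B) ->
  (forall p q, enorm p <= 1 -> enorm q <= 1 ->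
     enorm ('J F p - 'J G q) <= N * (e + enorm (p - q) `^ del)) ->
  enorm x <= 1 -> enorm y <= 1 -> enorm x' <= 1 -> enorm y' <= 1 ->
  enorm ((F x' - F y') - (G x - G y)) <= d%:R * (B + 2 * N) *
    (enorm ((x' - y') - (x - y)) +
     enorm (x - y) * (e + enorm (x' - x) `^ del + enorm (y' - y) `^ del)).
Proof.
move=> del01 B0 N0 e0 dF dG HB HN x1 y1 x'1 y'1; rewrite -mulrA; apply: enorm_le_coord => i.
pose phi u := F (y' + u *: (x' - y')) 0 i - G (y + u *: (x - y)) 0 i.
pose dphi u := ((x' - y') *m 'J F (y' + u *: (x' - y'))) 0 i
             - ((x - y) *m 'J G (y + u *: (x - y))) 0 i.
have dp (u : R) : is_derive u 1 phi (dphi u).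
  by apply: is_deriveB; apply: is_derive_line_coord.
have cp : {within `[0, 1], continuous phi}.
  apply: derivable_within_continuous => u _; exact: ex_derive.
have [c c01 Hc] := MVT ltr01 (fun u _ => dp u) cp.
have c01' : 0 <= c <= 1 by move: c01; rewrite in_itv /= => /andP[/ltW -> /ltW ->].
have -> : (F x' - F y' - (G x - G y)) 0 i = phi 1 - phi 0.
  rewrite /phi !scale1r !scale0r !addr0 ![y + _]addrC ![y' + _]addrC !subrK !mxE; ring.
rewrite Hc subr0 mulr1 /dphi.
(* One parameter [c] serves both segments, so that [p - q] is the convex combination of [x' - x] and
   [y' - y] with weights [c] and [1 - c]. *)
set p := y' + _; set q := y + _.
have p1 : enorm p <= 1 by apply: enorm_segment_le1.
have q1 : enorm q <= 1 by apply: enorm_segment_le1.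
have -> : ((x' - y') *m 'J F p) 0 i - ((x - y) *m 'J G q) 0 i =
  (((x' - y') - (x - y)) *m 'J F p) 0 i + ((x - y) *m ('J F p - 'J G q)) 0 i.
  exact: mulmx_sub_coord.
apply: (le_trans (ler_normD _ _)).
set Z := enorm (x - y); set DZ := enorm (x' - y' - (x - y)).
set ex := enorm (x' - x) `^ del; set ey := enorm (y' - y) `^ del.
have pq : enorm (p - q) `^ del <= 2 * (ex + ey).
  apply: (le_trans _ (powR_half_sum (enorm_ge0 _) (enorm_ge0 _) del01)).
  apply: le_powR_base; rewrite ?enorm_ge0 //; first by case/andP: del01.
  have -> : p - q = c *: (x' - x) + (1 - c) *: (y' - y).
    by rewrite /p /q; apply/rowP => j; rewrite !mxE; ring.
  apply: (le_trans (ler_enormD _ _)); rewrite !enormZ.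
  have /andP[c0 c1] := c01'.
  by rewrite !ger0_norm ?subr_ge0 // lerD // ler_piMl ?enorm_ge0 // lerBlDl lerDr.
have Z0 : 0 <= Z := enorm_ge0 _.
have DZ0 : 0 <= DZ := enorm_ge0 _.
have ex0 : 0 <= ex := powR_ge0 _ _.
have ey0 : 0 <= ey := powR_ge0 _ _.
have B1 : `|(((x' - y') - (x - y)) *m 'J F p) 0 i| <= DZ * B.
  by apply: (le_trans (norm_coord_mulmx_le _ _ _)); rewrite ler_wpM2l // HB.
have B2 : `|((x - y) *m ('J F p - 'J G q)) 0 i| <= Z * (N * (e + 2 * (ex + ey))).
  apply: (le_trans (norm_coord_mulmx_le _ _ _)); rewrite ler_wpM2l //.
  by apply: (le_trans (HN _ _ p1 q1)); rewrite ler_wpM2l // lerD2l.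
clearbody Z DZ ex ey.
have e1 : 0 <= DZ * N by apply: mulr_ge0.
have e2 : 0 <= Z * (B * (e + ex + ey)) by rewrite !mulr_ge0 // !addr_ge0.
have e3 : 0 <= Z * (N * e) by rewrite !mulr_ge0.
apply: (le_trans (lerD B1 B2)).
have -> : (B + 2 * N) * (DZ + Z * (e + ex + ey)) =
  (DZ * B + Z * (N * (e + 2 * (ex + ey)))) + (2 * (DZ * N) + Z * (B * (e + ex + ey)) + Z * (N * e)) by ring.
by rewrite lerDl !addr_ge0 // mulr_ge0.
Qed.

End SecondDifference.

(** * Measurability of the schemes in omega *)

Section Measurability.
Variables (R : realType) (disp : measure_display) (Omega : measurableType disp) (d : nat).
Implicit Types (X : Omega -> 'rV[R]_d).

(** Every preimage is a countable union of fibres of [W], whatever the function [phi]. A coefficient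
    can thus be evaluated at a discretized state with no measurable structure on row vectors. *)
Lemma measurable_fun_countable_factor (Z : countType) (W : Omega -> Z) (phi : Z -> R) :
  (forall z, measurable (W @^-1` [set z])) -> measurable_fun setT (phi \o W).
Proof.
move=> mW _ A mA; rewrite setTI.
have -> : (phi \o W) @^-1` A = \bigcup_z (if phi z \in A then W @^-1` [set z] else set0).
  apply/seteqP; split => [w /= Aw|w [z _]].
    by exists (W w) => //=; rewrite mem_set.
  by case: ifPn => // /set_mem Az /= ->.
apply: countable_bigcupT_measurable; first exact: countableP.
by move=> z; case: ifP.
Qed.

Lemma measurable_enorm X : (forall i, measurable_fun setT (fun w => X w 0 i)) ->
  measurable_fun setT (fun w => enorm (X w)).
Proof.
move=> mX.
have -> : (fun w => enorm (X w)) = (fun w => (\sum_(i < d) X w 0 i ^+ 2) `^ 2^-1).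
  apply/funext => w; rewrite powR12_sqrt; first by rewrite /enorm big_ord1.
  by apply: sumr_ge0 => i _; apply: sqr_ge0.
apply: (measurableT_comp (measurable_powR _)).
by apply: measurable_sum => i; apply: measurable_funX.
Qed.

Lemma measurable_ball_proj X i : (forall i, measurable_fun setT (fun w => X w 0 i)) ->
  measurable_fun setT (fun w => ball_proj (X w) 0 i).
Proof.
move=> mX.
have -> : (fun w => ball_proj (X w) 0 i) =
    (fun w => (Num.max 1 (enorm (X w))) `^ (-1) * X w 0 i).
  by apply/funext => w; rewrite mxE powR_inv1 // le_max ler01.
apply: measurable_funM => //; apply: (measurableT_comp (measurable_powR _)).
by apply: measurable_maxr => //; apply: measurable_enorm.
Qed.

(* X is approximated by its coordinatewise truncations to a dyadic grid, which
   take countably many values, pushed back into the ball. *)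
Lemma measurable_lipschitz_ball (F : 'rV[R]_d -> 'rV[R]_d) (M : R) X i : 0 <= M ->
  (forall x y, enorm x <= 1 -> enorm y <= 1 -> enorm (F x - F y) <= M * enorm (x - y)) ->
  (forall w, enorm (X w) <= 1) -> (forall i, measurable_fun setT (fun w => X w 0 i)) ->
  measurable_fun setT (fun w => F (X w) 0 i).
Proof.
move=> M0 FL X1 mX.
pose W n w : 'rV[int]_d := \row_j Num.floor (X w 0 j * 2 ^+ n).
pose phi n (z : 'rV[int]_d) : 'rV[R]_d := \row_j ((z 0 j)%:~R / 2 ^+ n).
pose h n w := F (ball_proj (phi n (W n w))) 0 i.
have hm n : measurable_fun setT (h n).
  apply: (@measurable_fun_countable_factor _ (W n) (fun z => F (ball_proj (phi n z)) 0 i)) => z.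
  have -> : W n @^-1` [set z] =
      \bigcap_(j in [set: 'I_d]) (fun w => X w 0 j * 2 ^+ n) @^-1` `[(z 0 j)%:~R, (z 0 j + 1)%:~R[%classic.
    apply/seteqP; split => [w /= <- j _|w /= H].
      by rewrite /= in_itv /= mxE ge_floor lt_succ_floor.
    apply/rowP => j; rewrite mxE; apply: floor_def.
    by have := H j Logic.I; rewrite /= in_itv.
  apply: fin_bigcap_measurable => [|j _]; first exact: finite_finset.
  have mf : measurable_fun setT (fun w => X w 0 j * 2 ^+ n) by apply: measurable_funM.
  by rewrite -[X in measurable X]setTI; apply: mf.
apply: (measurable_fun_cvg hm) => w _.
apply/cvgrPdist_le => e e0.
pose D := d%:R : R.
have D0 : 0 <= D by [].
have e'0 : 0 < e / (2 * M * D + 1) by rewrite divr_gt0 // ltr_wpDl // !mulr_ge0.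
have [n0 Hn] := dyadic_step_small e'0; exists n0 => // n /= nn.
set q := phi n (W n w).
have qX : enorm (q - X w) <= D * dyadic_step R n.
  apply: enorm_le_coord => j; rewrite !mxE.
  have p0 : 0 < 2 ^+ n :> R by rewrite exprn_gt0.
  have := ge_floor (X w 0 j * 2 ^+ n); have := lt_succ_floor (X w 0 j * 2 ^+ n).
  rewrite intrD; set z := (Num.floor _)%:~R => h1 h2.
  rewrite /dyadic_step exprVn ler_norml; apply/andP; split.
    by rewrite lerNl opprB lerBlDl -[X in _ + X]mul1r -mulrDl ler_pdivlMr // ltW.
  apply: (@le_trans _ _ 0); last by rewrite invr_ge0 ltW.
  by rewrite subr_le0 ler_pdivrMr.
(* Truncation may leave the ball, where [F] is controlled, but by no more than its own error;
   projecting back therefore at most doubles that error. *)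
have pq : enorm (ball_proj q - q) <= enorm (q - X w).
  apply: ball_proj_dist; first exact: enorm_ge0.
  by apply: (le_trans (ler_enorm_sub _ (X w))); rewrite lerD2r.
have hF : enorm (F (X w) - F (ball_proj q)) <= M * (2 * (D * dyadic_step R n)).
  apply: (le_trans (FL _ _ (X1 w) (enorm_ball_proj q))); rewrite ler_wpM2l // enorm_distC.
  rewrite -(subrK q (ball_proj q)) -addrA; apply: (le_trans (ler_enormD _ _)).
  lra.
have -> : F (X w) 0 i - h n w = (F (X w) - F (ball_proj q)) 0 i by rewrite /h !mxE.
apply: (le_trans (coord_le_enorm _ _ _)); apply: (le_trans hF).
have := Hn n nn; rewrite ler_pdivlMr; last by rewrite ltr_wpDl // !mulr_ge0.
have := dyadic_step_gt0 R n; nra.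
Qed.

Lemma measurable_euler (b sigma : R -> 'rV[R]_d -> 'rV[R]_d) (g : Omega -> R -> R)
    (M h : R) (x0 : 'rV[R]_d) k i : 0 <= h -> 0 <= M -> enorm x0 <= 1 ->
  (forall t x y, 0 <= t -> enorm x <= 1 -> enorm y <= 1 ->
     enorm (b t x - b t y) <= M * enorm (x - y)) ->
  (forall t x y, 0 <= t -> enorm x <= 1 -> enorm y <= 1 ->
     enorm (sigma t x - sigma t y) <= M * enorm (x - y)) ->
  (forall t, 0 <= t -> measurable_fun setT (g ^~ t)) ->
  measurable_fun setT (fun w => euler b sigma (g w) x0 h k 0 i).
Proof.
move=> h0 M0 x01 bL sL mg; elim: k i => [|k IH] i /=; first exact: measurable_cst.
have e1 w : enorm (euler b sigma (g w) x0 h k) <= 1.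
  by case: k {IH} => [|k] //=; apply: enorm_ball_proj.
apply: (measurable_ball_proj (X := fun w => _)) => j.
have kh0 : 0 <= k%:R * h by rewrite mulr_ge0.
have mb : measurable_fun setT (fun w => b (k%:R * h) (euler b sigma (g w) x0 h k) 0 j).
  by apply: (@measurable_lipschitz_ball (b (k%:R * h)) M) => // x y; apply: bL.
have ms : measurable_fun setT (fun w => sigma (k%:R * h) (euler b sigma (g w) x0 h k) 0 j).
  by apply: (@measurable_lipschitz_ball (sigma (k%:R * h)) M) => // x y; apply: sL.
rewrite (_ : (fun w => _) = (fun w => euler b sigma (g w) x0 h k 0 j +
  (h * b (k%:R * h) (euler b sigma (g w) x0 h k) 0 j +
   (g w (k.+1%:R * h) - g w (k%:R * h)) * sigma (k%:R * h) (euler b sigma (g w) x0 h k) 0 j))); last first.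
  by apply/funext => w; rewrite /euler_incr !mxE.
apply: measurable_funD; first exact: IH.
apply: measurable_funD; first by apply: measurable_funM.
apply: measurable_funM => //; apply: measurable_funB; apply: mg => //.
by rewrite mulr_ge0.
Qed.

End Measurability.

(** Let [y] be [x] minus its drift integral. Expanding that integral with the Hoelder continuity of
    the drift along [x] turns the hypothesis into a local estimate of the increments of [y] by
    [sigma] times those of [g]. The Riemann-Stieltjes integral then exists and equals the increment
    of [y]. *)
Lemma integral_equation_of_davie (R : realType) (d : nat)
    (b sigma : R -> 'rV[R]_d -> 'rV[R]_d) (g : R -> R) (x : R -> 'rV[R]_d)
    (t T tau K lam gam : R) :
  0 < tau <= 1 -> 0 <= K -> 0 < lam -> 0 < gam <= 1 -> 1 < lam + gam ->
  (forall u v, t <= u -> u <= v -> v <= T -> v <= u + tau ->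
    [/\ enorm (x v - x u - (v - u) *: b u (x u) - (g v - g u) *: sigma u (x u))
          <= K * (v - u) `^ (lam + gam),
        enorm (b v (x v) - b u (x u)) <= K * (v - u) `^ lam,
        enorm (sigma v (x v) - sigma u (x u)) <= K * (v - u) `^ lam &
        `|g v - g u| <= K * (v - u) `^ gam]) ->
  forall s, t <= s <= T -> integral_equation b sigma g t (x t) x s.
Proof.
move=> /andP[tau0 tau1] K0 lam0 /andP[gam0 gam1] lg H s /andP[ts sT].
(* One [K] for the remainder in the expansion of [x], another for that of the drift integral. *)
have K20 : 0 <= 2 * K by rewrite mulr_ge0.
have coordB (i : 'I_d) (p q : 'rV[R]_d) : p 0 i - q 0 i = (p - q) 0 i by rewrite !mxE.
pose f i r := b r (x r) 0 i.
pose V i v := \int[lebesgue_measure]_(r in `[t, v]) f i r.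
pose y i v := x v 0 i - V i v.
have cf i : {within `[t, s], continuous (f i)}.
  apply: (@within_continuous_holder _ _ _ _ tau K lam) => // u v tu uv vs vt.
  have [_ h _ _] := H u v tu uv (le_trans vs sT) vt.
  by apply: (le_trans _ h); rewrite /f coordB coord_le_enorm.
exists (\row_i (y i s - y i t)); split => [i|]; last first.
  by apply/rowP => i; rewrite !mxE /y /V Rintegral_point /f; ring.
rewrite mxE.
apply: (@RS_integral_of_local_estimate _ _ _ _ _ _ tau (2 * K) (lam + gam) lam gam) => //.
  by rewrite tau0.
move=> u v tu uv vs vt.
have [h1 _ h3 h4] := H u v tu uv (le_trans vs sT) vt.
have w0 : 0 <= v - u by rewrite subr_ge0.
have w1 : v - u <= 1 by rewrite lerBlDl (le_trans vt) // lerD2l.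
have dbl r : K * (v - u) `^ r <= 2 * K * (v - u) `^ r.
  by rewrite ler_wpM2r ?powR_ge0 // ler_peMl // ler1n.
split; last 2 first.
- by apply: (le_trans _ (dbl _)); apply: (le_trans _ h3); rewrite coordB coord_le_enorm.
- exact: (le_trans _ (dbl _)).
have hV : `|V i v - V i u - f i u * (v - u)| <= K * (v - u) `^ lam * (v - u).
  apply: (Rintegral_increment_le tu uv vs (cf i)) => r /andP[ur rv].
  have ru : r <= u + tau by apply: le_trans vt.
  have [_ h _ _] := H u r tu ur (le_trans (le_trans rv vs) sT) ru.
  rewrite /f coordB (le_trans (coord_le_enorm _ _ _)) // (le_trans h) // ler_wpM2l //.
  by apply: le_powR_base; rewrite ?subr_ge0 ?(ltW lam0) // lerD2r.
have hV' : K * (v - u) `^ lam * (v - u) <= K * (v - u) `^ (lam + gam).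
  rewrite -mulrA ler_wpM2l // powRD_gt0 // ler_wpM2l ?powR_ge0 //.
  have [->|wn0] := eqVneq (v - u) 0; first exact: powR_ge0.
  by apply: ger1_powR => //; rewrite lt0r wn0 w0.
set D := x v - _ - _ - _ in h1.
have hD := le_trans (coord_le_enorm D 0 i) h1.
have -> : y i v - y i u - sigma u (x u) 0 i * (g v - g u) =
   D 0 i - (V i v - V i u - f i u * (v - u)).
  by rewrite /D /y /f !mxE; ring.
apply: (le_trans (ler_normB _ _)).
have -> : 2 * K * (v - u) `^ (lam + gam) =
   K * (v - u) `^ (lam + gam) + K * (v - u) `^ (lam + gam) by ring.
by apply: lerD => //; apply: (le_trans hV).
Qed.

(** * Sufficiency on a single Hoelder path *)

Section Viability.
Variables (R : realType) (d : nat) (b sigma : R -> 'rV[R]_d -> 'rV[R]_d).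
Variables (T beta delta alpha mu L : R).
Hypotheses (T0 : 0 < T) (alpha0_gt : 0 < alpha) (alpha_lt : alpha < alpha0 beta delta).
Hypothesis sigma_H1 : assumption_H1 T beta delta sigma.
Hypothesis mu_bnd : 1 - alpha0 beta delta < mu <= 1.
Hypothesis L0 : 0 < L.
Hypothesis b_lip : forall s t : R, s \in `[0, T] -> t \in `[0, T] -> forall x y,
  enorm x <= 1 -> enorm y <= 1 ->
  enorm (b t x - b s y) <= L * (`|t - s| `^ mu + enorm (x - y)).
Hypothesis tangent : forall t : R, t \in `[0, T] -> forall x : 'rV[R]_d, enorm x = 1 ->
  dotp x (b t x) <= 0 /\ dotp x (sigma t x) = 0.

Definition path_exponent : R := Num.min (Num.min beta (delta * (1 - alpha))) mu.

(** The inequality [alpha < delta / (1 + delta)] amounts to [alpha < delta * (1 - alpha)]. In this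
    form the choice of [alpha0] makes [path_exponent + (1 - alpha)] exceed 1. *)
Lemma alpha_bounds : [/\ alpha < 2^-1, alpha < beta & alpha < delta * (1 - alpha)].
Proof.
have [_ /andP[d0 _] _ _ _] := sigma_H1.
move: alpha_lt; rewrite /alpha0 !lt_min => /and3P[-> -> h]; split => //.
move: h; rewrite ltr_pdivlMr; last by rewrite addr_gt0.
by rewrite mulrDr mulr1 mulrBr mulr1; lra.
Qed.

Lemma path_exponent_facts : [/\ 0 < path_exponent, path_exponent <= beta,
  path_exponent <= delta * (1 - alpha), path_exponent <= mu &
  1 < path_exponent + (1 - alpha)].
Proof.
have [a2 ab ad] := alpha_bounds.
have am : alpha < mu.
  have /andP[h _] := mu_bnd; apply: le_lt_trans h.
  have : alpha0 beta delta <= 2^-1 by rewrite /alpha0 ge_min lexx.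
  lra.
have h : alpha < path_exponent by rewrite /path_exponent !lt_min ab ad.
split; rewrite ?(lt_trans alpha0_gt) // /path_exponent ?ge_min ?lexx ?orbT //.
rewrite -/path_exponent; lra.
Qed.

(* Time is translated to start at 0 and frozen from T on. *)
Definition clamp (t0 u : R) : R := Num.min (t0 + u) T.

Lemma clamp_in t0 u : 0 <= t0 <= T -> 0 <= u -> clamp t0 u \in `[0, T].
Proof.
move=> /andP[t00 t0T] u0; rewrite in_itv /= /clamp le_min ge_min lexx orbT.
by rewrite addr_ge0 //= ltW.
Qed.

Lemma clamp_dist t0 s t : s <= t -> `|clamp t0 t - clamp t0 s| <= t - s.
Proof.
move=> st; rewrite /clamp; have w0 : 0 <= t - s by rewrite subr_ge0.
rewrite ler_norml; case: (leP (t0 + t) T) => h1; case: (leP (t0 + s) T) => h2;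
  apply/andP; split; lra.
Qed.

(** Bounds on the ball come from the value at time 0 and at the origin, plus the modulus of
    continuity over [[0, T]]; second differences come from the Hoelder gradient at radius 1.
    Clamping does not increase time lags, and lags of at most 1 allow every exponent to be lowered
    to [path_exponent]. [M] adds all the constants up. *)
Lemma young_data_clamp (g : R -> R) (G t0 : R) : 0 <= t0 <= T -> 0 <= G ->
  (forall s t, s \in `[0, T] -> t \in `[0, T] -> `|g t - g s| <= G * `|t - s| `^ (1 - alpha)) ->
  exists M, young_data (fun u => b (clamp t0 u)) (fun u => sigma (clamp t0 u))
    (g \o clamp t0) path_exponent (1 - alpha) delta M.
Proof.
move=> t0T G0 Hg.
have [/andP[be0 be1] /andP[de0 de1] sdiff [Ms Ms0 Hs] HJ] := sigma_H1.
have [MJ MJ0 HMJ] := HJ 1 ltr01.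
have [a2 ab ad] := alpha_bounds.
have [p0 pb pd pm p1] := path_exponent_facts.
have T00 : 0 \in `[0, T] by rewrite in_itv /= lexx ltW.
have e0 : enorm (0 : 'rV[R]_d) <= 1 by rewrite enorm0.
pose Bb := enorm (b 0 0) + L * (T `^ mu + 1).
pose Bs := enorm (sigma 0 0) + Ms * (T `^ beta + 1).
pose BJ := enorm ('J (sigma 0) 0) + MJ * (T `^ beta + 1).
have Bb0 : 0 <= Bb by rewrite addr_ge0 ?enorm_ge0 // mulr_ge0 ?(ltW L0) // addr_ge0 ?powR_ge0.
have Bs0 : 0 <= Bs by rewrite addr_ge0 ?enorm_ge0 // mulr_ge0 ?(ltW Ms0) // addr_ge0 ?powR_ge0.
have BJ0 : 0 <= BJ by rewrite addr_ge0 ?enorm_ge0 // mulr_ge0 ?(ltW MJ0) // addr_ge0 ?powR_ge0.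
pose Q := d%:R * (BJ + 2 * MJ).
have Q0 : 0 <= Q by rewrite mulr_ge0 // addr_ge0 // mulr_ge0 // ltW.
pose M := 1 + G + L + Ms + Bb + Bs + Q.
have MJ0' := ltW MJ0; have Ms0' := ltW Ms0; have L0' := ltW L0.
have pos r s : 0 <= r -> 0 <= s -> s <= T -> s `^ r <= T `^ r.
  by move=> r0 s0 sT; apply: le_powR_base.
have pw s t r : s <= t -> t <= s + 1 -> path_exponent <= r ->
    `|clamp t0 t - clamp t0 s| `^ r <= (t - s) `^ path_exponent.
  move=> st ts pr; have h := clamp_dist t0 st.
  have w0 : 0 <= t - s by rewrite subr_ge0.
  apply: (@le_trans _ _ ((t - s) `^ r)).
    by apply: le_powR_base => //; apply: (le_trans (ltW p0)).
  by apply: ge_powR_exponent => //; rewrite w0 lerBlDl.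
have inT t : 0 <= t -> clamp t0 t \in `[0, T] by move=> ?; apply: clamp_in.
have bnd t (r : R) : 0 <= t -> 0 <= r -> `|clamp t0 t - 0| `^ r <= T `^ r.
  move=> t00 r0; have := inT _ t00; rewrite in_itv /= => /andP[c0 cT].
  by rewrite subr0 ger0_norm // pos.
exists M; split => //.
- by apply/andP; split; rewrite ?lerBlDl ?lerDr ?(ltW alpha0_gt) //; lra.
- rewrite p0 /= (le_trans pd) // ler_piMl //; lra.
- by rewrite de0.
- rewrite /M; lra.
- move=> s t s0 st; apply: (le_trans (Hg _ _ (inT _ s0) (inT _ (le_trans s0 st)))).
  apply: ler_pM; rewrite ?powR_ge0 //; first by rewrite /M; lra.
  apply: le_powR_base => //; first lra.
  exact: clamp_dist.
- move=> t x t00 x1; apply: (le_trans (ler_enorm_sub _ (b 0 0))).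
  apply: (@le_trans _ _ Bb); last by rewrite /M; lra.
  rewrite lerD2l (le_trans (b_lip T00 (inT _ t00) x1 e0)) // ler_wpM2l //.
  by rewrite [x - 0]subr0 lerD // bnd // (le_trans (ltW p0)).
- move=> t x t00 x1; apply: (le_trans (ler_enorm_sub _ (sigma 0 0))).
  apply: (@le_trans _ _ Bs); last by rewrite /M; lra.
  rewrite lerD2l (le_trans (Hs 0 _ T00 (inT _ t00) x 0)) // ler_wpM2l //.
  by rewrite [x - 0]subr0 lerD // bnd // ltW.
- move=> s t x y s0 st ts x1 y1.
  apply: (le_trans (b_lip (inT _ s0) (inT _ (le_trans s0 st)) x1 y1)).
  apply: ler_pM; rewrite ?addr_ge0 ?powR_ge0 ?enorm_ge0 //; first by rewrite /M; lra.
  by rewrite lerD2r; apply: pw.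
- move=> s t x y s0 st ts x1 y1.
  apply: (le_trans (Hs _ _ (inT _ s0) (inT _ (le_trans s0 st)) x y)).
  apply: ler_pM; rewrite ?addr_ge0 ?powR_ge0 ?enorm_ge0 //; first by rewrite /M; lra.
  by rewrite lerD2r; apply: pw.
- move=> s t x y x' y' s0 st ts x1 y1 x'1 y'1.
  have t00 := le_trans s0 st.
  have BJle p : enorm p <= 1 -> enorm ('J (sigma (clamp t0 t)) p) <= BJ.
    move=> q1; apply: (le_trans (ler_enorm_sub _ ('J (sigma 0) 0))).
    rewrite lerD2l (le_trans (HMJ 0 _ T00 (inT _ t00) p 0 q1 e0)) // ler_wpM2l //.
    rewrite [p - 0]subr0 lerD //; first by rewrite bnd // ltW.
    by apply: powR_le1; rewrite ?enorm_ge0 ?q1 // ltW.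
  have de01 : 0 <= delta <= 1 by rewrite ltW.
  have := @second_difference_le R d (sigma (clamp t0 t)) (sigma (clamp t0 s)) BJ MJ
    (`|clamp t0 t - clamp t0 s| `^ beta) delta x y x' y' de01 BJ0 MJ0' (powR_ge0 _ _)
    (sdiff _ (inT _ t00)) (sdiff _ (inT _ s0)) BJle
    (fun p q p1 q1 => HMJ _ _ (inT _ s0) (inT _ t00) p q p1 q1) x1 y1 x'1 y'1.
  move=> H; apply: (le_trans H).
  apply: ler_pM => //.
  + by rewrite addr_ge0 ?enorm_ge0 // mulr_ge0 ?enorm_ge0 // !addr_ge0 ?powR_ge0.
  + by rewrite -/Q /M lerDr; do 5![apply: addr_ge0 => //].
  + by rewrite lerD2l ler_wpM2l ?enorm_ge0 // !lerD2r pw.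
- by move=> t x t00 x1; case: (tangent (inT _ t00) x1).
- by move=> t x t00 x1; case: (tangent (inT _ t00) x1).
Qed.

Definition path_solution (g : R -> R) (t0 : R) (x0 : 'rV[R]_d) (s : R) : 'rV[R]_d :=
  euler_limit (fun u => b (clamp t0 u)) (fun u => sigma (clamp t0 u)) (g \o clamp t0) x0 (s - t0).

Lemma path_solution_correct (g : R -> R) (G t0 : R) (x0 : 'rV[R]_d) :
  0 <= t0 <= T -> 0 <= G -> enorm x0 <= 1 ->
  (forall s t, s \in `[0, T] -> t \in `[0, T] -> `|g t - g s| <= G * `|t - s| `^ (1 - alpha)) ->
  [/\ holder_on t0 T (1 - alpha) (path_solution g t0 x0),
      forall s, s \in `[t0, T] ->
        integral_equation b sigma g t0 x0 (path_solution g t0 x0) s &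
      forall s, s \in `[t0, T] -> enorm (path_solution g t0 x0 s) <= 1].
Proof.
move=> t0T G0 x01 Hg; have [M YD] := young_data_clamp t0T G0 Hg.
set X := path_solution g t0 x0.
have [p0 pb pd pm p1] := path_exponent_facts.
have [a2 ab ad] := alpha_bounds.
have /andP[t00 t0leT] := t0T.
have [t1 /andP[t10 t11] [K K0 HK]] := euler_limit_davie YD x01.
have [t2 /andP[t20 t21] [C C0 HC]] := euler_limit_holder YD x01.
have pg : path_exponent <= 1 - alpha by case/andP: (young_lam YD).
have g0 : 0 < 1 - alpha by apply: (lt_le_trans p0).
have g1 : 1 - alpha <= 1 by rewrite gerBl ltW.
have X1 s : t0 <= s -> enorm (X s) <= 1.
  by move=> ts; apply: (enorm_euler_limit YD x01); rewrite subr_ge0.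
have clE s : s <= T -> clamp t0 (s - t0) = s.
  by move=> sT; rewrite /clamp addrC subrK; apply/min_idPl.
have XC u v : t0 <= u -> u <= v -> v <= u + t2 -> enorm (X v - X u) <= C * (v - u) `^ (1 - alpha).
  move=> tu uv vt; have := HC (u - t0) (v - t0); rewrite opprD opprK addrACA (addrC (- t0)) subrr addr0.
  by apply; rewrite ?subr_ge0 // ?lerD2r // addrAC lerD2r.
have C20 : 0 <= C + 2 / t2 `^ (1 - alpha).
  by rewrite addr_ge0 // divr_ge0 // powR_ge0.
split.
(* The Hoelder estimate of the limit covers distances up to [t2]. Beyond, two points of the ball are
   at distance at most 2, and [t2 ^ (1 - alpha) <= (s - r) ^ (1 - alpha)]. *)
- exists (C + 2 / t2 `^ (1 - alpha)).
  have Hle r s : t0 <= r -> r <= s -> enorm (X s - X r) <= (C + 2 / t2 `^ (1 - alpha)) * (s - r) `^ (1 - alpha).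
    move=> tr rs; have [h|h] := leP s (r + t2).
      apply: (le_trans (XC _ _ tr rs h)); rewrite ler_wpM2r ?powR_ge0 //.
      by rewrite lerDl divr_ge0 // powR_ge0.
    apply: (@le_trans _ _ 2).
      apply: (le_trans (ler_enormB _ _)).
      by have := X1 _ tr; have := X1 _ (le_trans tr rs); lra.
    rewrite mulrDl -[leLHS]add0r; apply: lerD; first by rewrite mulr_ge0 // powR_ge0.
    rewrite mulrAC ler_pdivlMr ?powR_gt0 // ler_wpM2l //.
    by apply: le_powR_base; [exact: ltW | exact: ltW | rewrite lerBrDl ltW].
  move=> r s; rewrite !in_itv /= => /andP[tr _] /andP[ts _].
  case: (leP r s) => [rs|/ltW sr].
    by rewrite ger0_norm ?subr_ge0 //; apply: Hle.
  by rewrite enorm_distC distrC ger0_norm ?subr_ge0 //; apply: Hle.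
- move=> s; rewrite in_itv /= => sT.
  have <- : X t0 = x0 by rewrite /X /path_solution subrr (euler_limit0 _ _ _ _).
  pose tau := Num.min t1 t2.
  have tau1 : tau <= t1 by rewrite ge_min lexx.
  have tau2 : tau <= t2 by rewrite ge_min lexx orbT.
  have M1 := young_M YD; have M0 : 0 <= M by apply: le_trans M1.
  have tau0 : 0 < tau <= 1 by rewrite lt_min t10 t20 (le_trans tau1).
  have g01 : 0 < 1 - alpha <= 1 by rewrite g0.
  apply: (@integral_equation_of_davie _ _ _ _ _ _ _ T tau (K + M * (1 + C)) path_exponent (1 - alpha)) => //.
    by rewrite addr_ge0 // mulr_ge0 // addr_ge0.
  move=> u v tu uv vT vtau.
  have uT := le_trans uv vT; have tv := le_trans tu uv.
  have u0 : 0 <= u - t0 by rewrite subr_ge0.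
  have uv' : u - t0 <= v - t0 by rewrite lerD2r.
  have vuE : v - t0 - (u - t0) = v - u by rewrite opprD opprK addrACA (addrC (- t0)) subrr addr0.
  have v1 : v <= u + 1 by apply: (le_trans vtau); rewrite lerD2l (le_trans tau1).
  have vu1 : v - t0 <= u - t0 + 1 by rewrite addrAC lerD2r.
  have w0 : 0 <= v - u by rewrite subr_ge0.
  have w01 : 0 <= v - u <= 1 by rewrite w0 lerBlDl.
  have HX : enorm (X v - X u) <= C * (v - u) `^ path_exponent.
    apply: (le_trans (XC _ _ tu uv _)); first by apply: (le_trans vtau); rewrite lerD2l.
    by rewrite ler_wpM2l // ge_powR_exponent.
  have HX' : M * ((v - u) `^ path_exponent + enorm (X v - X u)) <=
      (K + M * (1 + C)) * (v - u) `^ path_exponent.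
    apply: (@le_trans _ _ (M * (1 + C) * (v - u) `^ path_exponent)); last first.
      by rewrite ler_wpM2r ?powR_ge0 // lerDr.
    by rewrite -mulrA ler_wpM2l // mulrDl mul1r lerD2l.
  split.
  + have := HK (u - t0) (v - t0) u0 uv'; rewrite vuE /= !clE // => H.
    apply: (le_trans (H _)); first by rewrite addrAC lerD2r (le_trans vtau) // lerD2l.
    by rewrite ler_wpM2r ?powR_ge0 // lerDl mulr_ge0 // addr_ge0.
  + have := young_b YD u0 uv' vu1 (X1 _ tv) (X1 _ tu); rewrite !clE // vuE => H.
    exact: (le_trans H).
  + have := young_sigma YD u0 uv' vu1 (X1 _ tv) (X1 _ tu); rewrite !clE // vuE => H.
    exact: (le_trans H).
  + have := young_g YD u0 uv'; rewrite /= !clE // vuE => H.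
    apply: (le_trans H); rewrite ler_wpM2r ?powR_ge0 //.
    apply: (@le_trans _ _ (M * (1 + C))); last by rewrite lerDr.
    by rewrite ler_peMr // lerDl.
- by move=> s; rewrite in_itv /= => /andP[ts _]; apply: X1.
Qed.

(** A pointwise limit of measurable schemes. The Hoelder bound is asked for at every [w] so that
    convergence holds everywhere, at a rate depending on [w] through [G w]. *)
Lemma measurable_path_solution (disp : measure_display) (Omega : measurableType disp)
    (g : Omega -> R -> R) (G : Omega -> R) (t0 s : R) (x0 : 'rV[R]_d) i :
  0 <= t0 <= T -> enorm x0 <= 1 -> t0 <= s -> (forall w, 0 <= G w) ->
  (forall w s t, s \in `[0, T] -> t \in `[0, T] ->
     `|g w t - g w s| <= G w * `|t - s| `^ (1 - alpha)) ->
  (forall t, t \in `[0, T] -> measurable_fun setT (g ^~ t)) ->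
  measurable_fun setT (fun w => path_solution (g w) t0 x0 s 0 i).
Proof.
move=> t0T x01 ts G0 Hg mg.
have [_ _ _ [Ms Ms0 Hs] _] := sigma_H1.
have s0 : 0 <= s - t0 by rewrite subr_ge0.
pose h n w := euler_path (fun u => b (clamp t0 u)) (fun u => sigma (clamp t0 u))
  (g w \o clamp t0) x0 n (s - t0) 0 i.
apply: (@measurable_fun_cvg _ _ _ _ h) => [n|w _]; last first.
  have [M YD] := young_data_clamp t0T (G0 w) (Hg w).
  exact: (euler_path_cvg YD x01).
have mu0 : mu != 0.
  have [p0 _ _ pm _] := path_exponent_facts.
  by rewrite gt_eqF // (lt_le_trans p0).
have be0 : beta != 0 by have [/andP[be0 _] _ _ _ _] := sigma_H1; rewrite gt_eqF.
apply: (@measurable_euler _ _ _ _ _ _ (fun w => g w \o clamp t0) (L + Ms)) => //.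
- exact: ltW (dyadic_step_gt0 _ _).
- by rewrite addr_ge0 // ltW.
- move=> t x y tt x1 y1; have ct := clamp_in t0T tt.
  apply: (le_trans (b_lip ct ct x1 y1)); rewrite subrr normr0 powR0 // add0r.
  by rewrite ler_wpM2r ?enorm_ge0 // lerDl ltW.
- move=> t x y tt x1 y1; have ct := clamp_in t0T tt.
  apply: (le_trans (Hs _ _ ct ct x y)); rewrite subrr normr0 powR0 // add0r.
  by rewrite ler_wpM2r ?enorm_ge0 // lerDr ltW.
- by move=> t tt; apply: mg; apply: clamp_in.
Qed.

End Viability.

(** * Young's estimate of an integral by its left-point term *)

Section YoungLocalEstimate.
Variables (R : realType) (f g : R -> R).

Definition uniform_sum (a h : R) (N : nat) : R :=
  \sum_(0 <= k < N) f (a + k%:R * h) * (g (a + k.+1%:R * h) - g (a + k%:R * h)).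

Lemma RS_integral_uniform_sum (a c I : R) : a < c -> is_RS_integral f g a c I ->
  uniform_sum a ((c - a) / 2 ^+ n) (2 ^ n) @[n --> \oo] --> I.
Proof.
move=> ac HI; apply/cvgrPdist_lt => e e0.
have [eta eta0 Heta] := HI e e0.
have w0 : 0 < c - a by rewrite subr_gt0.
(* Dividing by twice the length gives [h <= eta / 2], hence the strict [h < eta] required of the
   mesh. *)
have [n0 Hn] := dyadic_step_small (divr_gt0 eta0 (addr_gt0 w0 w0)).
exists n0 => // n /= nn; set h := (c - a) / 2 ^+ n.
have h0 : 0 < h by rewrite divr_gt0 // exprn_gt0.
have hN : (2 ^ n)%:R * h = c - a.
  by rewrite natrX mulrC divfK // gt_eqF // exprn_gt0.
pose l := mkseq (fun k => a + k.+1%:R * h) (2 ^ n).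
have sl : size l = (2 ^ n)%N by rewrite size_mkseq.
have nl k : (k <= 2 ^ n)%N -> nth c (a :: l) k = a + k%:R * h.
  by case: k => [|k] kN /=; [rewrite mul0r addr0 | rewrite nth_mkseq].
have part : itv_partition a c l.
  split; last by rewrite (last_nth c) sl nl // hN addrC subrK.
  apply/(pathP c) => k; rewrite sl => kN.
  by rewrite nl ?(ltnW kN) // nth_mkseq // ltrD2l ltr_pM2r // ltr_nat.
have hlt : h < eta.
  have hE : h = dyadic_step R n * (c - a) by rewrite /h /dyadic_step exprVn mulrC.
  have hd : dyadic_step R n * (c - a + (c - a)) <= eta.
    rewrite -ler_pdivlMr; [exact: Hn | exact: addr_gt0].
  by rewrite mulrDr -hE in hd; lra.
have -> : uniform_sum a h (2 ^ n) = RS_sum f g a c l (fun k => a + k%:R * h).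
  rewrite /RS_sum sl; apply: eq_big_nat => k /andP[_ kN].
  by rewrite !nl // ltnW.
rewrite distrC; apply: Heta.
  split => // p k; rewrite sl /p => kN; rewrite !nl ?(ltnW kN) // lexx /=.
  by rewrite lerD2l ler_wpM2r ?(ltW h0) // ler_nat.
move=> k; rewrite sl => kN; rewrite !nl ?(ltnW kN) //.
by apply: le_lt_trans hlt; rewrite -natr1 mulrDl mul1r; lra.
Qed.

Lemma uniform_sum_refine (a h : R) (N : nat) :
  uniform_sum a (h / 2) (2 * N) - uniform_sum a h N =
  \sum_(0 <= k < N) (f (a + k%:R * h + h / 2) - f (a + k%:R * h)) *
    (g (a + k.+1%:R * h) - g (a + k%:R * h + h / 2)).
Proof.
rewrite /uniform_sum; elim: N => [|N IH]; first by rewrite muln0 !big_geq // subrr.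
rewrite mulnS [LHS]addrC !big_nat_recr //= -IH.
have -> : (2 * N).+2%:R * (h / 2) = N.+1%:R * h by rewrite -addn2 natrD natrM -natr1; field.
have -> : (2 * N).+1%:R * (h / 2) = N%:R * h + h / 2 by rewrite -natr1 natrM; field.
have -> : (2 * N)%:R * (h / 2) = N%:R * h by rewrite natrM; field.
rewrite !addrA; ring.
Qed.

(** The left-point sum over the single interval is [f a * (g c - g a)]. Halving [2 ^ n] intervals of
    length [h] changes the sum by at most [2 ^ n * K ^+ 2 * h ^ th], a geometric sequence of ratio
    [2 ^ (1 - th)], and the sums tend to the integral. *)
Lemma young_local_estimate (a c K lam gam I : R) : a < c -> 0 <= K -> 0 < lam -> 0 < gam ->
  1 < lam + gam ->
  (forall u v, a <= u -> u <= v -> v <= c -> `|f v - f u| <= K * (v - u) `^ lam) ->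
  (forall u v, a <= u -> u <= v -> v <= c -> `|g v - g u| <= K * (v - u) `^ gam) ->
  is_RS_integral f g a c I ->
  `|I - f a * (g c - g a)| <= K ^+ 2 / (1 - 2 `^ (1 - (lam + gam))) * (c - a) `^ (lam + gam).
Proof.
move=> ac K0 lam0 gam0 th1 Hf Hg HI; set th := lam + gam in th1 *.
pose u n := uniform_sum a ((c - a) / 2 ^+ n) (2 ^ n).
pose r : R := 2 `^ (1 - th).
have w0 : 0 <= c - a by rewrite subr_ge0 ltW.
have r01 : 0 <= r < 1.
  rewrite powR_ge0 /= /r -[1 - th]opprB powRN invf_lt1 ?powR_gt0 //.
  have : 1 `^ (th - 1) < (2 : R) `^ (th - 1).
    by apply: gt0_ltr_powR; rewrite ?nnegrE ?subr_gt0 // ltr1n.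
  by rewrite powR1.
have Hu n : `|u n.+1 - u n| <= K ^+ 2 * (c - a) `^ th * r ^+ n.
  set h := (c - a) / 2 ^+ n.
  have h0 : 0 <= h by rewrite divr_ge0 // exprn_ge0.
  have hN : (2 ^ n)%:R * h = c - a.
    by rewrite natrX mulrC divfK // gt_eqF // exprn_gt0.
  have -> : u n.+1 = uniform_sum a (h / 2) (2 * 2 ^ n).
    by rewrite /u expnS exprSr /h; congr uniform_sum; rewrite invfM mulrA.
  rewrite uniform_sum_refine; apply: (le_trans (ler_norm_sum _ _ _)).
  apply: (@le_trans _ _ (\sum_(0 <= k < 2 ^ n) K ^+ 2 * h `^ th)).
    rewrite big_nat_cond [leRHS]big_nat_cond; apply: ler_sum => k /andP[/andP[_ kN] _].
    have kh0 : 0 <= k%:R * h by rewrite mulr_ge0.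
    have k1 : k.+1%:R * h <= c - a by rewrite -hN ler_wpM2r // ler_nat.
    have kS : k.+1%:R * h = k%:R * h + h by rewrite -natr1 mulrDl mul1r.
    rewrite normrM expr2.
    have -> : K * K * h `^ th = K * h `^ lam * (K * h `^ gam) by rewrite /th powRD_gt0 //; ring.
    apply: ler_pM => //.
      apply: (le_trans (Hf _ _ _ _ _)); [lra|lra|lra|].
      by rewrite ler_wpM2l //; apply: le_powR_base; [exact: ltW|lra|lra].
    apply: (le_trans (Hg _ _ _ _ _)); [lra|lra|lra|].
    by rewrite ler_wpM2l //; apply: le_powR_base; [exact: ltW|lra|lra].
  rewrite sumr_const_nat subn0 -[leLHS]mulr_natl natrX.
  have -> : h `^ th = (c - a) `^ th / (2 `^ th) ^+ n.
    rewrite /h powRM ?invr_ge0 ?exprn_ge0 //; congr (_ * _).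
    by rewrite -powR_inv1 ?exprn_ge0 // powRAC powR_inv1 ?powR_ge0 // -powR_mulrn // powRAC powR_mulrn ?powR_ge0.
  have -> : r ^+ n = 2 ^+ n / (2 `^ th) ^+ n.
    rewrite /r powRB ?powRr1 ?expr_div_n //.
    by apply/implyP => _; rewrite pnatr_eq0.
  by rewrite le_eqVlt; apply/orP; left; apply/eqP; ring.
have C0 : 0 <= K ^+ 2 * (c - a) `^ th by rewrite mulr_ge0 ?sqr_ge0 ?powR_ge0.
have [_ H] := @geometric_cauchy_cvg _ u _ r 0%N C0 r01 (fun n _ => Hu n).
have := H 0%N (leqnn _).
have -> : limn u = I by apply: (cvg_lim (@norm_hausdorff _ _) (RS_integral_uniform_sum ac HI)).
have -> : u 0%N = f a * (g c - g a).
  rewrite /u /uniform_sum expn0 big_nat1 expr0 divr1 mul0r addr0 mul1r.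
  by have -> : a + (c - a) = c by rewrite addrC subrK.
by rewrite expr0 mulr1 [X in _ <= X]mulrAC.
Qed.

End YoungLocalEstimate.

Lemma lebesgue_measure_segment (R : realType) (a b : R) : a <= b ->
  lebesgue_measure [set` `[a, b]] = (b - a)%:E.
Proof.
move=> ab; rewrite lebesgue_measure_itv /= lte_fin.
by case: ltgtP ab => // -> _; rewrite subrr.
Qed.

(** * Normal laws and Gaussian variables *)

Section NormalLaw.
Variables (R : realType) (m s : R).
Hypothesis s0 : s != 0.

Let s20 : 0 < s ^+ 2. Proof. by rewrite exprn_even_gt0. Qed.

Lemma normal_pdf_formula x :
  normal_pdf m s x = normal_peak s * expR (- (x - m) ^+ 2 / (s ^+ 2 *+ 2)).
Proof. by rewrite /normal_pdf (negbTE s0). Qed.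

Lemma normal_peak_double : normal_peak s = 2 * normal_peak (2 * s).
Proof.
rewrite /normal_peak.
have -> : (2 * s) ^+ 2 * pi *+ 2 = 2 ^+ 2 * (s ^+ 2 * pi *+ 2) by ring.
rewrite sqrtrM ?exprn_ge0 //.
by rewrite sqrtr_sqr ger0_norm // invfM mulrA divff // mul1r.
Qed.

Lemma normal_peak_le : normal_peak s <= `|s|^-1.
Proof.
rewrite /normal_peak lef_pV2 ?posrE ?normr_gt0 ?sqrtr_gt0 //; last first.
  by rewrite mulrn_wgt0 // mulr_gt0 ?pi_gt0.
rewrite -[leLHS]sqrtr_sqr ler_sqrt ?normr_id ?real_normK ?num_real //; last first.
  by rewrite mulrn_wge0 // mulr_ge0 ?pi_ge0 // ltW.
have := pi_ge2 R; have := s20; rewrite mulr2n; nra.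
Qed.

(* The density is compared with that of twice the standard deviation, which
   still integrates to 1. *)
Lemma normal_prob_tail (lam : R) : 0 <= lam ->
  (normal_prob m s [set x | lam <= `|x - m|]%R <=
   (2 * expR (- (lam ^+ 2 / (4 * s ^+ 2))))%:E)%E.
Proof.
move=> lam0; set C := 2 * expR _; have C0 : 0 <= C by rewrite mulr_ge0 ?expR_ge0.
have mA : measurable [set x | lam <= `|x - m|]%R.
  rewrite -[X in measurable X]setTI; apply: measurable_fun_ler => //.
  by apply: measurableT_comp => //; apply: measurable_funB.
have mp u : measurable_fun setT (fun x => (normal_pdf m u x)%:E).
  by apply/measurable_EFinP; apply: measurable_normal_pdf.
rewrite /normal_prob.
apply: (@le_trans _ _ (\int[lebesgue_measure]_(x in [set x | lam <= `|x - m|]%R)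
   (C%:E * (normal_pdf m (2 * s) x)%:E))%E).
  apply: ge0_le_integral => //.
  - by move=> x _; rewrite lee_fin normal_pdf_ge0.
  - by apply: measurable_funTS; apply: mp.
  - by apply: measurable_funTS; apply: emeasurable_funM; [exact: measurable_cst | exact: mp].
  move=> x /= lx; rewrite -EFinM lee_fin normal_pdf_formula /normal_pdf.
  rewrite mulf_eq0 pnatr_eq0 /= (negbTE s0) /normal_fun normal_peak_double /C.
  set p := normal_peak _; have p0 : 0 <= p := normal_peak_ge0 _.
  rewrite [leRHS](_ : _ = 2 * p * (expR (- (lam ^+ 2 / (4 * s ^+ 2))) *
    expR (- (x - m) ^+ 2 / ((2 * s) ^+ 2 *+ 2)))); last by ring.
  rewrite ler_wpM2l ?mulr_ge0 // -expRD ler_expR.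
  have lx2 : lam ^+ 2 <= (x - m) ^+ 2.
    by rewrite -[leRHS]real_normK ?num_real // ler_pXn2r // nnegrE.
  have : lam ^+ 2 / (4 * s ^+ 2) <= (x - m) ^+ 2 / (4 * s ^+ 2).
    by rewrite ler_wpM2r // invr_ge0 mulr_ge0 // ltW.
  set z := (x - m) ^+ 2; have z0 : 0 <= z := sqr_ge0 _.
  have -> : - z / (s ^+ 2 *+ 2) = - (z / (4 * s ^+ 2) + z / (4 * s ^+ 2)) by field.
  have -> : - z / ((2 * s) ^+ 2 *+ 2) = - (z / (4 * s ^+ 2) / 2) by field.
  have : 0 <= z / (4 * s ^+ 2) by rewrite divr_ge0 // mulr_ge0 // ltW.
  lra.
rewrite ge0_integralZl_EFin //; last by apply: measurable_funTS; apply: mp.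
rewrite -[leRHS]mule1; apply: lee_wpmul2l => //.
rewrite -(integral_normal_pdf m (2 * s)); apply: ge0_subset_integral => //; first exact: mp.
  by move=> x _; rewrite lee_fin normal_pdf_ge0.
by move=> x _; rewrite lee_fin normal_pdf_ge0.
Qed.

Lemma normal_prob_itv_le (a b : R) : a <= b ->
  (normal_prob m s `[a, b] <= ((b - a) / `|s|)%:E)%E.
Proof.
move=> ab; rewrite /normal_prob.
apply: (@le_trans _ _ (\int[lebesgue_measure]_(x in `[a, b]) (`|s|^-1)%:E)%E).
  apply: ge0_le_integral => //.
  - by move=> x _; rewrite lee_fin normal_pdf_ge0.
  - by apply: measurable_funTS; apply/measurable_EFinP; apply: measurable_normal_pdf.
  - by move=> x _; rewrite lee_fin (le_trans (normal_pdf_ub _ _ s0)) // normal_peak_le.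
rewrite integral_cst // [X in (_ * X)%E](lebesgue_measure_segment ab).
by rewrite -EFinM mulrC.
Qed.

Lemma normal_prob_itv_ge (a b r : R) : a <= b -> (forall x, a <= x <= b -> `|x - m| <= r) ->
  (((b - a) * (normal_peak s * expR (- (r ^+ 2 / (2 * s ^+ 2)))))%:E <= normal_prob m s `[a, b])%E.
Proof.
move=> ab Hr; rewrite /normal_prob; set c := normal_peak s * _.
have c0 : 0 <= c by rewrite mulr_ge0 ?expR_ge0 ?normal_peak_ge0.
apply: (@le_trans _ _ (\int[lebesgue_measure]_(x in `[a, b]) c%:E)%E).
  rewrite integral_cst // [X in (_ * X)%E](lebesgue_measure_segment ab).
  by rewrite -EFinM mulrC.
apply: ge0_le_integral => //.
- by apply: measurable_funTS; apply/measurable_EFinP; apply: measurable_normal_pdf.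
move=> x /=; rewrite in_itv /= => xab; rewrite lee_fin normal_pdf_formula ler_wpM2l ?normal_peak_ge0 //.
rewrite ler_expR mulNr lerN2 mulr_natl; apply: ler_wpM2r.
  by rewrite invr_ge0 mulrn_wge0 // ltW.
rewrite -[leLHS]real_normK ?num_real // ler_pXn2r ?nnegrE //; first exact: Hr.
exact: le_trans (normr_ge0 _) (Hr x xab).
Qed.

End NormalLaw.

Section GaussianVariables.
Variables (R : realType) (disp : measure_display) (Omega : measurableType disp).
Variable P : probability Omega R.

Lemma Lfun2_of_sqr_integral (f : Omega -> R) : measurable_fun setT f ->
  (\int[P]_w ((f w) ^+ 2)%:E < +oo)%E -> f \in Lfun P 2%:E.
Proof.
move=> mf fi; rewrite inE; apply/andP; split; first by rewrite inE.
rewrite inE /= /finite_norm unlock poweR_lty //.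
apply: le_lt_trans fi; rewrite le_eqVlt; apply/orP; left; apply/eqP.
apply: eq_integral => w _ /=.
by rewrite powR_mulrn // real_normK ?num_real.
Qed.

Lemma exponential_tail_integral_le (c : R) : 0 < c ->
  (\int[lebesgue_measure]_(r in `[0%R, +oo[) (2 * expR (- (r / c)))%:E <= (2 * c)%:E)%E.
Proof.
move=> c0; have ci0 : 0 < c^-1 by rewrite invr_gt0.
have me : measurable_fun setT (fun x => (exponential_pdf c^-1 x)%:E).
  by apply/measurable_EFinP; apply: measurable_exponential_pdf.
rewrite [leLHS](_ : _ = \int[lebesgue_measure]_(r in `[0%R, +oo[)
    ((2 * c)%:E * (exponential_pdf c^-1 r)%:E)%E)%E; last first.
  apply: eq_integral => r; rewrite inE /= in_itv /= andbT => r0.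
  rewrite exponential_pdfE // -EFinM -!mulrA; congr (_ * _)%:E.
  by rewrite mulrA divff ?gt_eqF // mul1r mulNr mulrC.
rewrite ge0_integralZl_EFin //.
- rewrite -[leRHS]mule1; apply: lee_wpmul2l; first by rewrite lee_fin mulr_ge0 // ltW.
  rewrite -(integral_exponential_pdf ci0); apply: ge0_subset_integral => //.
  by move=> x _; rewrite lee_fin exponential_pdf_ge0 // ltW.
- by move=> x _; rewrite lee_fin exponential_pdf_ge0 // ltW.
- exact: measurable_funTS.
- by rewrite mulr_ge0 // ltW.
Qed.

(** The parameters of the law are compared with the variance instead of being computed. Integrating
    the tail bound over levels gives [v + m ^+ 2 = E (Y - m) ^+ 2 <= 8 * s ^+ 2]. Conversely, with
    [q ^+ 2 = v], Chebyshev's inequality leaves mass at least 3/4 on [[- 2 * q, 2 * q]], where a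
    density bounded by [1 / |s|] puts at most [4 * q / |s|]. Then [m ^+ 2 <= 8 * 36 * v]. *)
Lemma gaussian_rv_scale (Y : {RV P >-> R}) (v : R) : 0 < v ->
  ('E_P[Y] = 0)%E -> ('V_P[Y] = v%:E)%E -> gaussian_rv P Y ->
  exists m s : R, [/\ s != 0, v <= 8 * s ^+ 2, s ^+ 2 <= 36 * v, m ^+ 2 <= 288 * v &
    forall A, measurable A -> P (Y @^-1` A) = normal_prob m s A].
Proof.
move=> v0 EY VY [m [s law]].
have mY : measurable_fun setT Y by [].
have Y2 : (Y : Omega -> R) \in Lfun P 2%:E.
  apply: Lfun2_of_sqr_integral => //.
  have : ('V_P[Y] < +oo)%E by rewrite VY ltry.
  rewrite /variance unlock EY /= unlock; apply: le_lt_trans.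
  rewrite le_eqVlt; apply/orP; left; apply/eqP; apply: eq_integral => w _.
  by rewrite -[RHS]/(((Y w - 0) * (Y w - 0))%:E) subr0 expr2.
have mZ : measurable_fun setT (fun w => (Y w - m) ^+ 2).
  by apply: measurable_funX; apply: measurable_funB.
pose Z : {RV P >-> R} := mfun_Sub (mem_set mZ : (fun w => (Y w - m) ^+ 2) \in mfun).
have EZ : ('E_P[Z] = (v + m ^+ 2)%:E)%E.
  have Ym2 : ((Y : Omega -> R) \- cst m)%R \in Lfun P 2%:E.
    by rewrite rpredB ?lee1n //= => _; rewrite Lfun_cst.
  have := varianceE Ym2; rewrite varianceB_cst_r // VY expectationB; last 2 first.
  - by apply: Lfun_subset12 => //; apply: fin_num_measure.
  - by rewrite Lfun_cst.
  rewrite EY expectation_cst sub0e => H.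
  have -> : 'E_P[Z]%E = 'E_P[((Y : Omega -> R) \- cst m) ^+ 2]%E by [].
  move: H; rewrite -EFin_expe.
  case: ('E_P[_])%E => [r| |] //= [->]; rewrite sqrrN subrK //.
have ccE r : ccdf (P := P) Z r = gaussian_law m s [set x | r < (x - m) ^+ 2].
  rewrite -law.
    rewrite /ccdf /distribution /pushforward; congr (P _).
    by apply/seteqP; split => w /=; rewrite in_itv /= andbT.
  rewrite -[X in measurable X]setTI; apply: measurable_fun_ltr => //.
  by apply: measurable_funX; apply: measurable_funB.
have EZc := @ge0_expectation_ccdf _ _ _ P Z (fun w => sqr_ge0 _).
(* In the degenerate case the law is the point mass at [m], and the second moment about [m] would
   vanish in spite of [v > 0]. *)
have s0 : s != 0.
  apply/eqP => s0; suff : ('E_P[Z] <= 0)%E.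
    by rewrite EZ lee_fin leNgt ltr_wpDr // sqr_ge0.
  rewrite EZc integral0_eq // => r /=; rewrite in_itv /= andbT => r0.
  rewrite ccE /gaussian_law s0 eqxx diracE memNset //= subrr expr0n /=.
  by apply/negP; rewrite -leNgt.
have s20 : 0 < s ^+ 2 by rewrite exprn_even_gt0.
have lawN A : measurable A -> P (Y @^-1` A) = normal_prob m s A.
  by move=> mA; have := law A mA; rewrite /gaussian_law (negbTE s0).
have EZle : v + m ^+ 2 <= 8 * s ^+ 2.
  rewrite -lee_fin -EZ EZc.
  apply: (@le_trans _ _ (\int[lebesgue_measure]_(r in `[0%R, +oo[)
      (2 * expR (- (r / (4 * s ^+ 2))))%:E)%E).
    apply: ge0_le_integral => //.
    - exact: measurable_funTS (ccdf_measurable Z).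
    - apply: measurable_funTS; apply/measurable_EFinP; apply: measurable_funM => //.
      apply: measurableT_comp => //; apply: measurableT_comp => //.
      exact: measurable_funM.
    move=> r /=; rewrite in_itv /= andbT => r0.
    rewrite ccE /gaussian_law (negbTE s0).
    have := normal_prob_tail m s0 (sqrtr_ge0 r); rewrite sqr_sqrtr //; apply: le_trans.
    apply: le_measure; rewrite ?inE.
    - rewrite -[X in measurable X]setTI; apply: measurable_fun_ltr => //.
      by apply: measurable_funX; apply: measurable_funB.
    - rewrite -[X in measurable X]setTI; apply: measurable_fun_ler => //.
      by apply: measurableT_comp => //; apply: measurable_funB.
    move=> x /= rx; rewrite -sqrtr_sqr ler_sqrt ?sqr_ge0 //; exact: ltW.
  apply: (le_trans (exponential_tail_integral_le _)); first by rewrite mulr_gt0.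
  by rewrite lee_fin mulrA -natrM.
have sv : s ^+ 2 <= 36 * v.
  pose q := Num.sqrt v; have q0 : 0 < q by rewrite sqrtr_gt0.
  have qv : q ^+ 2 = v by rewrite sqr_sqrtr // ltW.
  have q20 : 0 < 2 * q by rewrite mulr_gt0.
  have cheb := chebyshev Y q20; rewrite EY VY /= -EFinM in cheb.
  have c14 : (2 * q) ^- 2 * v = 4^-1 by rewrite -qv; field; rewrite gt_eqF.
  rewrite c14 in cheb.
  pose J : set R := [set` `[- (2 * q), 2 * q]].
  have mI : measurable J by exact: measurable_itv.
  have cover : (1 <= P [set w | (2 * q <= `|Y w - 0|)%R] + P (Y @^-1` J))%E.
    rewrite -(probability_setT P); apply: (le_trans _ (measureU2 _ _ _)).
    - apply: le_measure; rewrite ?inE //.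
        by apply: measurableU; [|]; rewrite -[X in measurable X]setTI;
          [apply: measurable_fun_ler => //; apply: measurableT_comp => //; apply: measurable_funB | apply: mY].
      move=> w _ /=; rewrite subr0; case: (leP (2 * q) `|Y w|) => [|/ltW]; first by left.
      by rewrite ler_norml => h; right; rewrite /J /= in_itv.
    - rewrite -[X in measurable X]setTI; apply: measurable_fun_ler => //.
      by apply: measurableT_comp => //; apply: measurable_funB.
    - by rewrite -[X in measurable X]setTI; apply: mY.
  rewrite lawN // in cover.
  have qq : - (2 * q) <= 2 * q by lra.
  have up := normal_prob_itv_le m s0 qq.
  have : (1 <= (4^-1)%:E + ((2 * q - - (2 * q)) / `|s|)%:E :> \bar R)%E.
    by apply: (le_trans cover); apply: leeD.
  rewrite -EFinD lee_fin => h.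
  have sp : 0 < `|s| by rewrite normr_gt0.
  have h34 : 3 / 4 * `|s| <= 4 * q by rewrite -ler_pdivlMr //; lra.
  rewrite -(@real_normK _ s) ?num_real // -qv; nra.
exists m, s; split => //.
- by have := sqr_ge0 m; lra.
- by have := sqr_ge0 m; lra.
Qed.

End GaussianVariables.

(** * Chaining, and the paths of fractional Brownian motion *)

Lemma leq_succ_cases k l : (k <= l)%N -> (l <= k.+1)%N -> (l == k) || (l == k.+1).
Proof.
rewrite leq_eqVlt eq_sym => /orP[-> //|h1 h2].
by rewrite [X in _ || X]eqn_leq h1 h2 orbT.
Qed.

Lemma dyadic_scale (R : realType) (w : R) (n0 : nat) : 0 < w -> w <= dyadic_step R n0 ->
  exists2 n, (n0 <= n)%N & dyadic_step R n.+1 < w <= dyadic_step R n.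
Proof.
move=> w0 wn0; have w20 : 0 < w / 2 by rewrite divr_gt0.
have [n1 Hn1] := dyadic_step_small w20.
have ex : exists m, dyadic_step R (n0 + m) < w.
  by exists n1; apply: (le_lt_trans (Hn1 _ (leq_addl _ _))); lra.
case: (ex_minnP ex) => -[|m] Hm Hmin; first by move: Hm; rewrite addn0 ltNge wn0.
exists (n0 + m)%N; first exact: leq_addr.
rewrite -addnS Hm /= leNgt; apply/negP => /Hmin; by rewrite ltnn.
Qed.

(* Kolmogorov's chaining: a point is reached along its dyadic approximations. *)
Lemma dyadic_chaining (R : realType) (g : R -> R) (gam : R) (N n0 : nat) : 0 < gam ->
  {within `[0, N%:R], continuous g} ->
  (forall n k, (n0 <= n)%N -> (k < N * 2 ^ n)%N ->
     `|g (k.+1%:R * dyadic_step R n) - g (k%:R * dyadic_step R n)| <= dyadic_step R n `^ gam) ->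
  exists2 G, 0 <= G & forall s t, s \in `[0, N%:R] -> t \in `[0, N%:R] ->
    `|g t - g s| <= G * `|t - s| `^ gam.
Proof.
move=> gam0 cg H.
pose r : R := 2^-1 `^ gam; have r01 : 0 <= r < 1 := dyadic_ratio_lt1 gam0.
have /andP[r0 r1] := r01.
pose C := 1 / (1 - r); have C0 : 0 <= C by rewrite divr_ge0 // subr_ge0 ltW.
have le_idx n k (t : R) : k%:R * dyadic_step R n <= t -> t <= N%:R -> (k <= N * 2 ^ n)%N.
  move=> kt tN; have := le_trans kt tN; rewrite /dyadic_step exprVn ler_pdivrMr ?exprn_gt0 //.
  by rewrite -natrX -natrM ler_nat.
(* From one level to the next, the dyadic approximation of [t] either stays or moves by one step of
   the finer grid. The values of [g] thus converge geometrically, and continuity identifies their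
   limit as [g t]. *)
have approx t n : 0 <= t <= N%:R -> (n0 <= n)%N ->
    `|g t - g ((dyadic_index n t)%:R * dyadic_step R n)| <= C * r ^+ n.
  move=> /andP[t0 tN] nn.
  pose u n := g ((dyadic_index n t)%:R * dyadic_step R n).
  have Hu m : (n0 <= m)%N -> `|u m.+1 - u m| <= 1 * r ^+ m.
    move=> nm; rewrite mul1r /u.
    have hS : (2 * dyadic_index m t)%:R * dyadic_step R m.+1 = (dyadic_index m t)%:R * dyadic_step R m.
      by rewrite dyadic_stepS natrM; field.
    have /andP[i1 _] := dyadic_index_bounds m.+1 t0.
    have /andP[j1 j2] := dyadic_indexS m t0.
    case/orP: (leq_succ_cases j1 j2) => /eqP e.
      by rewrite e hS subrr normr0 exprn_ge0.
    rewrite e -hS; apply: (le_trans (H m.+1 (2 * dyadic_index m t)%N (leqW nm) _)).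
      by rewrite e in i1; exact: le_idx i1 tN.
    rewrite dyadic_step_powR exprS ler_piMl ?exprn_ge0 //; exact: ltW.
  have [cu hu] := geometric_cauchy_cvg ler01 r01 Hu.
  suff -> : g t = limn u by apply: hu.
  apply/esym/(cvg_lim (@norm_hausdorff _ _)).
  apply/cvgrPdist_le => e e0.
  move/subspace_continuousP : cg => /(_ t); rewrite /= in_itv /= t0 tN => /(_ isT).
  move/cvgrPdist_le => /(_ e e0); rewrite near_withinE => -[eta /= eta0 Heta].
  have eta20 : 0 < eta / 2 by rewrite divr_gt0.
  have [n1 Hn1] := dyadic_step_small eta20; exists n1 => // m /= nm.
  have /andP[i1 i2] := dyadic_index_bounds m t0.
  apply: Heta => /=.
    rewrite ger0_norm ?subr_ge0 //.
    have := Hn1 m nm; lra.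
  rewrite in_itv /= mulr_ge0 ?(ltW (dyadic_step_gt0 _ _)) //=; exact: le_trans i1 tN.
(* Pairs of times further apart than the step of level [n0] are out of reach of the hypothesis; for
   them the boundedness of [g] is used. *)
have [M M0 HM] : exists2 M, 0 <= M & forall t, t \in `[0, N%:R] -> `|g t| <= M.
  have N0 : (0 : R) <= N%:R by [].
  have [c1 _ h1] := EVT_max N0 cg; have [c2 _ h2] := EVT_min N0 cg.
  exists (`|g c1| + `|g c2|); first by rewrite addr_ge0.
  move=> t tN; have := h1 t tN; have := h2 t tN.
  have := ler_norm (g c1); have := lerNnormlW (lexx `|g c2|).
  have := normr_ge0 (g c1); have := normr_ge0 (g c2).
  by rewrite ler_norml => *; apply/andP; split; lra.
pose h0 := dyadic_step R n0; have h00 : 0 < h0 := dyadic_step_gt0 _ _.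
pose G := (2 * C + 1) * 2 `^ gam + 2 * M / h0 `^ gam.
have G1 : 0 <= (2 * C + 1) * 2 `^ gam by rewrite mulr_ge0 ?powR_ge0 // addr_ge0 // mulr_ge0.
have G2 : 0 <= 2 * M / h0 `^ gam by rewrite divr_ge0 ?powR_ge0 // mulr_ge0.
exists G; first by rewrite addr_ge0.
have main s t : 0 <= s -> s < t -> t <= N%:R -> `|g t - g s| <= G * (t - s) `^ gam.
  move=> s0 st tN; have w0 : 0 < t - s by rewrite subr_gt0.
  have sN : s <= N%:R by apply: le_trans tN; apply: ltW.
  have t0 : 0 <= t by apply: le_trans s0 (ltW st).
  have P0 : 0 <= (t - s) `^ gam := powR_ge0 _ _.
  have [hh|hh] := leP (t - s) h0; last first.
    apply: (@le_trans _ _ (2 * M)).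
      apply: (le_trans (ler_normB _ _)).
      have := HM t; have := HM s; rewrite !in_itv /= s0 sN t0 tN => /(_ isT) ? /(_ isT) ?; lra.
    rewrite /G [leRHS]mulrDl -[leLHS]add0r; apply: lerD; first exact: mulr_ge0.
    rewrite mulrAC ler_pdivlMr ?powR_gt0 // ler_wpM2l ?mulr_ge0 //.
    by apply: le_powR_base; [exact: ltW|exact: ltW|exact: ltW].
  have [n nn /andP[n1 n2]] := dyadic_scale w0 hh.
  pose h := dyadic_step R n; have hpos : 0 < h := dyadic_step_gt0 _ _.
  pose k := dyadic_index n s; pose l := dyadic_index n t.
  have /andP[k1 k2] := dyadic_index_bounds n s0; rewrite -/k -/h in k1 k2.
  have /andP[l1 l2] := dyadic_index_bounds n t0; rewrite -/l -/h in l1 l2.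
  have A1 : `|g t - g (l%:R * h)| <= C * r ^+ n by apply: approx; rewrite ?t0.
  have A2 : `|g s - g (k%:R * h)| <= C * r ^+ n by apply: approx; rewrite ?s0.
  have kl : (k <= l)%N by apply: dyadic_index_le => //; apply: ltW.
  have lk2 : (l < k.+2)%N.
    rewrite -(ltr_nat R) -(ltr_pM2r hpos) -addn2 natrD mulrDl.
    by rewrite -/h in n2; lra.
  have A3 : `|g (l%:R * h) - g (k%:R * h)| <= r ^+ n.
    case/orP: (leq_succ_cases kl lk2) => /eqP e; first by rewrite e subrr normr0 exprn_ge0.
    rewrite e -dyadic_step_powR; apply: H => //.
    by apply: (le_idx _ _ t) => //; rewrite -e.
  have rh : r ^+ n <= 2 `^ gam * (t - s) `^ gam.
    rewrite -dyadic_step_powR -powRM //; last exact: ltW.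
    apply: le_powR_base; [exact: ltW | exact: ltW |].
    by rewrite dyadic_stepS in n1; lra.
  have E : g t - g s = (g t - g (l%:R * h)) - (g s - g (k%:R * h)) + (g (l%:R * h) - g (k%:R * h)) by ring.
  rewrite E; apply: (le_trans (ler_normD _ _)).
  apply: (@le_trans _ _ ((2 * C + 1) * r ^+ n)).
    apply: (@le_trans _ _ (C * r ^+ n + C * r ^+ n + r ^+ n)); last by lra.
    apply: lerD => //; apply: (le_trans (ler_normB _ _)); exact: lerD.
  rewrite /G [leRHS]mulrDl -[leLHS]addr0; apply: lerD; last exact: mulr_ge0.
  by rewrite -mulrA ler_wpM2l // addr_ge0 // mulr_ge0.
move=> s t; rewrite !in_itv /= => /andP[s0 sN] /andP[t0 tN].
case: (ltgtP s t) => [st|ts|->].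
- by rewrite (gtr0_norm (_ : 0 < t - s)) ?subr_gt0 //; apply: main.
- by rewrite distrC [`|t - s|]distrC (gtr0_norm (_ : 0 < s - t)) ?subr_gt0 //; apply: main.
- by rewrite !subrr !normr0 mulr_ge0 ?addr_ge0 ?powR_ge0.
Qed.

Section FractionalBrownianPaths.
Variables (R : realType) (disp : measure_display) (Omega : measurableType disp).
Variables (P : probability Omega R) (H : R) (B : R -> {RV P >-> R}).
Hypotheses (H0 : 0 < H) (B_fbm : fractional_brownian_motion H B).

Definition increment (s t : R) : {RV P >-> R} := (B t \- B s)%R.

Lemma fbm_Lfun2 (t : R) : 0 <= t -> (B t : Omega -> R) \in Lfun P 2%:E.
Proof.
move=> t0; have [_ E0 cov _] := B_fbm.
apply: Lfun2_of_sqr_integral => //.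
have : (covariance P (B t) (B t) < +oo)%E by rewrite cov // ltry.
rewrite unlock E0 //= unlock; apply: le_lt_trans.
rewrite le_eqVlt; apply/orP; left; apply/eqP; apply: eq_integral => w _.
by rewrite -[RHS]/(((B t w - 0) * (B t w - 0))%:E) subr0 expr2.
Qed.

Lemma fbm_increment_moments (s t : R) : 0 <= s -> 0 <= t ->
  ('E_P[increment s t] = 0)%E /\ ('V_P[increment s t] = (`|t - s| `^ (2 * H))%:E)%E.
Proof.
move=> s0 t0; have [_ E0 cov _] := B_fbm.
have L2s := fbm_Lfun2 s0; have L2t := fbm_Lfun2 t0.
have fin : P setT \is a fin_num := fin_num_measure P _ measurableT.
split; first by rewrite expectationB ?Lfun_subset12 // !E0 // sube0.
rewrite varianceB // /variance !cov // !subrr normr0.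
rewrite powR0 ?mulf_eq0 ?pnatr_eq0 ?gt_eqF // [`|t - s|]distrC.
by rewrite -EFinM -!EFinD; congr EFin; field.
Qed.

Lemma fbm_increment_gaussian (s t : R) : 0 <= s -> 0 <= t -> gaussian_rv P (increment s t).
Proof.
move=> s0 t0; have [gp _ _ _] := B_fbm.
pose tt (i : 'I_2) := if i == 0 then t else s.
pose c (i : 'I_2) : R := if i == 0 then 1 else -1.
have := gp 2%N tt c; have -> : (fun w => \sum_i c i * B (tt i) w) = increment s t.
  apply/funext => w; rewrite !big_ord_recl big_ord0 /c /tt /=.
  by rewrite mul1r mulN1r addr0.
by apply => i; rewrite /tt; case: ifP.
Qed.

Lemma fbm_increment_law (s t : R) : 0 <= s -> 0 <= t -> s != t ->
  exists m sd : R, let v := `|t - s| `^ (2 * H) in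
    [/\ sd != 0, v <= 8 * sd ^+ 2, sd ^+ 2 <= 36 * v, m ^+ 2 <= 288 * v &
    forall A, measurable A -> P (increment s t @^-1` A) = normal_prob m sd A].
Proof.
move=> s0 t0 st; have [E0 V0] := fbm_increment_moments s0 t0.
apply: (gaussian_rv_scale _ E0 V0 (fbm_increment_gaussian s0 t0)).
by rewrite powR_gt0 // normr_gt0 subr_eq0 eq_sym.
Qed.

Lemma measurable_increment_ge (s t lam : R) :
  measurable [set w | lam <= `|increment s t w|].
Proof.
rewrite -[X in measurable X]setTI; apply: measurable_fun_ler => //.
exact: measurableT_comp.
Qed.

Lemma fbm_increment_tail : exists2 c : R, 0 < c &
  forall s t lam, 0 <= s -> 0 <= t -> s != t -> 0 <= lam ->
  c * `|t - s| `^ (2 * H) <= lam ^+ 2 ->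
  (P [set w | (lam <= `|increment s t w|)%R] <=
    (2 * expR (- (lam ^+ 2 / (c * `|t - s| `^ (2 * H)))))%:E)%E.
Proof.
(* [1152 = 4 * 288]: as [m ^+ 2 <= 288 * v], the condition on [lam] then gives [|m| <= lam / 2], and
   the tail about [m] at level [lam / 2] applies. The exponent asks for less, [16 * 36 = 576]. *)
exists 1152; first by rewrite ltr0n.
move=> s t lam s0 t0 st lam0; have [m [sd]] := fbm_increment_law s0 t0 st.
set v := `|t - s| `^ (2 * H) => -[sd0 vs sv mv law] lv.
have v0 : 0 < v by rewrite powR_gt0 // normr_gt0 subr_eq0 eq_sym.
have sd20 : 0 < sd ^+ 2 by rewrite exprn_even_gt0.
have l20 : 0 <= lam / 2 by rewrite divr_ge0.
have mA : measurable [set x : R | lam / 2 <= `|x - m|].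
  rewrite -[X in measurable X]setTI; apply: measurable_fun_ler => //.
  by apply: measurableT_comp => //; apply: measurable_funB.
have m2 : `|m| <= lam / 2.
  rewrite -(@ler_pXn2r _ 2) // ?nnegrE // real_normK ?num_real // expr_div_n.
  have -> : 2 ^+ 2 = 4 :> R by ring.
  lra.
apply: (@le_trans _ _ (P (increment s t @^-1` [set x : R | lam / 2 <= `|x - m|]))).
  apply: le_measure; rewrite ?inE.
  - exact: measurable_increment_ge.
  - by rewrite -[X in measurable X]setTI; apply: measurable_funP.
  move=> w /= lw; have := ler_normB (increment s t w - m) (- m).
  by rewrite opprK subrK normrN; lra.
rewrite law //; apply: (le_trans (normal_prob_tail m sd0 l20)).
rewrite lee_fin ler_wpM2l // ler_expR lerN2 expr_div_n.
have -> : lam ^+ 2 / 2 ^+ 2 / (4 * sd ^+ 2) = lam ^+ 2 / (16 * sd ^+ 2) by field.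
clearbody v; have d1 : 0 < 1152 * v by rewrite pmulr_rgt0 ?ltr0n.
have d2 : 0 < 16 * sd ^+ 2 by rewrite pmulr_rgt0 ?ltr0n.
apply: ler_wpM2l; first exact: sqr_ge0.
rewrite lef_pV2 ?posrE //.
have : 16 * sd ^+ 2 <= 16 * (36 * v) by rewrite ler_pM2l ?ltr0n.
lra.
Qed.

(** With [q = |t - s| ^ H], the event contains the passage of the increment in an interval of length
    [q] lying within [(kap + 18) * q] of the parameter [m], where the density is at least a constant
    over [q]. As [s] and [t] come in either order, large increments of both signs are covered. *)
Lemma fbm_increment_positive (kap : R) : 0 <= kap -> exists2 p : R, 0 < p &
  forall s t : R, 0 <= s -> 0 <= t -> s != t ->
    (p%:E <= P [set w | (kap * `|t - s| `^ H <= increment s t w)%R])%E.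
Proof.
(* In [K], 17 accounts for [|m| <= 17 * q], since [288 <= 17 ^ 2], and 1 for the length of the
   interval. In the witness, 6 comes from [|sd| <= 6 * q], and the exponent [4 * K ^+ 2] from
   [v <= 8 * sd ^+ 2]. *)
move=> kap0; pose K := kap + 18.
exists ((6 * Num.sqrt (pi *+ 2))^-1 * expR (- (4 * K ^+ 2))).
  by rewrite mulr_gt0 ?expR_gt0 // invr_gt0 mulr_gt0 // sqrtr_gt0 mulrn_wgt0 // pi_gt0.
move=> s t s0 t0 st; have [m [sd]] := fbm_increment_law s0 t0 st.
set q := `|t - s| `^ H; set v := `|t - s| `^ (2 * H) => -[sd0 vs sv mv law].
have q0 : 0 < q by rewrite powR_gt0 // normr_gt0 subr_eq0 eq_sym.
have qv : v = q ^+ 2 by rewrite /v mulrC powRrM powR_mulrn // powR_ge0.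
have sd20 : 0 < sd ^+ 2 by rewrite exprn_even_gt0.
have sp : 0 < `|sd| by rewrite normr_gt0.
have sd6 : `|sd| <= 6 * q.
  rewrite -(@ler_pXn2r _ 2) // ?nnegrE ?mulr_ge0 ?(ltW q0) // real_normK ?num_real //.
  rewrite exprMn -qv; have -> : 6 ^+ 2 = 36 :> R by ring.
  exact: sv.
have m17 : `|m| <= 17 * q.
  rewrite -(@ler_pXn2r _ 2) // ?nnegrE ?mulr_ge0 ?(ltW q0) // real_normK ?num_real //.
  rewrite exprMn -qv; have -> : 17 ^+ 2 = 289 :> R by ring.
  by have := sqr_ge0 q; rewrite -qv; lra.
have ab : kap * q <= (kap + 1) * q by rewrite ler_wpM2r ?(ltW q0) // lerDl.
have Hr x : kap * q <= x <= (kap + 1) * q -> `|x - m| <= K * q.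
  move=> /andP[x1 x2]; apply: (le_trans (ler_normB _ _)).
  rewrite ger0_norm; last by apply: le_trans x1; rewrite mulr_ge0 // ltW.
  rewrite /K; lra.
have := normal_prob_itv_ge sd0 ab Hr; rewrite -law // => h.
apply: (@le_trans _ _ (P (increment s t @^-1` `[kap * q, (kap + 1) * q]%classic))); last first.
  apply: le_measure; rewrite ?inE.
  - by rewrite -[X in measurable X]setTI; apply: measurable_funP.
  - by rewrite -[X in measurable X]setTI; apply: measurable_fun_ler.
  by move=> w /=; rewrite in_itv /= => /andP[].
apply: le_trans h; rewrite lee_fin.
have -> : (kap + 1) * q - kap * q = q by ring.
rewrite [leRHS]mulrA; apply: ler_pM; rewrite ?expR_ge0 ?invr_ge0 ?mulr_ge0 ?sqrtr_ge0 //.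
  rewrite /normal_peak -mulrnAr sqrtrM ?sqr_ge0 // sqrtr_sqr !invfM mulrA.
  rewrite ler_wpM2r ?invr_ge0 ?sqrtr_ge0 // ler_pdivlMr //; lra.
have d2 : 0 < 2 * sd ^+ 2 by rewrite pmulr_rgt0.
rewrite ler_expR lerN2 ler_pdivrMr //.
have -> : (K * q) ^+ 2 = K ^+ 2 * v by rewrite exprMn qv.
have : 0 <= K ^+ 2 := sqr_ge0 _.
set k2 := K ^+ 2 => k20.
have : k2 * v <= k2 * (8 * sd ^+ 2) by rewrite ler_wpM2l.
lra.
Qed.


Lemma borel_cantelli_geometric (U : nat -> set Omega) (C : R) (n1 : nat) :
  (forall n, measurable (U n)) -> 0 <= C ->
  (forall n, (n1 <= n)%N -> (P (U n) <= (C * 2^-1 ^+ n)%:E)%E) ->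
  \forall w \ae P, exists n0, forall n, (n0 <= n)%N -> ~ U n w.
Proof.
move=> mU C0 HU.
pose W n := \bigcup_i U (n + i)%N.
have mW n : measurable (W n) by apply: bigcupT_measurable.
have PW n : (n1 <= n)%N -> (P (W n) <= (2 * C * 2^-1 ^+ n)%:E)%E.
  move=> nn; apply: (le_trans (generalized_Boole_inequality P (fun i => mU (n + i)%N) (mW n))).
  have e0 : 0 <= 2 * C * 2^-1 ^+ n by rewrite !mulr_ge0 // exprn_ge0 // invr_ge0.
  apply: (le_trans _ (epsilon_trick0 xpredT e0)); apply: lee_nneseries => // i _.
  apply: (le_trans (HU _ (leq_trans nn (leq_addr _ _)))).
  rewrite lee_fin natrX exprD exprS !exprVn.
  by rewrite le_eqVlt; apply/orP; left; apply/eqP; field; rewrite ?expf_neq0.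
pose bad := \bigcap_n W n.
have mbad : measurable bad by apply: bigcapT_measurable.
exists bad; split => //.
  apply/eqP; rewrite eq_le measure_ge0 andbT.
  have fin : P bad \is a fin_num by apply: fin_num_measure.
  rewrite -(fineK fin) lee_fin.
  have h01 : 0 <= (2^-1 : R) < 1 by rewrite invr_ge0 ler0n /= invf_lt1 // ltr1n.
  apply: (@le_geometric_error _ _ _ (2 * C) 2^-1 n1 h01) => n nn.
  rewrite add0r -lee_fin fineK //; apply: (le_trans _ (PW n nn)).
  by apply: le_measure; rewrite ?inE // => w; apply.
move=> w /= Hw; apply: contrapT => nbad; apply: Hw.
have : exists n, ~ W n w.
  by apply: contrapT => h; apply: nbad => n _; apply: contrapT => hn; apply: h; exists n.
move=> [n hn]; exists n => k nk Uk; apply: hn; exists (k - n)%N => //.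
by rewrite subnKC.
Qed.

Lemma expR_opp_le (x : R) (k : nat) : 0 < x -> expR (- x) <= k.+1`!%:R / x ^+ k.+1.
Proof.
move=> x0; have x1 : 0 < x ^+ k.+1 by rewrite exprn_gt0.
rewrite expRN -[leRHS]invrK lef_pV2 ?posrE ?expR_gt0 // ?invr_gt0 ?divr_gt0 ?ltr0n ?fact_gt0 //.
rewrite invf_div; apply: (le_trans _ (expR_ge1Dxn k (ltW x0))).
by rewrite lerDr.
Qed.

(** A given increment of level [n] exceeds [h ^ gam] with probability at most
    [2 * expR (- (rho ^+ n / c))], where [rho = 4 ^ (H - gam) > 1]. This beats the number
    [N * 2 ^ n] of increments, so that by Borel-Cantelli the hypothesis of chaining holds from some
    level on. *)
Lemma fbm_holder (gam T : R) : 0 < gam < H -> 0 <= T ->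
  \forall w \ae P, exists2 G, 0 <= G &
    forall s t, s \in `[0, T] -> t \in `[0, T] -> `|B t w - B s w| <= G * `|t - s| `^ gam.
Proof.
move=> /andP[gam0 gamH] T0; have [_ _ _ cont] := B_fbm.
pose N := (Num.truncn T).+1.
have TN : T <= N%:R by rewrite ltW //; case/andP: (truncn_itv T0).
pose h n := dyadic_step R n.
pose A n k := [set w | h n `^ gam <= `|increment (k%:R * h n) (k.+1%:R * h n) w|].
pose U n := \big[setU/set0]_(k < N * 2 ^ n) A n k.
have mU n : measurable (U n).
  by apply: bigsetU_measurable => k _; apply: measurable_increment_ge.
have [c c0 tail] := fbm_increment_tail.
pose a : R := 2^-1 `^ gam; pose bb : R := 2^-1 `^ H; pose rho := (a / bb) ^+ 2.
have a0 : 0 < a by rewrite powR_gt0 // invr_gt0.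
have b0 : 0 < bb by rewrite powR_gt0 // invr_gt0.
have rho0 : 0 < rho by rewrite exprn_gt0 // divr_gt0.
have rhon n : 0 < rho ^+ n by apply: exprn_gt0.
have rhoV : 0 <= rho^-1 < 1.
  rewrite invr_ge0 (ltW rho0) /= /rho -exprVn invf_div expr_lt1 // ?divr_ge0 ?(ltW a0) ?(ltW b0) //.
  rewrite ltr_pdivrMr // mul1r /bb -(subrK gam H) powRD; last by rewrite invr_eq0 pnatr_eq0 implybT.
  have Hg0 : 0 < H - gam by rewrite subr_gt0.
  by rewrite gtr_pMl // -/a; case/andP: (@dyadic_ratio_lt1 R _ Hg0).
have small (e : R) : 0 < e -> exists n0, forall n, (n0 <= n)%N -> rho^-1 ^+ n <= e.
  move=> e0; have r1 : `|rho^-1| < 1 by case/andP: rhoV => r0 r1; rewrite ger0_norm.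
  have /cvgrPdist_le/(_ e e0)[n0 _ Hn] := cvg_expr r1; exists n0 => n nn.
  by have := Hn n nn; rewrite /= sub0r normrN ger0_norm // exprn_ge0 //; case/andP: rhoV.
(* [K0] is such that [rho ^+ K0.+1 >= 4]. Comparing the exponential with its Taylor term of order
   [K0.+1] makes it [O(4 ^ (- n))], and the [2 ^ n] intervals leave [2 ^ (- n)]. *)
have [K0 HK0] := small 4^-1 ltac:(by rewrite invr_gt0).
have rhoK : 4 <= rho ^+ K0.+1.
  have := HK0 K0.+1 (leqnSn _); rewrite exprVn lef_pV2 // posrE // rhon.
have ci0 : 0 < c^-1 by rewrite invr_gt0.
have [n1 Hn1] := small _ ci0.
have ratio n : (h n `^ gam) ^+ 2 / (h n `^ (2 * H)) = rho ^+ n.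
  have -> : h n `^ (2 * H) = (bb ^+ n) ^+ 2.
    by rewrite mulrC powRrM powR_mulrn ?powR_ge0 // dyadic_step_powR.
  by rewrite dyadic_step_powR -/a /rho -expr_div_n -expr_div_n -!exprM mulnC.
have PA n k : (n1 <= n)%N -> (P (A n k) <= (2 * expR (- (rho ^+ n / c)))%:E)%E.
  move=> nn; have hn0 := dyadic_step_gt0 R n.
  have dE : `|k.+1%:R * h n - k%:R * h n| = h n.
    by rewrite -mulrBl -natr1 addrAC subrr add0r mul1r ger0_norm // ltW.
  have hp : 0 < h n `^ (2 * H) by rewrite powR_gt0.
  have := tail (k%:R * h n) (k.+1%:R * h n) (h n `^ gam).
  rewrite dE; have -> : (h n `^ gam) ^+ 2 / (c * h n `^ (2 * H)) = rho ^+ n / c.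
    by rewrite -ratio invfM mulrCA mulrC -mulrA mulrC.
  apply; rewrite ?mulr_ge0 ?powR_ge0 ?(ltW hn0) //.
    by rewrite -subr_eq0 -normr_eq0 distrC dE gt_eqF.
  rewrite -ler_pdivlMr // ratio -[c]invrK -[leRHS]invrK lef_pV2 ?posrE ?invr_gt0 ?rhon //.
  by rewrite -exprVn; apply: Hn1.
pose C := N%:R * (2 * (K0.+1`!%:R * c ^+ K0.+1)).
have C0 : 0 <= C by rewrite !mulr_ge0 // exprn_ge0 // ltW.
have PU n : (n1 <= n)%N -> (P (U n) <= (C * 2^-1 ^+ n)%:E)%E.
  move=> nn; have mA k : (k < N * 2 ^ n)%N -> measurable (A n k) by move=> _; apply: measurable_increment_ge.
  apply: (le_trans (Boole_inequality P mA)).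
  apply: (@le_trans _ _ (\sum_(k < N * 2 ^ n) (2 * expR (- (rho ^+ n / c)))%:E)%E).
    by apply: lee_sum => k _; apply: PA.
  rewrite sumEFin lee_fin sumr_const card_ord -[leLHS]mulr_natl natrM natrX.
  have rn0 : 0 < rho ^+ n / c by rewrite divr_gt0.
  have yE : (rho ^+ n / c) ^+ K0.+1 = (rho ^+ K0.+1) ^+ n / c ^+ K0.+1.
    by rewrite expr_div_n exprAC.
  have hexp := expR_opp_le K0 rn0; rewrite yE invf_div mulrA in hexp.
  have h4 : (rho ^+ K0.+1 ^+ n)^-1 <= (4 ^+ n)^-1.
    have h4' : 4 ^+ n <= (rho ^+ K0.+1) ^+ n by apply: lerXn2r; rewrite ?nnegrE // ltW.
    by rewrite lef_pV2 // posrE exprn_gt0 // ltr0n.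
  have h5 : expR (- (rho ^+ n / c)) <= K0.+1`!%:R * c ^+ K0.+1 * (4 ^+ n)^-1.
    by apply: (le_trans hexp); rewrite ler_wpM2l // mulr_ge0 // exprn_ge0 // ltW.
  have h6 : (2 : R) ^+ n * (4 ^+ n)^-1 = 2^-1 ^+ n.
    have -> : (4 : R) = 2 * 2 by ring.
    by rewrite exprMn exprVn invfM mulrA divff ?mul1r // expf_neq0.
  rewrite /C -h6.
  have -> : N%:R * (2 * (K0.+1`!%:R * c ^+ K0.+1)) * (2 ^+ n / 4 ^+ n) =
    N%:R * 2 ^+ n * (2 * (K0.+1`!%:R * c ^+ K0.+1 * (4 ^+ n)^-1)) by ring.
  by rewrite ler_wpM2l ?mulr_ge0 ?exprn_ge0 // ler_wpM2l.
have := borel_cantelli_geometric mU C0 PU; move: cont; apply: filterS2 => w cw [n0 Hn0].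
have cN : {within `[0, N%:R], continuous (fun t => B t w)}.
  by apply: continuous_subspaceW cw => t /=; rewrite !in_itv /= => /andP[->].
have Hd n k : (n0 <= n)%N -> (k < N * 2 ^ n)%N ->
    `|B (k.+1%:R * dyadic_step R n) w - B (k%:R * dyadic_step R n) w| <= dyadic_step R n `^ gam.
  move=> nn kN; have := Hn0 n nn => nU.
  rewrite leNgt; apply/negP => hlt; apply: nU.
  rewrite /U -bigcup_mkord; exists k => //=; rewrite /A /=.
  exact: ltW.
have [G G0 HG] := dyadic_chaining gam0 cN Hd.
exists G => // s t; rewrite !in_itv /= => /andP[s0 sT] /andP[t0 tT].
by apply: HG; rewrite in_itv /= ?s0 ?t0 /= (le_trans _ TN).
Qed.

End FractionalBrownianPaths.

(** * Recurring events and the local expansion of a solution *)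

Lemma ae_inhabited (R : realType) (disp : measure_display) (Omega : measurableType disp)
    (P : probability Omega R) (Q : Omega -> Prop) :
  (\forall w \ae P, Q w) -> exists w, Q w.
Proof.
move=> [N [mN PN0 sub]]; apply: contrapT => nQ.
suff NT : N = setT by move: PN0; rewrite NT probability_setT => /eqP; rewrite onee_eq0.
apply/seteqP; split => // w _; apply: sub => /= Qw; apply: nQ; by exists w.
Qed.

(** The probability of the upper limit of the events is the limit of those of the tail unions, hence
    at least [p]. This is continuity of the measure, without independence. *)
Lemma ae_not_eventually_avoid (R : realType) (disp : measure_display)
    (Omega : measurableType disp) (P : probability Omega R) (F : nat -> set Omega)
    (p : R) (n1 : nat) : 0 < p -> (forall n, measurable (F n)) ->
  (forall n, (n1 <= n)%N -> (p%:E <= P (F n))%E) ->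
  ~ (\forall w \ae P, exists n0, forall n, (n0 <= n)%N -> ~ F n w).
Proof.
move=> p0 mF pF [N [mN PN0 sub]].
have cv := @lim_sup_set_cvg _ _ _ P F mF.
have fin : (P (\bigcup_(k in [set k | (0 <= k)%N]) F k) < +oo)%E.
  by apply: (le_lt_trans (probability_le1 P _)); rewrite ?ltry //; apply: bigcup_measurable.
have {}cv := cv fin.
have : (p%:E <= P (lim_sup_set F))%E.
  apply: (cvge_to_ge cv); exists n1 => // n /= nn; apply: (le_trans (pF n nn)).
  apply: le_measure; rewrite ?inE //; first by apply: bigcup_measurable.
  by move=> w Fw; exists n => //=.
apply/negP; rewrite -ltNge.
have -> : P (lim_sup_set F) = 0%E.
  apply/eqP; rewrite eq_le measure_ge0 andbT -PN0; apply: le_measure; rewrite ?inE //.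
    by apply: bigcapT_measurable => n; apply: bigcup_measurable.
  move=> w Hw; apply: sub => /= -[n0 Hn0].
  by have [k /= nk Fk] := Hw n0 Logic.I; apply: Hn0 Fk.
by rewrite lte_fin.
Qed.

(** Over [[a, a]] the empty subdivision is admissible for every mesh, and its sum is 0. *)
Lemma RS_integral_point (R : realType) (f g : R -> R) (a I : R) :
  is_RS_integral f g a a I -> I = 0.
Proof.
move=> H; apply/eqP; rewrite -normr_le0; apply/ler_addgt0Pr => e e0; rewrite add0r.
have [eta _ Heta] := H e e0.
have := Heta [::] (fun=> a); rewrite /RS_sum /= big_geq // sub0r normrN => h.
by apply/ltW/h.
Qed.

Section LocalExpansion.
Variables (R : realType) (d : nat) (b sigma : R -> 'rV[R]_d -> 'rV[R]_d).
Variables (T beta delta alpha mu L : R).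
Hypotheses (alpha0_gt : 0 < alpha) (alpha_lt : alpha < alpha0 beta delta).
Hypothesis sigma_H1 : assumption_H1 T beta delta sigma.
Hypothesis mu_bnd : 1 - alpha0 beta delta < mu <= 1.
Hypothesis L0 : 0 < L.
Hypothesis b_lip : forall s t : R, s \in `[0, T] -> t \in `[0, T] -> forall x y,
  enorm x <= 1 -> enorm y <= 1 ->
  enorm (b t x - b s y) <= L * (`|t - s| `^ mu + enorm (x - y)).

Let lam := path_exponent beta delta alpha mu.
Let gam := 1 - alpha.

(** A converse of [integral_equation_of_davie] at the starting time. The drift integral is expanded
    by the Hoelder continuity of its integrand and the other one by Young's estimate; both
    integrands are Hoelder because the solution is, and because it stays in the ball where [b] is
    Lipschitz. *)
Lemma solution_local_expansion (g : R -> R) (G t : R) (x0 : 'rV[R]_d) (x : R -> 'rV[R]_d) :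
  0 <= t -> t < T -> 0 <= G ->
  (forall s u, s \in `[0, T] -> u \in `[0, T] -> `|g u - g s| <= G * `|u - s| `^ gam) ->
  holder_on t T gam x ->
  (forall s, s \in `[t, T] -> enorm (x s) <= 1) ->
  (forall s, s \in `[t, T] -> integral_equation b sigma g t x0 x s) ->
  exists2 C, 0 <= C & forall s, t < s -> s <= T -> s <= t + 1 ->
    enorm (x s - x0 - (s - t) *: b t x0 - (g s - g t) *: sigma t x0)
      <= C * (s - t) `^ (lam + gam).
Proof.
move=> t0 tT G0 Hg [C1 HC1] x1 eqx.
have [p0 pb pd pm p1] := path_exponent_facts alpha0_gt alpha_lt sigma_H1 mu_bnd.
have [a2 ab ad] := alpha_bounds alpha_lt sigma_H1.
have [/andP[be0 be1] /andP[de0 de1] _ [Ms Ms0 Hs] _] := sigma_H1.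
have gam0 : 0 < gam by rewrite /gam; lra.
have gam1 : gam <= 1 by rewrite /gam gerBl ltW.
have lamgam : lam <= gam by apply: (le_trans pd); rewrite ler_piMl // /gam; lra.
pose C := `|C1|; have C0 : 0 <= C := normr_ge0 _.
have lam0 : 0 < lam := p0.
have p1' : 1 < lam + gam := p1.
(* The initial value is read off the equation at [s = t], where both integrals vanish. *)
have xx0 : x t = x0.
  have tt : t \in `[t, T] by rewrite in_itv /= lexx ltW.
  have [I [HI ->]] := eqx t tt.
  have -> : I = 0 by apply/rowP => i; rewrite mxE; apply: RS_integral_point (HI i).
  by apply/rowP => i; rewrite !mxE Rintegral_point !addr0.
have in0T u : t <= u -> u <= T -> u \in `[0, T].
  by move=> tu uT; rewrite in_itv /= uT (le_trans t0).
have intT u : t <= u -> u <= T -> u \in `[t, T].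
  by move=> tu uT; rewrite in_itv /= uT tu.
have Hx u v : t <= u -> u <= v -> v <= T -> v <= u + 1 -> enorm (x v - x u) <= C * (v - u) `^ lam.
  move=> tu uv vT vu1; have w0 : 0 <= v - u by rewrite subr_ge0.
  apply: (le_trans (HC1 u v (intT _ tu (le_trans uv vT)) (intT _ (le_trans tu uv) vT))).
  rewrite ger0_norm //; apply: (@le_trans _ _ (C * (v - u) `^ gam)).
    by rewrite ler_wpM2r ?powR_ge0 // ler_norm.
  by rewrite ler_wpM2l //; apply: ge_powR_exponent => //; rewrite w0 lerBlDl.
have powle u v r : u <= v -> v <= u + 1 -> lam <= r -> `|v - u| `^ r <= (v - u) `^ lam.
  move=> uv vu lr; rewrite ger0_norm ?subr_ge0 //.
  by apply: ge_powR_exponent => //; rewrite subr_ge0 uv lerBlDl.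
pose K := (L + Ms) * (1 + C) + G.
have LC0 : 0 <= L * (1 + C) by rewrite mulr_ge0 ?(ltW L0) // addr_ge0.
have MC0 : 0 <= Ms * (1 + C) by rewrite mulr_ge0 ?(ltW Ms0) // addr_ge0.
have KE : K = L * (1 + C) + Ms * (1 + C) + G by rewrite /K; ring.
have K0 : 0 <= K by rewrite KE !addr_ge0.
have Hb u v : t <= u -> u <= v -> v <= T -> v <= u + 1 ->
    enorm (b v (x v) - b u (x u)) <= K * (v - u) `^ lam.
  move=> tu uv vT vu1; have tv := le_trans tu uv; have uT := le_trans uv vT.
  apply: (le_trans (b_lip (in0T _ tu uT) (in0T _ tv vT) (x1 _ (intT _ tv vT)) (x1 _ (intT _ tu uT)))).
  apply: (@le_trans _ _ (L * (1 + C) * (v - u) `^ lam)).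
    rewrite -mulrA ler_wpM2l ?(ltW L0) // mulrDl mul1r lerD //; first exact: powle.
    exact: Hx.
  by rewrite ler_wpM2r ?powR_ge0 // KE -addrA lerDl addr_ge0.
have Hsig u v : t <= u -> u <= v -> v <= T -> v <= u + 1 ->
    enorm (sigma v (x v) - sigma u (x u)) <= K * (v - u) `^ lam.
  move=> tu uv vT vu1; have tv := le_trans tu uv; have uT := le_trans uv vT.
  apply: (le_trans (Hs _ _ (in0T _ tu uT) (in0T _ tv vT) (x v) (x u))).
  apply: (@le_trans _ _ (Ms * (1 + C) * (v - u) `^ lam)).
    rewrite -mulrA ler_wpM2l ?(ltW Ms0) // mulrDl mul1r lerD //; first exact: powle.
    exact: Hx.
  by rewrite ler_wpM2r ?powR_ge0 // KE (addrC (L * _)) -addrA lerDl addr_ge0.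
have coordB (i : 'I_d) (p q : 'rV[R]_d) : p 0 i - q 0 i = (p - q) 0 i by rewrite !mxE.
pose Cy := K ^+ 2 / (1 - 2 `^ (1 - (lam + gam))).
have Cy0 : 0 <= Cy.
  rewrite divr_ge0 ?sqr_ge0 // subr_ge0 -[1 - (lam + gam)]opprB powRN invf_le1 ?powR_gt0 //.
  have := @le_powR_base R 1 2 (lam + gam - 1); rewrite powR1; apply; rewrite ?ler1n //.
  by rewrite subr_ge0 ltW.
exists (d%:R * (K + Cy)); first by rewrite mulr_ge0 // addr_ge0.
move=> s ts sT st1; have ts' := ltW ts.
rewrite -mulrA; apply: enorm_le_coord => i.
have [I [HI xs]] := eqx s (intT _ ts' sT).
pose f r := b r (x r) 0 i.
have sub1 u v : t <= u -> v <= s -> v <= u + 1 by move=> tu vs; lra.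
have cf : {within `[t, s], continuous f}.
  apply: (@within_continuous_holder _ _ _ _ 1 K lam) => // u v tu uv vs vt.
  by apply: (le_trans _ (Hb u v tu uv (le_trans vs sT) vt)); rewrite /f coordB coord_le_enorm.
have w0 : 0 <= s - t by rewrite subr_ge0.
have E1 : `|\int[lebesgue_measure]_(r in `[t, s]) f r - f t * (s - t)| <= K * (s - t) `^ lam * (s - t).
  have := @Rintegral_increment_le R f t s t s (K * (s - t) `^ lam) (lexx t) ts' (lexx s) cf.
  rewrite Rintegral_point subr0; apply => r /andP[tr rs].
  rewrite /f coordB (le_trans (coord_le_enorm _ _ _)) //.
  apply: (le_trans (Hb t r (lexx t) tr (le_trans rs sT) (sub1 _ _ (lexx t) rs))).
  by rewrite ler_wpM2l //; apply: le_powR_base; rewrite ?subr_ge0 ?(ltW lam0) // lerD2r.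
have E1' : K * (s - t) `^ lam * (s - t) <= K * (s - t) `^ (lam + gam).
  rewrite -mulrA ler_wpM2l // powRD_gt0 // ler_wpM2l ?powR_ge0 //.
  by apply: ger1_powR => //; rewrite subr_gt0 ts lerBlDl.
have E2 : `|I 0 i - sigma t (x t) 0 i * (g s - g t)| <= Cy * (s - t) `^ (lam + gam).
  apply: (young_local_estimate ts K0 lam0 gam0 p1' _ _ (HI i)) => u v tu uv vs.
    rewrite coordB (le_trans (coord_le_enorm _ _ _)) //.
    exact: (Hsig u v tu uv (le_trans vs sT) (sub1 _ _ tu vs)).
  have tv := le_trans tu uv; have vT := le_trans vs sT.
  apply: (le_trans (Hg _ _ (in0T _ tu (le_trans uv vT)) (in0T _ tv vT))).
  rewrite ger0_norm ?subr_ge0 // ler_wpM2r ?powR_ge0 // KE lerDr addr_ge0 //.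
have -> : (x s - x0 - (s - t) *: b t x0 - (g s - g t) *: sigma t x0) 0 i =
   (\int[lebesgue_measure]_(r in `[t, s]) f r - f t * (s - t)) +
   (I 0 i - sigma t (x t) 0 i * (g s - g t)).
  by rewrite xs /f xx0 !mxE; ring.
apply: (le_trans (ler_normD _ _)); rewrite mulrDl; apply: lerD => //.
exact: (le_trans E1).
Qed.

End LocalExpansion.

(** * The equivalence for fractional Brownian motion *)

Section UnitBallViability.
Variables (R : realType) (disp : measure_display) (Omega : measurableType disp).
Variables (P : probability Omega R) (T : R) (d : nat) (H : R) (B : R -> {RV P >-> R}).
Variables (b sigma : R -> 'rV[R]_d -> 'rV[R]_d) (beta delta alpha mu L : R).
Hypotheses (T0 : 0 < T) (H_gt : 2^-1 < H) (H_lt1 : H < 1).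
Hypothesis B_fbm : fractional_brownian_motion H B.
Hypothesis sigma_H1 : assumption_H1 T beta delta sigma.
Hypotheses (alpha_gt : 1 - H < alpha) (alpha_lt : alpha < alpha0 beta delta).
Hypothesis mu_bnd : 1 - alpha0 beta delta < mu <= 1.
Hypothesis L0 : 0 < L.
Hypothesis b_lip : forall s t : R, s \in `[0, T] -> t \in `[0, T] -> forall x y,
  enorm x <= 1 -> enorm y <= 1 ->
  enorm (b t x - b s y) <= L * (`|t - s| `^ mu + enorm (x - y)).

Lemma alpha_gt0 : 0 < alpha.
Proof. by apply: lt_trans alpha_gt; rewrite subr_gt0. Qed.

Lemma fbm_holder_ae : \forall w \ae P, exists2 G, 0 <= G &
  forall s t, s \in `[0, T] -> t \in `[0, T] ->
    `|B t w - B s w| <= G * `|t - s| `^ (1 - alpha).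
Proof.
have [a2 _ _] := alpha_bounds alpha_lt sigma_H1.
have Hp : 0 < H by apply: lt_trans H_gt; rewrite invr_gt0.
apply: (fbm_holder Hp B_fbm); last exact: ltW.
by have h := alpha_gt; apply/andP; split; lra.
Qed.

Lemma viable_of_tangent :
  (forall t : R, t \in `[0, T] -> forall x : 'rV[R]_d, enorm x = 1 ->
     dotp x (b t x) <= 0 /\ dotp x (sigma t x) = 0) ->
  viable P T alpha b sigma B (@unit_ball R d).
Proof.
move=> tang t tT x0 x01; have a0 := alpha_gt0.
have t0T : 0 <= t <= T by move: tT; rewrite in_itv.
have [N [mN PN0 sub]] := fbm_holder_ae.
(* On the null set [N] the path is replaced by 0. Every path is then Hoelder, so that the solution
   is measurable and lies in the ball for all [w], and it is driven by [B] outside [N]. *)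
pose g w u := B u w * \1_(~` N) w.
have gN w : ~ N w -> g w = B ^~ w.
  by move=> nN; apply/funext => u; rewrite /g indicE mem_set ?mulr1.
have HG w : exists G, 0 <= G /\ forall s u, s \in `[0, T] -> u \in `[0, T] ->
    `|g w u - g w s| <= G * `|u - s| `^ (1 - alpha).
  have [Nw|nNw] := pselect (N w).
    exists 0; split => // s u _ _.
    by rewrite /g indicE memNset ?mulr0 ?subrr ?normr0 ?mul0r //= => /(_ Nw).
  have : exists2 G, 0 <= G & forall s u, s \in `[0, T] -> u \in `[0, T] ->
      `|B u w - B s w| <= G * `|u - s| `^ (1 - alpha).
    by apply: contrapT => h; apply: nNw; apply: sub.
  by move=> [G G0 hG]; exists G; split => // s u sT uT; rewrite gN //; apply: hG.
have [G HG'] := choice HG.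
have mg u : measurable_fun setT (g ^~ u).
  by apply: measurable_funM => //; apply: measurable_indic; apply: measurableC.
pose X s w := path_solution b sigma T (g w) t x0 s.
have correct w := path_solution_correct T0 a0 alpha_lt sigma_H1 mu_bnd L0 b_lip tang
   t0T (HG' w).1 x01 (HG' w).2.
exists X; last by exists set0; split => // w /= []; have [_ _] := correct w.
split.
- move=> s; rewrite in_itv /= => /andP[ts _] i.
  exact: (measurable_path_solution T0 a0 alpha_lt sigma_H1 mu_bnd L0 b_lip tang (g := g)
    (G := G) i t0T x01 ts (fun w => (HG' w).1) (fun w => (HG' w).2) (fun u _ => mg u)).
- by exists set0; split => // w /= []; have [] := correct w.
- exists N; split => // w /= nH; apply: contrapT => nN; apply: nH => s sT.
  by rewrite -gN //; have [_ h _] := correct w; apply: h.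
Qed.

Lemma tangent_of_viable_lt (t : R) (x : 'rV[R]_d) : 0 <= t -> t < T -> enorm x = 1 ->
  viable P T alpha b sigma B (@unit_ball R d) ->
  dotp x (b t x) <= 0 /\ dotp x (sigma t x) = 0.
Proof.
move=> t0 tT x1 viab; have a0 := alpha_gt0.
have [p0 pb pd pm p1] := path_exponent_facts a0 alpha_lt sigma_H1 mu_bnd.
set th := path_exponent beta delta alpha mu + (1 - alpha) in p1.
have tin : t \in `[0, T] by rewrite in_itv /= t0 ltW.
have Kx : @unit_ball R d x by rewrite /unit_ball /= x1.
have [X [_ Xhol Xeq] XK] := viab t tin x Kx.
have Hp : 0 < H by apply: lt_trans H_gt; rewrite invr_gt0.
pose bet := dotp x (b t x); pose c := dotp x (sigma t x).
(* The expansion of the solution is paired with [x], using that [dotp x (X s w) <= 1] while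
   [dotp x x = 1]. The constant depends on [w]. *)
pose good w := exists2 C, 0 <= C & forall s, t < s -> s <= T -> s <= t + 1 ->
  (s - t) * bet + (B s w - B t w) * c <= C * (s - t) `^ th.
have goodae : \forall w \ae P, good w.
  have q1 : \forall w \ae P, holder_on t T (1 - alpha) (X ^~ w) /\
      (forall s, s \in `[t, T] -> integral_equation b sigma (B ^~ w) t x (X ^~ w) s).
    by move: Xhol Xeq; apply: filterS2 => w h1 h2; split.
  have q2 : \forall w \ae P, (forall s, s \in `[t, T] -> enorm (X s w) <= 1) /\
      exists2 G, 0 <= G & forall s u, s \in `[0, T] -> u \in `[0, T] ->
        `|B u w - B s w| <= G * `|u - s| `^ (1 - alpha).
    by move: XK fbm_holder_ae; apply: filterS2 => w h1 h2; split.
  move: q1 q2; apply: filterS2 => w [h1 h2] [h3 [G G0 h4]].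
  have [C C0 HC] := solution_local_expansion a0 alpha_lt sigma_H1 mu_bnd L0 b_lip
    t0 tT G0 h4 h1 h3 h2.
  exists C => // s ts sT st1; have := HC s ts sT st1.
  set E := _ - _ - _ - _ => hE.
  have dE : dotp x E = dotp x (X s w) - 1 - (s - t) * bet - (B s w - B t w) * c.
    by rewrite /E !dotpBr !dotpZr -(sqr_enorm_row x) x1 expr1n.
  have xX : dotp x (X s w) <= 1.
    apply: (le_trans (ler_norm _)); apply: (le_trans (norm_dotp_le _ _)).
    by rewrite x1 mul1r; apply: h3; rewrite in_itv /= sT ltW.
  have := norm_dotp_le x E; rewrite x1 mul1r dE ler_norml => /andP[h _].
  lra.
have h00 n := dyadic_step_gt0 R n.
have tT0 : 0 < Num.min (T - t) 1 by rewrite lt_min subr_gt0 tT ltr01.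
have [n1 Hn1] := dyadic_step_small tT0.
have step n : (n1 <= n)%N -> [/\ t < t + dyadic_step R n, t + dyadic_step R n <= T &
    t + dyadic_step R n <= t + 1].
  move=> nn; have := Hn1 n nn; rewrite le_min => /andP[s1 s2].
  by rewrite ltrDl h00 lerD2l dyadic_step_le1; split => //; lra.
have c0 : c = 0.
  apply/eqP; apply/negPn/negP => cn0.
  have cp : 0 < `|c| by rewrite normr_gt0.
  (* The increment is read backwards when [c] is negative, so that on [F n] the product of [c] with
     the forward increment is always at least [|c| * h ^ H]. *)
  pose lo n := if 0 < c then t else t + dyadic_step R n.
  pose hi n := if 0 < c then t + dyadic_step R n else t.
  have incE n w : `|c| * increment B (lo n) (hi n) w = (B (t + dyadic_step R n) w - B t w) * c.
    rewrite /lo /hi; case: (ltgtP 0 c) => [cpos|cneg|ce].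
    - by rewrite [`|c|]gtr0_norm //= mulrC.
    - by rewrite [`|c|]ltr0_norm //= /increment; ring.
    - by rewrite -ce normr0 mul0r mulr0.
  have lohi n : [/\ 0 <= lo n, 0 <= hi n, lo n != hi n & `|hi n - lo n| = dyadic_step R n].
    have h0 := h00 n; have ne : t != t + dyadic_step R n by rewrite lt_eqF // ltrDl.
    rewrite /lo /hi; case: ifP => _; split; rewrite ?addr_ge0 ?(ltW h0) //.
    - by rewrite addrC addKr ger0_norm // ltW.
    - by rewrite eq_sym.
    - by rewrite opprD addNKr normrN ger0_norm // ltW.
  have [p pp Hpos] := fbm_increment_positive Hp B_fbm ler01.
  pose F n := [set w | 1 * `|hi n - lo n| `^ H <= increment B (lo n) (hi n) w].
  have mF n : measurable (F n).
    by rewrite -[X in measurable X]setTI; apply: measurable_fun_ler.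
  apply: (@ae_not_eventually_avoid _ _ _ P F p 0 pp mF).
    by move=> n _; have [l1 l2 l3 _] := lohi n; apply: Hpos.
  move: goodae; apply: filterS => w [C C0 HC].
  (* On [F n] the inequality in [good] would give [|c| * h ^ H <= (C + |bet|) * h], which fails once
     [D * h ^ (1 - H) <= |c| / 2]. How small [h] has to be depends on [w] through [C], so the events
     are avoided only eventually. *)
  pose D := C + `|bet| + 1.
  have D0 : 0 < D by rewrite ltr_wpDl // addr_ge0.
  have H10 : 0 < 1 - H by rewrite subr_gt0.
  have cp2 : 0 < `|c| / 2 by rewrite divr_gt0.
  have [eta /andP[eta0 eta1] Heta] := exists_small_powR D0 cp2 H10.
  have [n2 Hn2] := dyadic_step_small eta0.
  exists (maxn n1 n2) => n; rewrite geq_max => /andP[nn1 nn2].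
  have [_ _ _ dist] := lohi n; have [s1 s2 s3] := step n nn1.
  rewrite /F /= dist mul1r => inc.
  set h := dyadic_step R n in dist inc s1 s2 s3; have h0 : 0 < h := h00 n.
  have h1 : h <= 1 := dyadic_step_le1 _ n.
  have := HC (t + h) s1 s2 s3; rewrite -incE [t + h - t]addrC addKr => main.
  have thh : h `^ th <= h.
    by rewrite -[leRHS]powRr1 ?(ltW h0) //; apply: ge_powR_exponent; rewrite ?(ltW h0) // ltW.
  have q1 : C * h `^ th <= C * h by rewrite ler_wpM2l.
  have q2 : - (h * bet) <= h * `|bet|.
    by rewrite -mulrN ler_wpM2l ?(ltW h0) // -normrN ler_norm.
  have q3 : `|c| * h `^ H <= `|c| * increment B (lo n) (hi n) w by rewrite ler_wpM2l.
  have q4 : D * h `^ (1 - H) <= `|c| / 2.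
    apply: (le_trans _ Heta); rewrite ler_wpM2l ?(ltW D0) //.
    by apply: le_powR_base; [exact: ltW | exact: ltW | exact: Hn2].
  have hH : h `^ H * h `^ (1 - H) = h.
    by rewrite -powRD_gt0 // addrC subrK powRr1 // ltW.
  have hHp : 0 < h `^ H by rewrite powR_gt0.
  have q5 : h `^ H * (D * h `^ (1 - H)) <= h `^ H * (`|c| / 2) by rewrite ler_wpM2l // ltW.
  have q6 : h `^ H * (D * h `^ (1 - H)) = D * h by rewrite mulrCA hH.
  have q7 : 0 < `|c| * h `^ H by rewrite mulr_gt0.
  have q8 : `|c| * h `^ H <= (C + `|bet|) * h by lra.
  have q9 : (C + `|bet|) * h <= D * h by rewrite ler_wpM2r ?(ltW h0) // lerDl.
  lra.
split => //; rewrite -/bet.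
(* With [c = 0] the noise has disappeared: a single good [w] suffices, and dividing by [h] leaves
   [bet <= C * h ^ (th - 1)]. *)
have [w [C C0 HC]] := ae_inhabited goodae.
apply/ler_addgt0Pr => e e0; rewrite add0r.
have C10 : 0 < C + 1 by rewrite ltr_wpDl.
have th10 : 0 < th - 1 by rewrite subr_gt0.
have [eta /andP[eta0 eta1] Heta] := exists_small_powR C10 e0 th10.
have [n2 Hn2] := dyadic_step_small eta0.
pose n := maxn n1 n2; pose h := dyadic_step R n; have h0 : 0 < h := h00 n.
have [s1 s2 s3] := step n (leq_maxl _ _).
have := HC (t + h) s1 s2 s3; rewrite c0 mulr0 addr0 [t + h - t]addrC addKr.
rewrite -mulr_powRB1 ?(ltW h0) ?(lt_trans ltr01) // mulrCA ler_pM2l // => hb.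
apply: (le_trans hb); apply: (le_trans _ Heta); apply: ler_pM; rewrite ?powR_ge0 ?lerDl //.
by apply: le_powR_base; [exact: ltW | exact: ltW | apply: Hn2; rewrite leq_maxr].
Qed.

Lemma tangent_of_viable : viable P T alpha b sigma B (@unit_ball R d) ->
  forall t : R, t \in `[0, T] -> forall x : 'rV[R]_d, enorm x = 1 ->
    dotp x (b t x) <= 0 /\ dotp x (sigma t x) = 0.
Proof.
move=> viab t; rewrite in_itv /= => /andP[t0 tT] x x1.
have [tltT|Tle] := ltP t T; first exact: tangent_of_viable_lt.
have -> : t = T by apply/eqP; rewrite eq_le tT Tle.
have a0 := alpha_gt0.
have [p0 pb _ pm _] := path_exponent_facts a0 alpha_lt sigma_H1 mu_bnd.
have mu0 : 0 < mu by apply: lt_le_trans pm.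
have [/andP[be0 _] _ _ [Ms Ms0 Hs] _] := sigma_H1.
have TT : T \in `[0, T] by rewrite in_itv /= lexx ltW.
have approach (e A r : R) : 0 < e -> 0 < A -> 0 < r ->
    exists2 s, 0 <= s < T & A * `|T - s| `^ r <= e.
  move=> e0 A0 r0; have [tau /andP[tau0 _] Htau] := exists_small_powR A0 e0 r0.
  have m0 : 0 < Num.min tau T by rewrite lt_min tau0.
  exists (T - Num.min tau T); first by rewrite subr_ge0 ge_min lexx orbT /= gtrBl.
  apply: (le_trans _ Htau); rewrite ler_wpM2l ?(ltW A0) // opprB addrC subrK ger0_norm ?(ltW m0) //.
  by apply: le_powR_base; rewrite ?(ltW r0) ?(ltW m0) // ge_min lexx.
have dotle (u v : 'rV[R]_d) : `|dotp x u - dotp x v| <= enorm (u - v).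
  by rewrite -dotpBr (le_trans (norm_dotp_le _ _)) // x1 mul1r.
split.
  apply/ler_addgt0Pr => e e0; rewrite add0r.
  have [s /andP[s0 sT] hs] := approach e L mu e0 L0 mu0.
  have [h _] := tangent_of_viable_lt s0 sT x1 viab.
  have sin : s \in `[0, T] by rewrite in_itv /= s0 ltW.
  have x1' : enorm x <= 1 by rewrite x1.
  have := b_lip sin TT x1' x1'; rewrite subrr enorm0 addr0 => hb.
  have := dotle (b T x) (b s x); rewrite ler_norml => /andP[_ hd]; lra.
apply/eqP; rewrite -normr_le0; apply/ler_addgt0Pr => e e0; rewrite add0r.
have [s /andP[s0 sT] hs] := approach e Ms beta e0 Ms0 be0.
have [_ h] := tangent_of_viable_lt s0 sT x1 viab.
have sin : s \in `[0, T] by rewrite in_itv /= s0 ltW.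
have := Hs s T sin TT x x; rewrite subrr enorm0 addr0 => hb.
have := dotle (sigma T x) (sigma s x); rewrite h subr0; lra.
Qed.

End UnitBallViability.

Unset Implicit Arguments.

Theorem proposition3p7 (R : realType) (disp : measure_display)
    (Omega : measurableType disp) (P : probability Omega R)
    (P_complete : measure_is_complete P)
    (T : R) (T_gt0 : 0 < T) (d : nat) (d_ge1 : (1 <= d)%N)
    (H : R) (H_gt : 2^-1 < H) (H_lt1 : H < 1)
    (B : R -> {RV P >-> R}) (B_fbm : fractional_brownian_motion H B)
    (b sigma : R -> 'rV[R]_d -> 'rV[R]_d)
    (b_cont : continuous_coef T b) (sigma_cont : continuous_coef T sigma)
    (beta delta : R)
    (sigma_H1 : assumption_H1 T beta delta sigma)
    (b_H2 : assumption_H2 T beta delta b)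
    (alpha : R) (alpha_gt : 1 - H < alpha) (alpha_lt : alpha < alpha0 beta delta) :
  viable P T alpha b sigma B (@unit_ball R d) <->
  (forall t : R, t \in `[0, T] -> forall x : 'rV[R]_d, enorm x = 1 ->
     dotp x (b t x) <= 0 /\ dotp x (sigma t x) = 0).
Proof.
have [mu mu_bnd [b_loc _]] := b_H2.
(* All trajectories considered stay in the unit ball, so the local Lipschitz condition enters at
   radius 1. *)
have [L L0 b_lip] := b_loc 1 ler01.
split.
  exact: (tangent_of_viable T_gt0 H_gt H_lt1 B_fbm sigma_H1 alpha_gt alpha_lt mu_bnd L0 b_lip).
exact: (viable_of_tangent T_gt0 H_gt H_lt1 B_fbm sigma_H1 alpha_gt alpha_lt mu_bnd L0 b_lip).
Qed.
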